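(* Let $\mathcal{M}$ be a Riemannian manifold, let $f \colon \mathcal{M} \to \mathbb{R}$ be of class $\mathrm{C}^2$, let $\bar x$ be a local minimum of $f$, let $f_{\mathcal{S}} = f(\bar x)$ and $\mathcal{S} = \{x \in \mathcal{M} : x \text{ is a local minimum of } f \text{ and } f(x) = f_{\mathcal{S}}\}$, and let $\mu > 0$. Suppose that $f$ satisfies $\mu$-PŁ around $\bar x$, that is, $f(x) - f_{\mathcal{S}} \leq \frac{1}{2\mu}\|\nabla f(x)\|^2$ for all $x$ in some neighborhood of $\bar x$. Then $f$ satisfies the $\mu$-Morse–Bott property at $\bar x$, that is: $\mathcal{S}$ is a $\mathrm{C}^1$ submanifold around $\bar x$, $\ker \nabla^2 f(\bar x) = \mathrm{T}_{\bar x}\mathcal{S}$, and $\langle v, \nabla^2 f(\bar x)[v]\rangle \geq \mu\|v\|^2$ for all $v \in \mathrm{N}_{\bar x}\mathcal{S}$. The same conclusion holds if, instead of $\mu$-PŁ, $f$ satisfies $\mu$-EB around $\bar x$ (that is, $\mu\,\mathrm{dist}(x, \mathcal{S}) \leq \|\nabla f(x)\|$ for all $x$ in some neighborhood of $\bar x$), or $\mu$-QG around $\bar x$ (that is, $f(x) - f_{\mathcal{S}} \geq \frac{\mu}{2}\mathrm{dist}(x, \mathcal{S})^2$ for all $x$ in some neighborhood of $\bar x$).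
   Context: $\mathcal{M}$ is a smooth finite-dimensional Riemannian manifold with Riemannian distance $\mathrm{dist}$; $\nabla f$, $\nabla^2 f$ are the Riemannian gradient and Hessian; $\mathrm{dist}(x, \mathcal{S}) = \inf_{y \in \mathcal{S}} \mathrm{dist}(x, y)$. ''Submanifold'' means embedded submanifold; $\mathrm{T}_{\bar x}\mathcal{S}$ is its tangent space at $\bar x$ and the normal space $\mathrm{N}_{\bar x}\mathcal{S}$ is the orthogonal complement of $\mathrm{T}_{\bar x}\mathcal{S}$ in $\mathrm{T}_{\bar x}\mathcal{M}$. *)

(* Defs.v *)
From HB Require Import structures.
From mathcomp Require Import all_boot all_order all_algebra.
From mathcomp Require Import all_classical all_reals all_analysis.

Set Implicit Arguments.
Unset Strict Implicit.
Unset Printing Implicit Defensive.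

Import Order.TTheory GRing.Theory Num.Theory.
Import numFieldNormedType.Exports.

Local Open Scope classical_set_scope.
Local Open Scope ring_scope.

(* Class C^k on U, meaningful when U is open. *)
Fixpoint Ck_on (R : realType) (V W : normedModType R) (k : nat)
    (U : set V) (f : V -> W) : Prop :=
  match k with
  | 0 => forall x, U x -> {for x, continuous f}
  | k'.+1 => (forall x, U x -> differentiable f x) /\
             (forall v, Ck_on k' U (fun x => 'D_v f x))
  end.

(* [chart_inv] is only meaningful on [chart_cod]. *)
Record chart (R : realType) (n : nat) (T : topologicalType) := Chart {
  chart_dom : set T;
  chart_map : T -> 'rV[R]_n;
  chart_inv : 'rV[R]_n -> T;
  chart_cod := chart_map @` chart_dom;
  chart_dom_open : open chart_dom;
  chart_cod_open : open chart_cod;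
  chart_mapK : forall x, chart_dom x -> chart_inv (chart_map x) = x;
  chart_map_continuous :
    forall x, chart_dom x -> {for x, continuous chart_map};
  chart_inv_continuous :
    forall u, chart_cod u -> {for u, continuous chart_inv}
}.

Section charts.
Context {R : realType} {n : nat} {T : topologicalType}.
Implicit Types c : chart R n T.

Definition transition c c' : 'rV[R]_n -> 'rV[R]_n :=
  chart_map c' \o chart_inv c.

Definition overlap c c' : set 'rV[R]_n :=
  chart_map c @` (chart_dom c `&` chart_dom c').

Definition Ck_compatible (k : nat) c c' : Prop :=
  Ck_on k (overlap c c') (transition c c') /\
  Ck_on k (overlap c' c) (transition c' c).

End charts.

(* A smooth n-dimensional Riemannian manifold.  [metric c u] is the Gram matrix
   (g_ij) of the metric in the chart c at the coordinates u, and [metric_change]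
   is the transformation law of a covariant 2-tensor.
   A tangent vector at x is represented by its row
   of coordinates in the preferred chart [chart_at x]; vectors are rows, so a
   tangent vector with coordinates v in c has coordinates
   [v *m 'J (transition c c') u] in c'. *)
Record riemannianManifold (R : realType) (n : nat) := RiemannianManifold {
  manifold_sort :> topologicalType;
  manifold_hausdorff : hausdorff_space manifold_sort;
  manifold_second_countable : @second_countable manifold_sort;
  atlas : set (chart R n manifold_sort);
  chart_at : manifold_sort -> chart R n manifold_sort;
  chart_at_atlas : forall x, atlas (chart_at x);
  chart_at_dom : forall x, chart_dom (chart_at x) x;
  atlas_smooth : forall k c c', atlas c -> atlas c' -> Ck_compatible k c c';
  metric : chart R n manifold_sort -> 'rV[R]_n -> 'M[R]_n;
  metric_sym : forall c u, atlas c -> chart_cod c u ->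
    (metric c u)^T = metric c u;
  metric_pos : forall c u (v : 'rV[R]_n), atlas c -> chart_cod c u -> v != 0 ->
    0 < (v *m metric c u *m v^T) 0 0;
  metric_smooth : forall k c, atlas c -> Ck_on k (chart_cod c) (metric c);
  metric_change : forall c c' x, atlas c -> atlas c' ->
    chart_dom c x -> chart_dom c' x ->
    let J := 'J (transition c c') (chart_map c x) in
    metric c (chart_map c x) = J *m metric c' (chart_map c' x) *m J^T
}.

Section riemannian.
Context {R : realType} {n : nat} {M : riemannianManifold R n}.
Implicit Types (x y : M) (v w : 'rV[R]_n) (f : M -> R) (S : set M).

Definition Ck_function (k : nat) (W : normedModType R) (f : M -> W) : Prop :=
  forall c, atlas c -> Ck_on k (chart_cod c) (f \o chart_inv c).

Definition inner x v w : R :=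
  (v *m metric (chart_at x) (chart_map (chart_at x) x) *m w^T) 0 0.

Definition rnorm x v : R := Num.sqrt (inner x v v).

Definition Ck_curve (k : nat) (I : set R) (gamma : R -> M) : Prop :=
  (forall t, I t -> {for t, continuous gamma}) /\
  forall c, atlas c ->
    Ck_on k (I `&` gamma @^-1` chart_dom c) (chart_map c \o gamma).

Definition velocity (gamma : R -> M) (t : R) : 'rV[R]_n :=
  derive1 (chart_map (chart_at (gamma t)) \o gamma) t.

(* C^1 on a closed interval: agrees there with a C^1 curve defined on an open
   neighbourhood of the interval. *)
Definition C1_segment (a b : R) (gamma : R -> M) : Prop :=
  exists delta : R -> M, exists I : set R,
    [/\ open I, `[a, b] `<=` I, Ck_curve 1 I delta &
        forall t, t \in `[a, b] -> gamma t = delta t].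

Definition piecewise_C1 (gamma : R -> M) : Prop :=
  exists s : seq R,
    [/\ path <%R 0 s, last 0 s = 1 &
        forall i, (i < size s)%N ->
          C1_segment (nth 0 (0 :: s) i) (nth 0 (0 :: s) i.+1) gamma].

Definition curve_length (gamma : R -> M) : \bar R :=
  (\int[lebesgue_measure]_(t in `[0%R, 1%R])
      (rnorm (gamma t) (velocity gamma t))%:E)%E.

(* +oo between points of distinct connected components. *)
Definition rdist x y : \bar R :=
  ereal_inf [set curve_length gamma | gamma in
    [set gamma : R -> M | [/\ piecewise_C1 gamma, gamma 0 = x & gamma 1 = y]]].

Definition set_dist x S : \bar R := ereal_inf [set rdist x y | y in S].

Definition local_grad (c : chart R n M) f (u : 'rV[R]_n) : 'rV[R]_n :=
  (\row_i 'D_(delta_mx 0 i) (f \o chart_inv c) u) *m invmx (metric c u).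

Definition grad f x : 'rV[R]_n :=
  local_grad (chart_at x) f (chart_map (chart_at x) x).

(* Gamma^k_ij of the Levi-Civita connection. *)
Definition christoffel (c : chart R n M) (u : 'rV[R]_n) (i j k : 'I_n) : R :=
  2^-1 * \sum_l invmx (metric c u) k l *
    ('D_(delta_mx 0 i) (fun w => metric c w j l) u
     + 'D_(delta_mx 0 j) (fun w => metric c w i l) u
     - 'D_(delta_mx 0 l) (fun w => metric c w i j) u).

Definition covariant_derivative (c : chart R n M)
    (X : 'rV[R]_n -> 'rV[R]_n) (u v : 'rV[R]_n) : 'rV[R]_n :=
  'D_v X u +
  \row_k \sum_i \sum_j christoffel c u i j k * v 0 i * X u 0 j.

(* Hess f(x)[v] = nabla_v grad f. *)
Definition hess f x v : 'rV[R]_n :=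
  covariant_derivative (chart_at x) (local_grad (chart_at x) f)
    (chart_map (chart_at x) x) v.

Definition local_min f x : Prop := \forall y \near x, f x <= f y.

(* Every point of S has a slice chart of class C^k. *)
Definition embedded_submanifold (k : nat) S : Prop :=
  exists2 d : nat, (d <= n)%N & forall x, S x ->
    exists s : chart R n M,
      [/\ chart_dom s x,
          forall c, atlas c -> Ck_compatible k s c &
          forall y, chart_dom s y ->
            (S y <-> forall i : 'I_n, (d <= i)%N -> chart_map s y 0 i = 0)].

Definition submanifold_around (k : nat) S x : Prop :=
  exists2 U : set M, open_nbhs x U & embedded_submanifold k (S `&` U).

(* Only meant for S a C^1 submanifold around x. *)
Definition tangent_space S x : set 'rV[R]_n :=
  [set v | exists gamma : R -> M, exists2 e : R, 0 < e &
    [/\ Ck_curve 1 `]- e, e[ gamma, forall t, t \in `]- e, e[ -> S (gamma t),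
        gamma 0 = x & velocity gamma 0 = v]].

Definition normal_space S x : set 'rV[R]_n :=
  [set v | forall w, tangent_space S x w -> inner x v w = 0].

Definition min_set f (xbar : M) : set M :=
  [set x | local_min f x /\ f x = f xbar].

Definition PL (mu : R) f (xbar : M) : Prop :=
  \forall x \near xbar,
    f x - f xbar <= (2 * mu)^-1 * rnorm x (grad f x) ^+ 2.

Definition EB (mu : R) f (xbar : M) : Prop :=
  \forall x \near xbar,
    (mu%:E * set_dist x (min_set f xbar) <= (rnorm x (grad f x))%:E)%E.

Definition QG (mu : R) f (xbar : M) : Prop :=
  \forall x \near xbar,
    ((mu / 2)%:E * set_dist x (min_set f xbar) ^+ 2 <= (f x - f xbar)%:E)%E.

Definition morse_bott (mu : R) f (xbar : M) : Prop :=
  [/\ submanifold_around 1 (min_set f xbar) xbar,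
      [set v | hess f xbar v = 0] = tangent_space (min_set f xbar) xbar &
      forall v, normal_space (min_set f xbar) xbar v ->
        mu * rnorm xbar v ^+ 2 <= inner xbar v (hess f xbar v)].

End riemannian.

(* Main.v *)
(* Each hypothesis is reduced to an error bound in a single chart at xbar, where
   the metric is replaced by its value G at xbar at the cost of shrinking mu
   slightly.  The chart only has to provide lower bounds for the Riemannian
   distance, and these follow from the fact that a curve leaving a coordinate
   ball is at least (almost) as long as its radius.

   In the chart, write F for f and A for its Hessian at xbar.  PL with constant
   mu gives QG with every mu' < mu: a minimizer of sqrt (F - F xbar) + a |. - u|
   over a ball violates PL unless it lies on the solution set.  QG gives EB by a
   second-order Taylor expansion at the nearest solution.  So assume EB
   with every constant below mu.

   Let P be a linear map of rank rank A whose restriction to the range of A is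
   injective.  Near xbar the solution set is {P (grad F) = 0}: if z is a nearest
   solution to x, then grad F x = (x - z) A + o(|x - z|), which EB turns into
   (x - z) A + o(|grad F x|), so P (grad F x) = 0 forces grad F x = 0, and EB
   then puts x on the solution set.  As P (grad F) is a submersion, the inverse
   function theorem straightens this set, with tangent space ker A.

   Finally EB at xbar + t v gives |A v| >= mu |v| for v normal to ker A.  Applied
   to the normal w with A w = v this gives |w| <= |v| / mu, and Cauchy-Schwarz
   for the semidefinite form A yields
   |v|^4 = <w, A v>^2 <= <w, A w> <v, A v> <= |v|^2 / mu <v, A v>. *)
Require Import Defs.
From HB Require Import structures.
From mathcomp Require Import all_boot all_order all_algebra.
From mathcomp Require Import all_classical all_reals all_analysis.
From mathcomp Require Import measurable_realfun ring lra.
Set Implicit Arguments.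
Unset Strict Implicit.
Unset Printing Implicit Defensive.
Import Order.TTheory GRing.Theory Num.Theory.
Import numFieldNormedType.Exports.
Local Open Scope classical_set_scope.
Local Open Scope ring_scope.

(** * Quadratic forms and norms *)

Section bilinear_forms.
Context {R : realType} {n : nat}.
Implicit Types (G A : 'M[R]_n) (u v w p : 'rV[R]_n).

(** No nearest solution is ever chosen. Every estimate works with some solution [z] that satisfies
    the inequality and lies within a prescribed radius of the base point; infima are only
    approached. The slack between [mu] and a smaller constant pays for this and for freezing the
    metric, and it is recovered in the coercivity estimate, where the smaller constants tend to
    [mu].

    Solutions close to the base point are again local minima, hence critical points. This removes
    the first-order term of expansions at [z], and it removes the Christoffel terms from the
    Riemannian Hessian at the base point. As [f] is only C^2, an expansion at a moving [z] with the
    Hessian frozen at the base point relies on strict differentiability of the gradient, an estimate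
    in which both points vary.

    The system grad F = 0 has n equations of rank only rank A, too degenerate for an implicit
    function argument. The map P keeps just enough of them, and the error bound is what shows that
    no spurious solution appears. *)

Definition bform G v w : R := (v *m G *m w^T) 0 0.
Definition gnorm G v : R := Num.sqrt (bform G v v).
Definition posdef G := G^T = G /\ forall v, v != 0 -> 0 < bform G v v.
Definition psd G := G^T = G /\ forall v, 0 <= bform G v v.

Lemma bformDl G u v w : bform G (u + v) w = bform G u w + bform G v w.
Proof. by rewrite /bform !mulmxDl mxE. Qed.
Lemma bformDr G u v w : bform G u (v + w) = bform G u v + bform G u w.
Proof. by rewrite /bform linearD /= mulmxDr mxE. Qed.
Lemma bformZl G a v w : bform G (a *: v) w = a * bform G v w.
Proof. by rewrite /bform -!scalemxAl mxE. Qed.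
Lemma bformZr G a v w : bform G v (a *: w) = a * bform G v w.
Proof. by rewrite /bform linearZ /= -!scalemxAr mxE. Qed.
Lemma bformNr G v w : bform G v (- w) = - bform G v w.
Proof. by rewrite -scaleN1r bformZr mulN1r. Qed.
Lemma bform0l G w : bform G 0 w = 0.
Proof. by rewrite -(scale0r 0) bformZl mul0r. Qed.
Lemma bformC G v w : G^T = G -> bform G v w = bform G w v.
Proof.
move=> GT; rewrite /bform; transitivity ((v *m G *m w^T)^T 0 0).
  by rewrite [RHS]mxE.
by rewrite !trmx_mul trmxK GT mulmxA.
Qed.

Lemma posdef_psd G : posdef G -> psd G.
Proof.
move=> [GT G0]; split=> // v; have [->|/G0/ltW//] := eqVneq v 0.
by rewrite bform0l.
Qed.

(** The form along the line [v + t *: w] is a nonnegative polynomial in [t], evaluated at its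
    minimum. Semidefiniteness leaves the case where [w] is isotropic; the polynomial is then affine
    and must be constant. The Hessian is such a form. *)
Lemma cauchy_schwarz_sq G v w : psd G ->
  bform G v w ^+ 2 <= bform G v v * bform G w w.
Proof.
move=> [GT G0].
have H t : 0 <= bform G v v + 2 * t * bform G v w + t ^+ 2 * bform G w w.
  have := G0 (v + t *: w).
  rewrite !(bformDl, bformDr, bformZl, bformZr) (bformC w v GT) => h.
  by apply: le_trans h _; rewrite le_eqVlt; apply/orP; left; apply/eqP; ring.
have := G0 w; rewrite le_eqVlt => /orP[/eqP w0|w0].
  rewrite -w0 mulr0; have [->|b0] := eqVneq (bform G v w) 0; first by rewrite expr0n.
  (* At this [t] the affine polynomial takes the value -1. *)
  have := H (- (1 + bform G v v) / (2 * bform G v w)); rewrite -w0 mulr0 addr0.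
  have -> : 2 * (- (1 + bform G v v) / (2 * bform G v w)) * bform G v w = - (1 + bform G v v).
    by field.
  by move: H GT => _ _ {G0} ?; exfalso; lra.
have := H (- bform G v w / bform G w w).
have -> : bform G v v + 2 * (- bform G v w / bform G w w) * bform G v w +
   (- bform G v w / bform G w w) ^+ 2 * bform G w w =
   (bform G v v * bform G w w - bform G v w ^+ 2) / bform G w w.
  by field; rewrite gt_eqF// unfold_in.
by rewrite pmulr_lge0 ?invr_gt0// subr_ge0.
Qed.

Lemma gnorm_ge0 G v : 0 <= gnorm G v.
Proof. exact: sqrtr_ge0. Qed.

Lemma gnorm0 G : gnorm G 0 = 0.
Proof. by rewrite /gnorm bform0l sqrtr0. Qed.

Lemma sqr_gnorm G v : psd G -> gnorm G v ^+ 2 = bform G v v.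
Proof. by move=> [_ G0]; rewrite /gnorm sqr_sqrtr. Qed.

Lemma gnormZ G a v : gnorm G (a *: v) = `|a| * gnorm G v.
Proof.
by rewrite /gnorm bformZl bformZr mulrA -expr2 sqrtrM ?sqr_ge0// sqrtr_sqr.
Qed.

Lemma gnormN G v : gnorm G (- v) = gnorm G v.
Proof. by rewrite -scaleN1r gnormZ normrN normr1 mul1r. Qed.

Lemma cauchy_schwarz G v w : psd G -> `|bform G v w| <= gnorm G v * gnorm G w.
Proof.
move=> G0; rewrite -(@ler_pXn2r _ 2)// ?nnegrE ?mulr_ge0 ?gnorm_ge0//.
by rewrite exprMn !sqr_gnorm// real_normK ?num_real// cauchy_schwarz_sq.
Qed.

Lemma bform_le G v w : psd G -> bform G v w <= gnorm G v * gnorm G w.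
Proof. by move=> G0; apply: le_trans (cauchy_schwarz _ _ G0); exact: ler_norm. Qed.

Lemma gnormD G v w : psd G -> gnorm G (v + w) <= gnorm G v + gnorm G w.
Proof.
move=> G0; rewrite -(@ler_pXn2r _ 2)// ?nnegrE ?addr_ge0 ?gnorm_ge0//.
rewrite sqr_gnorm// sqrrD !sqr_gnorm// bformDl !bformDr (bformC w v G0.1).
by have := bform_le v w G0; lra.
Qed.

Lemma gnorm_gt0 G v : posdef G -> v != 0 -> 0 < gnorm G v.
Proof. by move=> [_ G0] /G0; rewrite /gnorm sqrtr_gt0. Qed.

Lemma posdef_unitmx G : posdef G -> G \in unitmx.
Proof.
move=> [_ G0]; rewrite -row_free_unit -kermx_eq0; apply/eqP/row_matrixP => i.
rewrite row0; apply/eqP; apply: contraT => /G0.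
by rewrite /bform -row_mul mulmx_ker row0 mul0mx mxE ltxx.
Qed.

(** [p *m invmx G] is the Riesz representative of the covector [p], so this is Cauchy-Schwarz for
    [G]; its first factor is the dual norm of [p]. *)
Lemma dot_le G p v : posdef G ->
  (p *m v^T) 0 0 <= gnorm G (p *m invmx G) * gnorm G v.
Proof.
move=> G0; have := bform_le (p *m invmx G) v (posdef_psd G0).
by rewrite /bform mulmxKV// posdef_unitmx.
Qed.

Lemma dual_sqr G p : posdef G ->
  gnorm G (p *m invmx G) ^+ 2 = (p *m (p *m invmx G)^T) 0 0.
Proof.
move=> G0; rewrite sqr_gnorm; last exact: posdef_psd.
by rewrite /bform mulmxKV// posdef_unitmx.
Qed.

End bilinear_forms.

Section norm_bounds.
Context {R : realType}.

Lemma entry_le m n (A : 'M[R]_(m, n)) i j : `|A i j| <= `|A|.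
Proof.
by rewrite [leRHS]/Num.Def.normr/= mx_normrE; exact: (le_bigmax _ (fun x => `|A x.1 x.2|) (i, j)).
Qed.

Lemma mx_norm_le m n (A : 'M[R]_(m, n)) e : 0 <= e ->
  (forall i j, `|A i j| <= e) -> `|A| <= e.
Proof.
move=> e0 H; rewrite [leLHS]/Num.Def.normr/= mx_normrE; apply: bigmax_le => // -[i j] _ /=.
Qed.

Lemma dot_norm_le n (a b : 'rV[R]_n) : `|(a *m b^T) 0 0| <= n%:R * (`|a| * `|b|).
Proof.
rewrite mxE; apply: le_trans (ler_norm_sum _ _ _) _.
apply: (@le_trans _ _ (\sum_(i < n) `|a| * `|b|)).
  by apply: ler_sum => i _; rewrite normrM mxE ler_pM// entry_le.
by rewrite sumr_const card_ord mulr_natl.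
Qed.

Lemma dotC n (a b : 'rV[R]_n) : (a *m b^T) 0 0 = (b *m a^T) 0 0.
Proof. by rewrite !mxE; apply: eq_bigr => i _; rewrite !mxE mulrC. Qed.

Lemma dotBr n (h a b : 'rV[R]_n) :
  (h *m (a - b)^T) 0 0 = (h *m a^T) 0 0 - (h *m b^T) 0 0.
Proof. by rewrite linearB/= mulmxBr mxE; congr (_ + _); rewrite mxE. Qed.

Lemma mulmx_norm_le m n p (A : 'M[R]_(m, n)) (B : 'M[R]_(n, p)) :
  `|A *m B| <= n%:R * (`|A| * `|B|).
Proof.
apply: mx_norm_le => [|i j]; first by rewrite !mulr_ge0.
rewrite mxE; apply: le_trans (ler_norm_sum _ _ _) _.
apply: (@le_trans _ _ (\sum_(i < n) `|A| * `|B|)).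
  by apply: ler_sum => k _; rewrite normrM ler_pM// entry_le.
by rewrite sumr_const card_ord mulr_natl.
Qed.

Lemma mulmx_bound n p (B : 'M[R]_(n, p)) :
  exists2 C, 0 < C & forall v : 'rV_n, `|v *m B| <= C * `|v|.
Proof.
exists (n%:R * `|B| + 1); first by rewrite ltr_wpDl// mulr_ge0.
move=> v; apply: le_trans (mulmx_norm_le _ _) _.
by rewrite mulrDl -mulrA [`|B| * _]mulrC lerDl mul1r.
Qed.

Lemma bform_norm_le n (G : 'M[R]_n) :
  exists2 C, 0 < C & forall v w, `|bform G v w| <= C * (`|v| * `|w|).
Proof.
have [C C0 HC] := mulmx_bound G.
exists (n%:R * C + 1); first by rewrite ltr_wpDl// mulr_ge0// ltW.
move=> v w; apply: le_trans (dot_norm_le _ _) _.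
apply: (@le_trans _ _ (n%:R * C * (`|v| * `|w|))).
  by rewrite -!mulrA ler_wpM2l// mulrA ler_wpM2r.
by rewrite ler_wpM2r ?mulr_ge0// lerDl.
Qed.

Lemma gnorm_le n (G : 'M[R]_n) :
  exists2 C, 0 < C & forall v, gnorm G v <= C * `|v|.
Proof.
have [C C0 HC] := bform_norm_le G.
exists (Num.sqrt C); first by rewrite sqrtr_gt0.
move=> v; rewrite -[`|v|]ger0_norm// -sqrtr_sqr -sqrtrM ?(ltW C0)//.
apply: ler_wsqrtr; apply: le_trans (HC v v); exact: ler_norm.
Qed.

(** Each coordinate is a linear functional, bounded by its dual norm times [gnorm G v]; [C] adds up
    these dual norms, so no compactness of the sphere is used. *)
Lemma norm_le_gnorm n (G : 'M[R]_n) : posdef G ->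
  exists2 C, 0 < C & forall v, `|v| <= C * gnorm G v.
Proof.
move=> G0; pose C := \sum_(i < n) gnorm G (delta_mx 0 i *m invmx G).
have C0 : 0 <= C by rewrite sumr_ge0// => i _; exact: gnorm_ge0.
exists (C + 1); first by rewrite ltr_wpDl.
move=> v; apply: mx_norm_le => [|i j].
  by rewrite mulr_ge0 ?gnorm_ge0// addr_ge0.
have E (w : 'rV[R]_n) : w 0 j = ((delta_mx 0 j : 'rV[R]_n) *m w^T) 0 0.
  by rewrite -rowE !mxE.
have K : gnorm G (delta_mx 0 j *m invmx G) <= C + 1.
  rewrite /C (bigD1 j)//= -addrA lerDl addr_ge0// sumr_ge0// => k _.
  exact: gnorm_ge0.
rewrite ord1 ler_norml; apply/andP; split.
  have -> : v 0 j = - (- v) 0 j by rewrite mxE opprK.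
  rewrite lerN2 E; apply: le_trans (dot_le _ _ G0) _.
  by rewrite gnormN ler_wpM2r ?gnorm_ge0.
by rewrite E; apply: le_trans (dot_le _ _ G0) _; rewrite ler_wpM2r ?gnorm_ge0.
Qed.

End norm_bounds.

(** * Strict differentiability and C1 maps *)

Section strict_differentiability.
Context {R : realType}.

Lemma near_norm (V : normedModType R) (x : V) (P : V -> Prop) :
  (\forall y \near x, P y) <-> exists2 d, 0 < d & forall y, `|y - x| < d -> P y.
Proof.
rewrite nbhs_normP; split=> -[d d0 H]; exists d => //= y.
  by rewrite distrC; exact: H.
by rewrite /= distrC; exact: H.
Qed.

Lemma open_norm (V : normedModType R) (A : set V) :
  open A <-> forall x, A x -> exists2 d, 0 < d & forall y, `|y - x| < d -> A y.
Proof.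
by rewrite openE; split=> H x /H => [/near_norm|Ax] //; apply/near_norm.
Qed.

Lemma continuous_norm (V W : normedModType R) (f : V -> W) (x : V) :
  {for x, continuous f} <-> forall e, 0 < e -> exists2 d, 0 < d &
    forall y, `|y - x| < d -> `|f y - f x| <= e.
Proof.
split=> [cf e e0|H].
  have /cvgrPdist_le /(_ _ e0)/near_norm [d d0 Hd] := cf.
  by exists d => // y /Hd; rewrite distrC.
apply/cvgrPdist_le => e e0; have [d d0 Hd] := H _ e0.
by apply/near_norm; exists d => // y /Hd; rewrite distrC.
Qed.

Lemma near_and (V : normedModType R) (x : V) (P Q : V -> Prop) :
  (\forall y \near x, P y) -> (\forall y \near x, Q y) -> \forall y \near x, P y /\ Q y.
Proof. by move=> HP HQ; apply: filterS2 HP HQ => y; exact: conj. Qed.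

Lemma near_forall (V : normedModType R) (I : finType) (x : V) (P : I -> V -> Prop) :
  (forall i, \forall y \near x, P i y) -> \forall y \near x, forall i, P i y.
Proof. exact: filter_forall. Qed.

Lemma is_diff_eps (V W : normedModType R) (f : V -> W) (x : V) (L : {linear V -> W}) :
  continuous L ->
  (forall e, 0 < e -> exists2 d, 0 < d & forall y, `|y - x| < d ->
    `|f y - f x - L (y - x)| <= e * `|y - x|) ->
  is_diff x f L.
Proof.
move=> cL H.
have E : f \o shift x = cst (f x) + (L : V -> W) +o_ 0 id.
  apply/eqaddoP => e e0; have [d d0 Hd] := H _ e0.
  apply/near_norm; exists d => // y; rewrite subr0 => yd.
  have := Hd (y + x); rewrite addrK => /(_ yd).
  have -> : (f \o shift x - (cst (f x) + (L : V -> W))) y = f (y + x) - f x - L y.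
    by rewrite !fctE/= opprD addrA.
  by [].
have D := diff_unique cL E.
by apply: DiffDef => //; apply/diff_locallyP; rewrite D.
Qed.

Lemma is_derive_line (V W : normedModType R) (h : V -> W) (y v : V) (t : R) :
  derivable h (y + t *: v) v ->
  is_derive t 1 (fun s : R => h (y + s *: v)) ('D_v h (y + t *: v)).
Proof.
move=> dh.
have E : (fun s : R =>
    s^-1 *: (((fun s : R => h (y + s *: v)) \o shift t) (s *: 1) - h (y + t *: v)))
  = (fun s : R => s^-1 *: ((h \o shift (y + t *: v)) (s *: v) - h (y + t *: v))).
  apply/funext => s /=; congr (_ *: (h _ - _)).
  by rewrite [s *: 1]mulr1 scalerDl addrCA.
by split; rewrite /derivable /derive E.
Qed.

Lemma is_derive_line_diff (V W : normedModType R) (h : V -> W) (y v : V) (t : R) :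
  differentiable h (y + t *: v) ->
  is_derive t 1 (fun s : R => h (y + s *: v)) ('D_v h (y + t *: v)).
Proof. by move=> dh; apply: is_derive_line; exact: diff_derivable. Qed.

Lemma is_derive_continuous (h : R -> R) (t d : R) : is_derive t 1 h d ->
  {for t, continuous h}.
Proof.
move=> [dh _]; apply: differentiable_continuous; exact/derivable1_diffP.
Qed.

Lemma MVT_line (V : normedModType R) (h : V -> R) (x y : V) :
  (forall t, 0 <= t <= 1 -> differentiable h (y + t *: (x - y))) ->
  exists2 t, 0 <= t <= 1 & h x - h y = 'D_(x - y) h (y + t *: (x - y)).
Proof.
move=> dh.
have D (t : R) : 0 <= t <= 1 -> is_derive t 1 (fun s : R => h (y + s *: (x - y)))
   ('D_(x - y) h (y + t *: (x - y))).
  by move=> t01; apply: is_derive_line; apply: diff_derivable; exact: dh.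
have [|||t] := @MVT_segment R (fun s : R => h (y + s *: (x - y)))
   (fun t => 'D_(x - y) h (y + t *: (x - y))) 0 1.
- exact: ler01.
- move=> t; rewrite in_itv/= => /andP[t0 t1]; apply: D; rewrite !ltW//.
- apply: continuous_in_subspaceT => t; rewrite inE/= in_itv/= => t01.
  exact: is_derive_continuous (D _ t01).
- rewrite in_itv/= => t01; rewrite scale1r scale0r addr0 subr0 mulr1 (addrC y (x - y)) subrK => E.
  by exists t.
Qed.

Definition partials n (h : 'rV[R]_n -> R) (u : 'rV[R]_n) : 'rV[R]_n :=
  \row_i 'D_(delta_mx 0 i) h u.

Lemma derive_partials n (h : 'rV[R]_n -> R) u v : differentiable h u ->
  'D_v h u = (v *m (partials h u)^T) 0 0.
Proof.
move=> dh; rewrite deriveE// [in LHS](matrix_sum_delta v) big_ord1 linear_sum mxE.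
by apply: eq_bigr => i _; rewrite linearZ /= -deriveE// !mxE.
Qed.

Lemma segment_near n (u x y : 'rV[R]_n) d t : `|x - u| < d -> `|y - u| < d ->
  0 <= t <= 1 -> `|y + t *: (x - y) - u| < d.
Proof.
move=> xd yd /andP[t0 t1].
have -> : y + t *: (x - y) - u = (1 - t) *: (y - u) + t *: (x - u).
  by apply/rowP => i; rewrite !mxE; ring.
apply: le_lt_trans (ler_normD _ _) _; rewrite !normrZ !ger0_norm ?subr_ge0//.
have [->|tn0] := eqVneq t 0; first by rewrite subr0 mul1r mul0r addr0.
have : t * `|x - u| < t * d by rewrite ltr_pM2l// lt_def tn0.
have : (1 - t) * `|y - u| <= (1 - t) * d by rewrite ler_wpM2l ?subr_ge0// ltW.
lra.
Qed.

(** The mean value theorem on the segment from [y] to [x] evaluates the partial derivatives at a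
    point still close to [u], where they differ little from those at [u]. *)
Lemma C1_strict_scalar n (h : 'rV[R]_n -> R) (U : set 'rV[R]_n) u :
  open U -> U u -> Ck_on 1 U h -> forall e, 0 < e ->
  exists2 d, 0 < d & forall x y, `|x - u| < d -> `|y - u| < d ->
    `|h x - h y - ((x - y) *m (partials h u)^T) 0 0| <= e * `|x - y|.
Proof.
move=> oU Uu [dh ch] e e0.
(* The factor [n%:R] is the one lost in [dot_norm_le]; adding 1 keeps the quotient meaningful in
   dimension zero. *)
have n0 : 0 < e / (n%:R + 1) by rewrite divr_gt0// ltr_wpDl.
have K : \forall y \near u, forall i : 'I_n,
    `|partials h u 0 i - partials h y 0 i| <= e / (n%:R + 1).
  apply: near_forall => i; have := ch (delta_mx 0 i) u Uu.
  move/cvgrPdist_le => /(_ _ n0); apply: filterS => y.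
  by rewrite !mxE.
have : \forall y \near u, U y /\ forall i : 'I_n,
    `|partials h u 0 i - partials h y 0 i| <= e / (n%:R + 1).
  by apply: filterS2 (open_nbhs_nbhs (conj oU Uu)) K => y Uy.
move/near_norm => [d d0 Hd]; exists d => // x y xd yd.
have [|t t01 ->] := @MVT_line _ h x y.
  by move=> t t01; apply/dh; have [] := Hd _ (segment_near xd yd t01).
have [Uz Hz] := Hd _ (segment_near xd yd t01).
rewrite derive_partials; last exact: dh.
set z := y + _ in Hz *.
have -> : ((x - y) *m (partials h z)^T) 0 0 - ((x - y) *m (partials h u)^T) 0 0
   = ((x - y) *m (partials h z - partials h u)^T) 0 0.
  by rewrite dotBr.
apply: le_trans (dot_norm_le _ _) _.
have : `|partials h z - partials h u| <= e / (n%:R + 1).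
  by apply: mx_norm_le => [|i j]; [exact: ltW | rewrite ord1 mxE [X in _ + X]mxE distrC].
rewrite ler_pdivlMr ?ltr_wpDl// => K1.
rewrite mulrCA mulrC ler_wpM2r//.
apply: le_trans K1; rewrite mulrC ler_wpM2l//.
by rewrite lerDl.
Qed.

(** Both points vary near [u], unlike in Fréchet differentiability. This makes a map bi-Lipschitz
    when [J] is invertible, and it allows gradients to be compared at a moving solution. *)
Definition strict_diff n m (h : 'rV[R]_n -> 'rV[R]_m) (u : 'rV[R]_n) (J : 'M[R]_(n, m)) :=
  forall e, 0 < e -> exists2 d, 0 < d & forall x y, `|x - u| < d -> `|y - u| < d ->
    `|h x - h y - (x - y) *m J| <= e * `|x - y|.

Lemma finite_radius (I : finType) (P : I -> R -> Prop) :
  (forall i d d', d' <= d -> P i d -> P i d') ->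
  (forall i, exists2 d, 0 < d & P i d) -> exists2 d, 0 < d & forall i, P i d.
Proof.
move=> mono ex; pose D i := sval (cid2 (ex i)).
have D0 i : 0 < D i by rewrite /D; case: cid2.
have DP i : P i (D i) by rewrite /D; case: cid2.
exists (\big[Order.min/1]_i D i).
  by elim/big_ind : _ => // a b a0 b0; rewrite lt_min a0.
by move=> i; apply: mono (DP i); exact: bigmin_le.
Qed.

Lemma strict_diff_row n m (h : 'rV[R]_n -> 'rV[R]_m) u (J : 'M[R]_(n, m)) :
  (forall i e, 0 < e -> exists2 d, 0 < d & forall x y, `|x - u| < d -> `|y - u| < d ->
    `|h x 0 i - h y 0 i - ((x - y) *m J) 0 i| <= e * `|x - y|) ->
  strict_diff h u J.
Proof.
move=> H e e0.
have [i d d' d'd Hi x y xd yd||d d0 Hd]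
  := @finite_radius _ (fun i d => forall x y, `|x - u| < d -> `|y - u| < d ->
    `|h x 0 i - h y 0 i - ((x - y) *m J) 0 i| <= e * `|x - y|).
- by apply: Hi; exact: lt_le_trans d'd.
- by move=> i; exact: H.
exists d => // x y xd yd; apply: mx_norm_le => [|i j].
  by rewrite mulr_ge0// ltW.
rewrite ord1; have := Hd j x y xd yd.
by rewrite [in X in _ -> X]mxE [in X in _ -> X]mxE [in X in _ -> X]mxE [X in _ -> `|_ + X| <= _]mxE.
Qed.

Lemma strict_diff_is_diff n m (h : 'rV[R]_n -> 'rV[R]_m) u J :
  strict_diff h u J -> is_diff u h (mulmxr J).
Proof.
move=> H; apply: is_diff_eps.
  have [C C0 HC] := mulmx_bound J.
  apply/linear_bounded_continuous/linear_boundedP; exists C; split; first exact: num_real.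
  move=> M CM x /=.
  by apply: le_trans (HC x) _; rewrite ler_wpM2r// ltW.
move=> e e0; have [d d0 Hd] := H e e0; exists d => // y yd.
by apply: Hd => //; rewrite subrr normr0.
Qed.

Lemma strict_diff_derive n m (h : 'rV[R]_n -> 'rV[R]_m) u J v :
  strict_diff h u J -> 'D_v h u = v *m J.
Proof.
by move=> /strict_diff_is_diff [dh E]; rewrite deriveE// E.
Qed.

Lemma derive_comp (V V' W : normedModType R) (f : V -> V') (g : V' -> W) x v :
  differentiable f x -> differentiable g (f x) ->
  'D_v (g \o f) x = 'D_('D_v f x) g (f x).
Proof.
move=> df dg; rewrite (deriveE _ (differentiable_comp df dg)).
by rewrite (diff_comp df dg)/= (deriveE _ dg) (deriveE _ df).
Qed.

End strict_differentiability.

Section C1_maps.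
Context {R : realType}.

Lemma C1_ext (V W : normedModType R) (U : set V) (f g : V -> W) : open U ->
  (forall x, U x -> f x = g x) -> Ck_on 1 U f -> Ck_on 1 U g.
Proof.
move=> oU fg [df cf].
have nfg x : U x -> {near x, f =1 g}.
  by move=> Ux; apply: filterS (open_nbhs_nbhs (conj oU Ux)).
have nD v x : U x -> \forall y \near x, 'D_v f y = 'D_v g y.
  move=> Ux; apply: filterS (open_nbhs_nbhs (conj oU Ux)) => y Uy.
  exact: near_eq_derive (nfg _ Uy).
split=> [x Ux|v x Ux].
  suff [] : is_diff x g ('d f x) by [].
  apply: is_diff_eps => [|e e0]; first exact: diff_continuous (df _ Ux).
  have /eqaddoP /(_ _ e0) := diff_locally (df _ Ux).
  move/near_norm => [d d0 Hd].
  have /near_norm [d' d'0 Hd'] := nfg _ Ux.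
  exists (Num.min d d'); first by rewrite lt_min d0.
  move=> y; rewrite lt_min => /andP[yd yd'].
  rewrite -(Hd' _ yd') -(fg _ Ux).
  have := Hd (y - x); rewrite subr0 => /(_ yd).
  by rewrite !fctE/= subrK opprD addrA.
rewrite /prop_for/continuous_at -(nbhs_singleton (nD v x Ux)).
apply: cvg_trans (cf v x Ux); apply: near_eq_cvg.
by apply: filterS (nD v x Ux) => y ->.
Qed.

Lemma C1_subset (V W : normedModType R) (U U' : set V) (f : V -> W) :
  U' `<=` U -> Ck_on 1 U f -> Ck_on 1 U' f.
Proof.
by move=> UU' [df cf]; split=> [x /UU'/df//|v x /UU'/cf].
Qed.

(** [Ck_on] controls derivatives in fixed directions, whereas the chain rule differentiates [g] in
    the direction ['D_v f y], which moves with [y]. Expanding this direction in the standard basis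
    of the middle space leaves finitely many fixed ones. *)
Lemma C1_comp (V W : normedModType R) m (U : set V) (U' : set 'rV[R]_m)
    (f : V -> 'rV[R]_m) (g : 'rV[R]_m -> W) : open U ->
  (forall x, U x -> U' (f x)) -> Ck_on 1 U f -> Ck_on 1 U' g -> Ck_on 1 U (g \o f).
Proof.
move=> oU fU [df cf] [dg cg]; split=> [x Ux|v x Ux].
  by apply: differentiable_comp; [exact: df|exact/dg/fU].
have E y : U y -> 'D_v (g \o f) y = \sum_i ('D_v f y) 0 i *: 'D_(delta_mx 0 i) g (f y).
  move=> Uy; have dgy := dg _ (fU _ Uy); have dfy := df _ Uy.
  rewrite deriveE; last exact: differentiable_comp.
  have -> : 'd (g \o f) y v = 'd g (f y) ('D_v f y) by rewrite diff_comp// deriveE.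
  rewrite [in LHS](matrix_sum_delta ('D_v f y)) big_ord1 linear_sum.
  by apply: eq_bigr => i _; rewrite linearZ /= -deriveE.
rewrite /prop_for/continuous_at E//.
apply: (@cvg_trans _ ((fun y => \sum_i ('D_v f y) 0 i *: 'D_(delta_mx 0 i) g (f y)) @ x)).
  apply: near_eq_cvg; apply: filterS (open_nbhs_nbhs (conj oU Ux)) => y Uy.
  by rewrite E.
apply: cvg_big => [|i _]; first exact: add_continuous.
have cfx : {for x, continuous f} := differentiable_continuous (df _ Ux).
apply: cvgZ.
  exact: (@continuous_comp _ _ _ ('D_v f) (fun z : 'rV[R]_m => z 0 i) x
    (cf v x Ux) (@coord_continuous _ _ _ _ _ _)).
exact: (@continuous_comp _ _ _ f ('D_(delta_mx 0 i) g) x cfx (cg _ _ (fU _ Ux))).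
Qed.

Lemma C1_mulmxr m p (V : normedModType R) (U : set V) (f : V -> 'rV[R]_m) (B : 'M[R]_(m, p)) :
  open U -> Ck_on 1 U f -> Ck_on 1 U (fun x => f x *m B).
Proof.
move=> oU cf; apply: (C1_comp (U' := setT) (g := mulmxr B)) cf _ => //.
have D (x : 'rV[R]_m) : is_diff x (mulmxr B) (mulmxr B).
  apply: strict_diff_is_diff => e e0; exists 1 => // y z _ _.
  by rewrite /= -mulmxBl subrr normr0 mulr_ge0// ltW.
split=> [x _|v x _]; first by have [] := D x.
have -> : (fun x => 'D_v (mulmxr B) x) = cst (v *m B).
  by apply/funext => y; have [d E] := D y; rewrite deriveE// E.
exact: cst_continuous.
Qed.

Lemma C1_add (V W : normedModType R) (U : set V) (f g : V -> W) : open U ->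
  Ck_on 1 U f -> Ck_on 1 U g -> Ck_on 1 U (fun x => f x + g x).
Proof.
move=> oU [df cf] [dg cg]; split=> [x Ux|v x Ux].
  by apply: differentiableD; [exact: df|exact: dg].
have E y : U y -> 'D_v (fun x => f x + g x) y = 'D_v f y + 'D_v g y.
  move=> Uy; rewrite (_ : (fun x => f x + g x) = f + g)// deriveD//.
    by apply: diff_derivable; exact: df.
  by apply: diff_derivable; exact: dg.
rewrite /prop_for/continuous_at E//.
apply: (@cvg_trans _ ((fun y => 'D_v f y + 'D_v g y) @ x)).
  apply: near_eq_cvg; apply: filterS (open_nbhs_nbhs (conj oU Ux)) => y Uy.
  by rewrite E.
by apply: cvgD; [exact: cf|exact: cg].
Qed.

Lemma C1_affine (V : normedModType R) (U : set V) (u : V) : Ck_on 1 U (fun x : V => x - u).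
Proof.
have D x : is_diff x (fun x : V => x - u) id.
  rewrite (_ : (fun x : V => x - u) = id - cst u); last by apply/funext.
  apply: is_diff_eq; rewrite subr0//.
split=> [x _|v x _]; first by have [] := D x.
have -> : (fun x => 'D_v (fun x : V => x - u) x) = cst v.
  by apply/funext => y; have [d E] := D y; rewrite deriveE// E.
exact: cst_continuous.
Qed.

Lemma C1_row (V : normedModType R) m (U : set V) (f : V -> 'rV[R]_m) : open U ->
  (forall i, Ck_on 1 U (fun x => f x 0 i)) -> Ck_on 1 U f.
Proof.
move=> oU H.
have E : f = \sum_i (fun x => f x 0 i *: (delta_mx 0 i : 'rV[R]_m)).
  apply/funext => x; rewrite fct_sumE [LHS]matrix_sum_delta big_ord1.
  by apply: eq_bigr => i _.
have df x : U x -> differentiable f x.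
  move=> Ux; rewrite E; apply: differentiable_sum => i.
  by apply: differentiableZl; exact: (H i).1.
split=> // v x Ux.
apply/cvgrPdist_le => e e0.
have : \forall y \near x, forall i, `|'D_v (fun x => f x 0 i) x - 'D_v (fun x => f x 0 i) y| <= e.
  apply: near_forall => i; have := (H i).2 v x Ux.
  by move/cvgrPdist_le => /(_ _ e0).
apply: filterS2 (open_nbhs_nbhs (conj oU Ux)) => y Uy He.
rewrite !derive_mx; [|exact/diff_derivable/df..].
by apply: mx_norm_le => [|i j]; [exact: ltW|rewrite ord1 !mxE].
Qed.

Lemma derive_coord m (v x : 'rV[R]_m) i : 'D_v (fun y : 'rV[R]_m => y 0 i) x = v 0 i.
Proof.
have := @derive_mx R _ 1 m (@id 'rV[R]_m) x v (@derivable_id _ _ _ _).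
by rewrite derive_id => /matrixP /(_ 0 i) ->; rewrite mxE.
Qed.

Lemma derive_mulmxr_coord (V : normedModType R) m q (f : V -> 'rV[R]_m)
    (B : 'M[R]_(m, q)) x v i : differentiable f x ->
  'D_v (fun x => (f x *m B) 0 i) x = ('D_v f x *m B) 0 i.
Proof.
move=> df.
have sB : strict_diff (mulmxr B) (f x) B.
  move=> e e0; exists 1 => // y z _ _.
  by rewrite /= -mulmxBl subrr normr0 mulr_ge0// ltW.
have [dB _] := strict_diff_is_diff sB.
have E := derive_comp v (differentiable_comp df dB) (@differentiable_coord _ _ _ _ 0 i).
rewrite derive_coord in E; rewrite [LHS]E.
by rewrite (derive_comp v df dB) (strict_diff_derive _ sB).
Qed.

Lemma C1_coord (V : normedModType R) m (U : set V) (f : V -> 'rV[R]_m) i :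
  open U -> Ck_on 1 U f -> Ck_on 1 U (fun x => f x 0 i).
Proof.
move=> oU cf; apply: (C1_comp (U' := setT) (g := fun y : 'rV[R]_m => y 0 i)) cf _ => //.
split=> [x _|v x _]; first exact: differentiable_coord.
have -> : (fun x => 'D_v (fun y : 'rV[R]_m => y 0 i) x) = cst (v 0 i).
  by apply/funext => y; exact: derive_coord.
exact: cst_continuous.
Qed.

Lemma C1_strict n m (h : 'rV[R]_n -> 'rV[R]_m) (U : set 'rV[R]_n) u :
  open U -> U u -> Ck_on 1 U h ->
  strict_diff h u (\matrix_(j, i) 'D_(delta_mx 0 j) (fun x => h x 0 i) u).
Proof.
move=> oU Uu ch; apply: strict_diff_row => i e e0.
have [d d0 Hd] := C1_strict_scalar oU Uu (C1_coord i oU ch) e0.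
exists d => // x y xd yd; have := Hd x y xd yd.
set A := _ *m _; set B := _ *m _; suff -> : A 0 0 = B 0 i by [].
by rewrite !mxE; apply: eq_bigr => j _; rewrite !mxE.
Qed.

Lemma C1_partials n (U : set 'rV[R]_n) (F : 'rV[R]_n -> R) :
  open U -> Ck_on 2 U F -> Ck_on 1 U (partials F).
Proof.
move=> oU [dF cF]; apply: C1_row => // i.
by rewrite (_ : (fun x => _) = 'D_(delta_mx 0 i) F)//; apply/funext => x; rewrite mxE.
Qed.

Lemma C2_C1 n (U : set 'rV[R]_n) (F : 'rV[R]_n -> R) :
  Ck_on 2 U F -> Ck_on 1 U F.
Proof.
by move=> [dF cF]; split=> // v x Ux; apply: differentiable_continuous; apply: (cF v).1.
Qed.

End C1_maps.

(** * The inverse function theorem *)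

Section inverse_function.
Context {R : realType} {n : nat}.
Implicit Types (h : 'rV[R]_n -> 'rV[R]_n) (u x y v : 'rV[R]_n).

Lemma closed_ball_compact u (r : R) : compact [set x : 'rV[R]_n | `|x - u| <= r].
Proof.
apply: bounded_closed_compact.
  exists (`|u| + r); split; first exact: num_real.
  move=> M uM x /= xr; apply: ltW; apply: le_lt_trans uM.
  by rewrite -[x](subrK u) addrC; apply: le_trans (ler_normD _ _) _; rewrite lerD2l.
have -> : [set x : 'rV[R]_n | `|x - u| <= r]
  = (fun x : 'rV[R]_n => `|x - u|) @^-1` [set s | s <= r] by [].
apply: closed_comp => [x _|]; last exact: closed_le.
apply: continuous_comp; last exact: norm_continuous.
exact: differentiable_continuous ((@C1_affine _ 'rV[R]_n setT u).1 x I).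
Qed.

(* Minimizing [|theta x - a|] over a closed ball: at an interior minimum with
   nonzero residual [w], the step [x + t w] would decrease it. *)
Lemma near_identity_surjective (theta : 'rV[R]_n -> 'rV[R]_n) u (r : R) : 0 < r ->
  (forall x y, `|x - u| <= r -> `|y - u| <= r ->
     `|theta x - theta y - (x - y)| <= 2^-1 * `|x - y|) ->
  forall a, 4 * `|a - theta u| < r -> exists2 x, `|x - u| < r & theta x = a.
Proof.
move=> r0 H a ar.
have uu : `|u - u| <= r by rewrite subrr normr0 ltW.
have lip x y : `|x - u| <= r -> `|y - u| <= r -> `|x - y| <= 2 * `|theta x - theta y|.
  move=> xr yr; have := H x y xr yr.
  have := ler_normB (theta x - theta y) (theta x - theta y - (x - y)).
  by rewrite [X in `|X| <= _](_ : _ = x - y); [lra | rewrite opprB addrC subrK].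
have lip' x y : `|x - u| <= r -> `|y - u| <= r -> `|theta x - theta y| <= 2 * `|x - y|.
  move=> xr yr; have := H x y xr yr.
  have := ler_normD (theta x - theta y - (x - y)) (x - y).
  by rewrite subrK; have := normr_ge0 (x - y); lra.
have [] := @EVT_min_rV R n (fun x => `|theta x - a|) [set x | `|x - u| <= r].
- by exists u; exact: uu.
- exact: closed_ball_compact.
- apply/subspace_continuousP => x /= xr; apply/cvgrPdist_le => e e0.
  have : \forall y \near (x : 'rV[R]_n), `|y - x| < e / 2.
    by apply/near_norm; exists (e / 2) => //; rewrite divr_gt0.
  move=> He; rewrite near_withinE; apply: filterS He => y yx yr.
  apply: le_trans (ler_dist_dist _ _) _.
  rewrite opprB addrA subrK.
  by apply: le_trans (lip' _ _ xr yr) _; rewrite distrC; move: yx; lra.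
move=> x; rewrite inE /= => xr xmin.
(* Minimality against [u] gives |theta x - theta u| <= 2 |a - theta u|, and [lip] doubles this:
   hence the factor 4, and the minimum is interior. *)
have xr' : `|x - u| < r.
  apply: le_lt_trans (lip _ _ xr uu) _; apply: le_lt_trans ar.
  have := xmin u; rewrite inE/= => /(_ uu); rewrite (distrC (theta u)).
  have := ler_normD (theta x - a) (a - theta u); rewrite addrA subrK.
  lra.
exists x => //; apply/eqP; rewrite -subr_eq0; apply: contraT => xa.
set w := a - theta x; have w0 : 0 < `|w| by rewrite normr_gt0 /w -opprB oppr_eq0.
pose t := Num.min 1 ((r - `|x - u|) / `|w|).
have t0 : 0 < t by rewrite lt_min ltr01 divr_gt0// subr_gt0.
have t1 : t <= 1 by rewrite ge_min lexx.
have tw : t * `|w| <= r - `|x - u|.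
  by rewrite -ler_pdivlMr// ge_min lexx orbT.
have yr : `|x + t *: w - u| <= r.
  rewrite addrAC; apply: le_trans (ler_normD _ _) _.
  by rewrite normrZ (gtr0_norm t0); move: tw; lra.
have := xmin (x + t *: w); rewrite inE/= => /(_ yr).
have := H _ _ yr xr; rewrite [x + _ - x]addrC addKr normrZ (gtr0_norm t0).
set q := _ - t *: w => qle.
have -> : theta (x + t *: w) - a = q - (1 - t) *: w.
  by rewrite /q /w; apply/rowP => i; rewrite !mxE; ring.
have -> : theta x - a = - w by rewrite /w opprB.
rewrite normrN => wle.
have := ler_normB q ((1 - t) *: w); rewrite normrZ (ger0_norm (_ : 0 <= 1 - t)) ?subr_ge0//.
have : 0 < t * `|w| by rewrite mulr_gt0.
move: qle wle; lra.
Qed.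

Definition jac h u : 'M[R]_n :=
  \matrix_(j, i) 'D_(delta_mx 0 j) (fun x => h x 0 i) u.

(** Composing with [invmx C] gives a map [theta] that differs from the identity by a 1/2-Lipschitz
    map on a ball [W]. So [h] is injective there with a [2 * K]-Lipschitz inverse, and
    [near_identity_surjective] around each point makes the image open. *)
Lemma inverse_function_theorem h (U : set 'rV[R]_n) u (C : 'M[R]_n) :
  open U -> U u -> Ck_on 1 U h -> strict_diff h u C -> C \in unitmx ->
  exists W : set 'rV[R]_n, exists g : 'rV[R]_n -> 'rV[R]_n,
    [/\ open W, W u, W `<=` U, open (h @` W) &
      (forall x, W x -> g (h x) = x) /\ Ck_on 1 (h @` W) g].
Proof.
move=> oU Uu ch sC Cu.
have [K K0 HK] := mulmx_bound (invmx C).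
have [d1 d10 Hd1] : exists2 d, 0 < d & forall x, `|x - u| < d -> U x.
  by apply/near_norm; exact: open_nbhs_nbhs.
have [d2 d20 Hd2] := sC (2 * K)^-1 ltac:(by rewrite invr_gt0 mulr_gt0).
pose d := Num.min d1 d2.
have d0 : 0 < d by rewrite lt_min d10.
pose W : set 'rV[R]_n := [set x | `|x - u| < d].
have WU : W `<=` U by move=> x /=; rewrite /W/= lt_min => /andP[/Hd1].
have oW : open W.
  rewrite (_ : W = ball u d); first exact: ball_open.
  by apply/seteqP; split=> x; rewrite /W -ball_normE /ball_/= distrC.
have Wu : W u by rewrite /W/= subrr normr0.
pose theta x := h x *m invmx C.
have Ht x y : W x -> W y -> `|theta x - theta y - (x - y)| <= 2^-1 * `|x - y|.
  rewrite /W/= !lt_min => /andP[_ xd] /andP[_ yd].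
  have -> : theta x - theta y - (x - y) = (h x - h y - (x - y) *m C) *m invmx C.
    by rewrite !mulmxBl -/(theta x) -/(theta y) -!mulmxA mulmxV// !mulmx1.
  apply: le_trans (HK _) _; rewrite -ler_pdivlMl//.
  apply: le_trans (Hd2 _ _ xd yd) _.
  by rewrite invfM mulrA [K^-1 * _]mulrC.
have lip x y : W x -> W y -> `|x - y| <= (2 * K) * `|h x - h y|.
  move=> xW yW; have := Ht x y xW yW.
  have := ler_normB (theta x - theta y) (theta x - theta y - (x - y)).
  rewrite [X in `|X| <= _](_ : _ = x - y); last by rewrite opprB addrC subrK.
  have : `|theta x - theta y| <= K * `|h x - h y| by rewrite -mulmxBl.
  by rewrite -mulrA; lra.
have inj x y : W x -> W y -> h x = h y -> x = y.
  move=> xW yW hxy; apply/eqP; rewrite -subr_eq0 -normr_le0.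
  by apply: le_trans (lip _ _ xW yW) _; rewrite hxy subrr normr0 mulr0.
have surj x : W x -> exists2 e, 0 < e & forall y, `|y - h x| < e -> (h @` W) y.
  move=> Wx; have [r r0 Hr] : exists2 r, 0 < r & forall y, `|y - x| < r -> W y.
    by apply/near_norm; exact: open_nbhs_nbhs.
  exists (r / 2 / (4 * K)); first by rewrite !divr_gt0// mulr_gt0.
  move=> y yh.
  have r2 z : `|z - x| <= r / 2 -> W z.
    by move=> zx; apply: Hr; apply: le_lt_trans zx _; move: r0; lra.
  have [|||z zx zy] := @near_identity_surjective theta x (r / 2) _ _ (y *m invmx C).
  - by rewrite divr_gt0.
  - by move=> a b /r2 Wa /r2 Wb; exact: Ht.
  - rewrite -mulmxBl; apply: le_lt_trans (_ : 4 * (K * `|y - h x|) < _).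
      by rewrite ler_pM2l.
    by rewrite mulrA -ltr_pdivlMl ?mulr_gt0// mulrC.
  exists z; first exact/r2/ltW.
  by have := congr1 (fun v => v *m C) zy; rewrite /theta -!mulmxA mulVmx// !mulmx1.
(* The default value [u] is taken only off the image of [W]. *)
pose g y := xget u [set x | W x /\ h x = y].
have gh x : W x -> g (h x) = x.
  move=> Wx; rewrite /g; case: xgetP => [z _ [Wz hz]|/(_ x)[]//].
  exact: inj.
have oh : open (h @` W).
  by apply/(@open_norm R 'rV[R]_n) => _ [x Wx <-]; exact: surj.
exists W, g; split => //; split=> //.
have sJ x : W x -> strict_diff h x (jac h x) by move=> /WU Ux; exact: C1_strict ch.
(* The lower Lipschitz bound of [h], applied to [x + t *: v] and divided by [t], passes to the
   derivative. It makes the Jacobian invertible at every point of [W]. *)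
have lJ x v : W x -> `|v| <= (2 * K) * `|v *m jac h x|.
  move=> Wx; apply/ler_addgt0Pr => e e0.
  have K2 : 0 < 2 * K by rewrite mulr_gt0.
  have [v0|v0] := eqVneq v 0.
    by rewrite v0 mul0mx normr0 mulr0 add0r ltW.
  have v0' : 0 < `|v| by rewrite normr_gt0.
  have [a a0 Ha] := sJ _ Wx (e / (2 * K * `|v|)) ltac:(by rewrite divr_gt0// mulr_gt0).
  have [b b0 Hb] : exists2 r, 0 < r & forall y, `|y - x| < r -> W y.
    by apply/near_norm; exact: open_nbhs_nbhs.
  have ab0 : 0 < Num.min a b by rewrite lt_min a0.
  have [t t0 tv'] : exists2 t, 0 < t & t * `|v| < Num.min a b.
    exists (Num.min a b / (2 * `|v|)); first by rewrite divr_gt0// mulr_gt0.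
    by rewrite invfM mulrA mulfVK ?gt_eqF// ltr_pdivrMr// ltr_pMr// ltr1n.
  have tv : `|x + t *: v - x| < Num.min a b.
    by rewrite addrC addKr normrZ gtr0_norm.
  move: (tv); rewrite lt_min => /andP[xa xb].
  have := Ha _ x xa; rewrite subrr normr0 => /(_ a0).
  have := lip _ _ (Hb _ xb) Wx; rewrite [x + _ - x]addrC addKr -scalemxAl !normrZ gtr0_norm//.
  set q := h _ - h x => H1 H2.
  have := ler_normD (q - t *: (v *m jac h x)) (t *: (v *m jac h x)).
  rewrite subrK normrZ gtr0_norm// => H3.
  have H4 : t * `|v| <= (2 * K) * (e / (2 * K * `|v|) * (t * `|v|) + t * `|v *m jac h x|).
    by apply: le_trans H1 _; rewrite ler_pM2l//; apply: le_trans H3 _; rewrite lerD2r.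
  rewrite -(ler_pM2l t0); apply: le_trans H4 _.
  rewrite le_eqVlt; apply/orP; left; apply/eqP; field.
  by rewrite !gt_eqF.
have uJ x : W x -> jac h x \in unitmx.
  move=> Wx; rewrite -row_free_unit -kermx_eq0; apply/eqP/row_matrixP => i.
  rewrite row0; apply/eqP; rewrite -normr_le0; apply: le_trans (lJ x _ Wx) _.
  by rewrite -row_mul mulmx_ker row0 normr0 mulr0.
have dg x : W x -> is_diff (h x) g (mulmxr (invmx (jac h x))).
  move=> Wx; have [K' K'0 HK'] := mulmx_bound (invmx (jac h x)).
  apply: is_diff_eps.
    apply/linear_bounded_continuous/linear_boundedP; exists K'; split; first exact: num_real.
    move=> M CM v /=.
    by apply: le_trans (HK' v) _; rewrite ler_wpM2r// ltW.
  move=> e e0; have e'0 : 0 < e / (K' * (2 * K)) by rewrite divr_gt0// !mulr_gt0.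
  have [a a0 Ha] := sJ _ Wx _ e'0.
  have [b b0 Hb] := surj _ Wx.
  exists (Num.min b (a / (2 * K))); first by rewrite lt_min b0 divr_gt0// mulr_gt0.
  move=> y; rewrite lt_min => /andP[/Hb[z Wz <-]].
  rewrite ltr_pdivlMr ?mulr_gt0// mulrC => za.
  have zx := lip _ _ Wz Wx; rewrite gh// gh//=.
  have {}za : `|z - x| < a by apply: le_lt_trans zx za.
  have -> : z - x - (h z - h x) *m invmx (jac h x) =
      - ((h z - h x - (z - x) *m jac h x) *m invmx (jac h x)).
    by rewrite [in RHS]mulmxBl -[_ *m jac h x *m _]mulmxA mulmxV ?uJ// mulmx1 opprB.
  rewrite normrN; apply: le_trans (HK' _) _.
  have := Ha z x za; rewrite subrr normr0 => /(_ a0) H1.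
  apply: le_trans (_ : K' * (e / (K' * (2 * K)) * (2 * K * `|h z - h x|)) <= _).
    rewrite ler_pM2l//; apply: le_trans H1 _; rewrite ler_pM2l//.
  rewrite le_eqVlt; apply/orP; left; apply/eqP; field.
  by rewrite !gt_eqF.
have Dg v x : W x -> 'D_v g (h x) = v *m invmx (jac h x).
  by move=> Wx; have [dd E] := dg _ Wx; rewrite deriveE// E.
split=> [_ [x Wx <-]|v _ [x Wx <-]]; first by have [] := dg _ Wx.
apply/(@continuous_norm R 'rV[R]_n 'rV[R]_n) => e e0.
(* By [lJ] at [z], the difference of [v *m invmx (jac h z)] and [a] is at most [2 * K] times
   [v - a *m jac h z], that is ['D_a h x - 'D_a h z]. Only continuity of ['D_a h] in the fixed
   direction [a] is left. *)
set a := v *m invmx (jac h x).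
have [b b0 Hb] : exists2 b, 0 < b & forall z, `|z - x| < b ->
    `|'D_a h z - 'D_a h x| <= e / (2 * K).
  have := ch.2 a x (WU _ Wx); move/(@continuous_norm R 'rV[R]_n 'rV[R]_n).
  by apply; rewrite divr_gt0// mulr_gt0.
have [c c0 Hc] := surj _ Wx.
exists (Num.min c (b / (2 * K))).
  by rewrite lt_min c0 divr_gt0// mulr_gt0.
move=> y; rewrite lt_min => /andP[/Hc[z Wz <-]].
rewrite ltr_pdivlMr ?mulr_gt0// mulrC => za.
have {}za : `|z - x| < b by apply: le_lt_trans (lip _ _ Wz Wx) za.
have := Hb _ za; rewrite !(strict_diff_derive _ (sJ _ _))// => H1.
rewrite !Dg// -/a; apply: le_trans (lJ z _ Wz) _.
rewrite mulmxBl -[v *m _ *m _]mulmxA mulVmx ?uJ// mulmx1.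
rewrite -ler_pdivlMl ?mulr_gt0// mulrC.
by move: H1; rewrite [in X in X -> _]/a -[v *m _ *m jac h x]mulmxA mulVmx ?uJ// mulmx1 distrC.
Qed.

End inverse_function.

(** * Second-order conditions *)

Section second_order.
Context {R : realType} {n : nat}.
Variables (F : 'rV[R]_n -> R) (U : set 'rV[R]_n) (u0 : 'rV[R]_n).
Hypotheses (oU : open U) (Uu0 : U u0) (F2 : Ck_on 2 U F).
Local Notation p := (partials F).

Definition hessian : 'M[R]_n := jac p u0.
Local Notation A := hessian.

Lemma partials_strict_diff : strict_diff p u0 A.
Proof. exact: C1_strict oU Uu0 (C1_partials oU F2). Qed.

(** Divide by [t] and let [t] tend to 0. Only increments in one direction enter, which suits a
    minimizer of [F] combined with a term that is not differentiable there. *)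
Lemma slope_ge z v c tau : U z -> 0 < tau ->
  (forall t, 0 < t -> t < tau -> - (c * t) <= F (z + t *: v) - F z) ->
  - c <= (p z *m v^T) 0 0.
Proof.
move=> Uz tau0 H; rewrite lerNl; apply/ler_addgt0Pr => e e0.
have e'0 : 0 < e / (`|v| + 1) by rewrite divr_gt0// ltr_wpDl.
have [d d0 Hd] := C1_strict_scalar oU Uz (C2_C1 F2) e'0.
pose t := Num.min (tau / 2) (d / (2 * (`|v| + 1))).
have v1 : 0 < `|v| + 1 by rewrite ltr_wpDl.
have t0 : 0 < t by rewrite lt_min !divr_gt0// mulr_gt0.
have ttau : t < tau.
  by rewrite /t gt_min; apply/orP; left; rewrite ltr_pdivrMr// ltr_pMr// ltr1n.
have td : t * (`|v| + 1) <= d / 2.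
  by rewrite -ler_pdivlMr// -mulrA -invfM ge_min lexx orbT.
have := Hd (z + t *: v) z; rewrite subrr normr0 [z + _ - z]addrC addKr => /(_ _ d0).
rewrite normrZ gtr0_norm// => K.
have {}K := K ltac:(by apply: le_lt_trans (_ : t * (`|v| + 1) < _);
  [rewrite ler_pM2l// lerDl | apply: le_lt_trans td _; rewrite ltr_pdivrMr// ltr_pMr// ltr1n]).
have K2 : e / (`|v| + 1) * (t * `|v|) <= e * t.
  rewrite mulrAC ler_pdivrMr// mulrA ler_wpM2l ?lerDl//.
  by rewrite mulr_ge0// ltW.
move: K; rewrite ler_norml => /andP[_ K].
have := H t t0 ttau; move: K.
rewrite -scalemxAl mxE.
rewrite dotC.
move=> K H1; rewrite -(ler_pM2l t0); move: K H1 K2.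
set b := (_ *m _) 0 0; lra.
Qed.

Lemma critical_point z d : 0 < d -> U z -> (forall y, `|y - z| < d -> F z <= F y) ->
  p z = 0.
Proof.
move=> d0 Uz H.
have K (v : 'rV[R]_n) : 0 <= (p z *m v^T) 0 0.
  have v1 : 0 < `|v| + 1 by rewrite ltr_wpDl.
  rewrite -oppr0; apply: (@slope_ge _ _ _ (d / (`|v| + 1))) => //.
    by rewrite divr_gt0.
  move=> t t0; rewrite ltr_pdivlMr// => td; rewrite mul0r oppr0 subr_ge0.
  apply: H; rewrite addrC addKr normrZ gtr0_norm//; apply: le_lt_trans td.
  by rewrite ler_pM2l// lerDl.
apply/rowP => i; rewrite [RHS]mxE.
have E : (p z *m (delta_mx 0 i : 'rV[R]_n)^T) 0 0 = p z 0 i.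
  by rewrite trmx_delta -colE mxE.
apply/eqP; rewrite eq_le -{2}E K andbT.
have := K (- delta_mx 0 i); rewrite linearN/= mulmxN mxE E.
by rewrite oppr_ge0.
Qed.

(** The base point [z] is any critical point near [u0], yet the Hessian is the one at [u0]. Strict
    differentiability of the gradient gives the first estimate uniformly in both points; the second
    follows from it by the mean value theorem. *)
Lemma taylor e : 0 < e -> exists2 d, 0 < d & forall x z,
  `|x - u0| < d -> `|z - u0| < d -> p z = 0 ->
  `|p x - (x - z) *m A| <= e * `|x - z| /\
  `|F x - F z - bform A (x - z) (x - z) / 2| <= e * `|x - z| ^+ 2.
Proof.
move=> e0; have n1 : 0 < n%:R + 1 :> R by rewrite ltr_wpDl.
have e'0 : 0 < e / (n%:R + 1) by rewrite divr_gt0.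
have e'e : e / (n%:R + 1) <= e by rewrite ler_pdivrMr// ler_pMr// lerDr.
have [d1 d10 Hd1] := partials_strict_diff e'0.
have [d2 d20 Hd2] : exists2 d, 0 < d & forall x, `|x - u0| < d -> U x.
  by apply/near_norm; exact: open_nbhs_nbhs.
exists (Num.min d1 d2) => [|x z xd zd pz]; first by rewrite lt_min d10.
have xd1 : `|x - u0| < d1 by move: xd; rewrite lt_min => /andP[].
have zd1 : `|z - u0| < d1 by move: zd; rewrite lt_min => /andP[].
split.
  have := Hd1 _ _ xd1 zd1; rewrite pz subr0 => /le_trans; apply.
  by rewrite ler_wpM2r.
set h := x - z; set q := bform A h h.
have dF t : 0 <= t <= 1 -> differentiable F (z + t *: h).
  move=> t01; apply: F2.1; apply: Hd2.
  by have := segment_near xd zd t01; rewrite lt_min => /andP[].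
(* With the quadratic term subtracted, the mean value theorem returns the remainder itself, namely
   [h] paired with [p (z + t *: h) - t *: h *m A]. *)
have D (t : R) : 0 <= t <= 1 -> is_derive t 1 (fun s : R => F (z + s *: h) - (q / 2) *: s ^+ 2)
   ('D_h F (z + t *: h) - (q / 2) *: (2 * t)).
  move=> t01.
  have D1 := is_derive_line_diff (dF t t01).
  have D2 : is_derive t 1 (fun s : R => (q / 2) *: s ^+ 2) ((q / 2) *: (2 * t)).
    apply: is_deriveZ; apply: is_derive_eq.
    by transitivity (t + t); [congr (_ + _); exact: mulr1|ring].
  exact: is_deriveB.
have [|||t] := @MVT_segment R (fun s : R => F (z + s *: h) - (q / 2) *: s ^+ 2)
   (fun t => 'D_h F (z + t *: h) - (q / 2) *: (2 * t)) 0 1.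
- exact: ler01.
- move=> t; rewrite in_itv/= => /andP[t0 t1]; apply: D; rewrite !ltW//.
- apply: continuous_in_subspaceT => t; rewrite inE/= in_itv/= => t01.
  exact: is_derive_continuous (D _ t01).
rewrite in_itv/= => t01; rewrite scale1r scale0r addr0 subr0 mulr1 expr0n scaler0 subr0.
rewrite expr1n [z + h]addrC /h subrK -/h [_ *: 1]mulr1 => E.
have -> : F x - F z - q / 2 = 'D_h F (z + t *: h) - (q / 2) *: (2 * t) by rewrite -E; ring.
have -> : (q / 2) *: (2 * t) = t * q by rewrite /GRing.scale/=; field.
rewrite derive_partials; last exact: dF.
have -> : (h *m (p (z + t *: h))^T) 0 0 - t * q = (h *m (p (z + t *: h) - t *: h *m A)^T) 0 0.
  rewrite dotBr; congr (_ - _); rewrite dotC -!scalemxAl [RHS]mxE.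
  by rewrite /q /bform.
apply: le_trans (dot_norm_le _ _) _.
have := Hd1 (z + t *: h) z _ zd1; rewrite pz subr0 [z + _ - z]addrC addKr.
have sd : `|z + t *: h - u0| < d1.
  by have := segment_near xd zd t01; rewrite lt_min => /andP[].
move=> /(_ sd); rewrite normrZ => K.
have K2 : `|t| * `|h| <= `|h|.
  by case/andP: t01 => t0 t1; rewrite ger0_norm// ler_piMl.
set y := `|_ - _| in K *.
have {K2}K : y <= e / (n%:R + 1) * `|h|.
  by apply: le_trans K _; rewrite ler_pM2l.
rewrite mulrCA expr2 [e * _]mulrCA ler_wpM2l//.
apply: (@le_trans _ _ ((n%:R + 1) * (e / (n%:R + 1) * `|h|))).
  apply: ler_pM => //; first by rewrite /y.
  by rewrite lerDl.
by rewrite mulrA mulrCA mulfV ?mulr1// gt_eqF.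
Qed.

(** The mean value theorem in the direction [h] turns the second difference into a difference of
    gradients at two points that are [s] apart, to which strict differentiability applies. *)
Lemma hessian_second_difference e : 0 < e -> exists2 d, 0 < d & forall s h,
  `|s| < d -> `|h| < d ->
  `|F (u0 + s + h) - F (u0 + s) - F (u0 + h) + F u0 - bform A s h| <= e * (`|s| * `|h|).
Proof.
move=> e0; have n1 : 0 < n%:R + 1 :> R by rewrite ltr_wpDl.
have e'0 : 0 < e / (n%:R + 1) by rewrite divr_gt0.
have [d1 d10 Hd1] := partials_strict_diff e'0.
have [d2 d20 Hd2] : exists2 d, 0 < d & forall x, `|x - u0| < d -> U x.
  by apply/near_norm; exact: open_nbhs_nbhs.
pose d := Num.min d1 d2; have d0 : 0 < d by rewrite lt_min d10.
exists (d / 2) => [|s h sd hd]; first by rewrite divr_gt0.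
have near1 t : 0 <= t <= 1 -> `|u0 + s + t *: h - u0| < d.
  move=> /andP[t0 t1]; rewrite [_ - u0]addrC addrA addKr.
  apply: le_lt_trans (ler_normD _ _) _; rewrite normrZ ger0_norm//.
  have : t * `|h| <= `|h| by rewrite ler_piMl.
  move: sd hd; lra.
have near2 t : 0 <= t <= 1 -> `|u0 + t *: h - u0| < d.
  move=> /andP[t0 t1]; rewrite [_ - u0]addrC addKr normrZ ger0_norm//.
  have : t * `|h| <= `|h| by rewrite ler_piMl.
  have := normr_ge0 s; move: sd hd; lra.
have UF x : `|x - u0| < d -> differentiable F x.
  by rewrite lt_min => /andP[_ xd]; apply: F2.1; exact: Hd2.
have D (t : R) : 0 <= t <= 1 -> is_derive t 1 (fun r : R => F (u0 + s + r *: h) - F (u0 + r *: h))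
   ('D_h F (u0 + s + t *: h) - 'D_h F (u0 + t *: h)).
  move=> t01.
  have D1 := is_derive_line_diff (UF _ (near1 t t01)).
  have D2 := is_derive_line_diff (UF _ (near2 t t01)).
  exact: is_deriveB.
have [|||t] := @MVT_segment R (fun r : R => F (u0 + s + r *: h) - F (u0 + r *: h))
   (fun t => 'D_h F (u0 + s + t *: h) - 'D_h F (u0 + t *: h)) 0 1.
- exact: ler01.
- move=> t; rewrite in_itv/= => /andP[t0 t1]; apply: D; rewrite !ltW//.
- apply: continuous_in_subspaceT => t; rewrite inE/= in_itv/= => t01.
  exact: is_derive_continuous (D _ t01).
rewrite in_itv/= => t01; rewrite !scale1r !scale0r !addr0 subr0 mulr1 => E.
have -> : F (u0 + s + h) - F (u0 + s) - F (u0 + h) + F u0 =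
  'D_h F (u0 + s + t *: h) - 'D_h F (u0 + t *: h) by rewrite -E; ring.
rewrite !derive_partials; [|exact/UF/near2|exact/UF/near1].
set a := p _; set b := p _.
have -> : (h *m a^T) 0 0 - (h *m b^T) 0 0 - bform A s h = (h *m (a - b - s *m A)^T) 0 0.
  by rewrite !dotBr [X in _ - _ - X = _](dotC (s *m A)).
apply: le_trans (dot_norm_le _ _) _.
have := Hd1 (u0 + s + t *: h) (u0 + t *: h).
move: (near1 t t01) (near2 t t01); rewrite !lt_min => /andP[k1 _] /andP[k2 _] /(_ k1 k2).
rewrite -/a -/b.
have -> : u0 + s + t *: h - (u0 + t *: h) = s by apply/rowP => i; rewrite !mxE; ring.
move=> K; rewrite (mulrC `|s|) mulrCA [e * _]mulrCA ler_wpM2l//.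
apply: (@le_trans _ _ ((n%:R + 1) * (e / (n%:R + 1) * `|s|))).
  by apply: ler_pM => //; rewrite lerDl.
by rewrite mulrA [_ * (e / _)]mulrC divfK// gt_eqF.
Qed.

(** The second difference is symmetric in [s] and [h]. Hence [bform A s h] and [bform A h s] differ
    by an arbitrarily small multiple of [|s| |h|], after both vectors are scaled by a small [t]. *)
Lemma hessian_sym : A^T = A.
Proof.
have K s h : bform A s h = bform A h s.
  apply/eqP; rewrite -subr_eq0 -normr_le0; apply/ler_addgt0Pr => e e0.
  rewrite add0r.
  have M0 : 0 < 2 * (`|s| * `|h|) + 1 by rewrite ltr_wpDl// !mulr_ge0.
  have [d d0 Hd] := hessian_second_difference (divr_gt0 e0 M0).
  have [t t0 [ts th]] : exists2 t, 0 < t & `|t *: s| < d /\ `|t *: h| < d.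
    have S0 : 0 < `|s| + `|h| + 1 by rewrite ltr_wpDl// addr_ge0.
    have [t t0 tE] : exists2 t, 0 < t & t * (`|s| + `|h| + 1) = d.
      by exists (d / (`|s| + `|h| + 1)); rewrite ?divfK ?gt_eqF// divr_gt0.
    exists t => //; rewrite !normrZ (gtr0_norm t0).
    have := mulr_ge0 (ltW t0) (normr_ge0 s); have := mulr_ge0 (ltW t0) (normr_ge0 h).
    by move: tE t0; rewrite !mulrDr mulr1; split; lra.
  have := Hd _ _ ts th; have := Hd _ _ th ts.
  rewrite !bformZl !bformZr !normrZ !(gtr0_norm t0).
  have -> : u0 + t *: h + t *: s = u0 + t *: s + t *: h by rewrite addrAC.
  set f1 := F _; set f2 := F _; set f3 := F _ => H1 H2.
  have H3 : (t * t) * `|bform A s h - bform A h s| <=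
     (t * t) * (e / (2 * (`|s| * `|h|) + 1) * (2 * (`|s| * `|h|))).
    rewrite -{1}[t * t]ger0_norm ?(mulr_ge0 (ltW t0) (ltW t0))// -normrM.
    have := ler_normB (f1 - f2 - f3 + F u0 - t * (t * bform A h s))
       (f1 - f3 - f2 + F u0 - t * (t * bform A s h)).
    rewrite [X in `|X| <= _](_ : _ = t * t * (bform A s h - bform A h s)); last by ring.
    move=> /le_trans; apply; apply: le_trans (lerD H1 H2) _.
    by rewrite le_eqVlt; apply/orP; left; apply/eqP; ring.
  rewrite ler_pM2l ?mulr_gt0// in H3; apply: le_trans H3 _.
  by rewrite mulrAC ler_pdivrMr// ler_pM2l// lerDl.
apply/matrixP => i j; rewrite mxE.
have E a b : bform A (delta_mx 0 a) (delta_mx 0 b) = A a b.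
  by rewrite /bform -rowE trmx_delta -colE !mxE.
by rewrite -!E K.
Qed.

Lemma hessian_psd : (\forall u \near u0, F u0 <= F u) -> psd A.
Proof.
move=> /near_norm [d1 d10 Hd1]; split; first exact: hessian_sym.
have p0 : p u0 = 0 by exact: critical_point Hd1.
move=> v; rewrite -oppr0 lerNl; apply/ler_addgt0Pr => e e0; rewrite add0r.
have v1 : 0 < `|v| + 1 by rewrite ltr_wpDl.
have e'0 : 0 < e / (2 * (`|v| + 1) ^+ 2) by rewrite divr_gt0// mulr_gt0// exprn_gt0.
have [d d0 Hd] := taylor e'0.
pose t := Num.min d d1 / (2 * (`|v| + 1)).
have dd : 0 < Num.min d d1 by rewrite lt_min d0.
have t0 : 0 < t by rewrite divr_gt0// mulr_gt0.
have : `|u0 + t *: v - u0| < Num.min d d1.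
  rewrite addrC addKr normrZ gtr0_norm// /t mulrAC ltr_pdivrMr ?mulr_gt0// ltr_pM2l//.
  by have := normr_ge0 v; lra.
rewrite lt_min => /andP[td td1].
have := (Hd (u0 + t *: v) u0 td _ p0).2; rewrite subrr normr0 => /(_ d0).
rewrite [u0 + _ - _]addrC addKr bformZl bformZr normrZ gtr0_norm// => K.
have := Hd1 _ td1.
move: K; rewrite ler_norml => /andP[_]; set f1 := F _; set f0 := F u0; set q := bform A v v.
move=> K K1.
have : - (t * t * q / 2) <= (t * t) * (e / 2).
  have : e / (2 * (`|v| + 1) ^+ 2) * (t * `|v|) ^+ 2 <= t * t * (e / 2).
    rewrite exprMn mulrCA (expr2 t) ler_wpM2l ?(mulr_ge0 (ltW t0) (ltW t0))//.
    have V2 : `|v| ^+ 2 <= (`|v| + 1) ^+ 2 by rewrite ler_pXn2r ?nnegrE ?(ltW v1)// lerDl.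
    apply: le_trans (ler_wpM2l (ltW e'0) V2) _.
    by rewrite le_eqVlt; apply/orP; left; apply/eqP; field; rewrite gt_eqF.
  move: K K1; lra.
have tt : 0 < t * t by rewrite mulr_gt0.
rewrite -mulrA -mulrN ler_pM2l//; lra.
Qed.

End second_order.

(** * Rank factorization adapted to slice charts *)

Section normal_form.
Context {R : fieldType}.

(** [embedded_submanifold] makes the coordinates of index at least [d] vanish, so the projection has
    to keep the last coordinates, whereas [pid_mx] keeps the first ones. *)
Definition last_coords n d : 'M[R]_n := \matrix_(i, j) ((i == j) && (d <= i)%N)%:R.

Lemma last_coords_idem n d : last_coords n d *m last_coords n d = last_coords n d.
Proof.
apply/matrixP => i j; rewrite !mxE (bigD1 i)//= big1 => [|k ki]; last first.
  by rewrite !mxE eq_sym (negPf ki) mul0r.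
rewrite !mxE eqxx addr0 /=; case: (i == j) => //=; last by rewrite mulr0.
by rewrite -natrM mulnb andbb.
Qed.

Lemma mul_last_coordsE n d (v : 'rV[R]_n) i :
  (v *m last_coords n d) 0 i = if (d <= i)%N then v 0 i else 0.
Proof.
rewrite !mxE (bigD1 i)//= big1 => [|k ki]; last by rewrite !mxE (negPf ki) mulr0.
by rewrite !mxE eqxx addr0 /=; case: leqP => _; rewrite (mulr1, mulr0).
Qed.

(** Conjugating the [pid_mx] factorization by the permutation [P] that reverses the order of the
    coordinates moves the rank block to the end. The witness [d] is the dimension of the kernel. *)
Lemma rank_normal_form n (A : 'M[R]_n) : exists (d : nat) (C B : 'M[R]_n),
  [/\ (d <= n)%N, C \in unitmx, B \in unitmx & A = C *m last_coords n d *m B].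
Proof.
pose P : 'M[R]_n := \matrix_(i, j) (j == rev_ord i)%:R.
have mulP m (X : 'M[R]_(n, m)) i j : (P *m X) i j = X (rev_ord i) j.
  rewrite !mxE (bigD1 (rev_ord i))//= big1 => [|k ki]; last first.
    by rewrite mxE (negPf ki) mul0r.
  by rewrite mxE eqxx mul1r addr0.
have P2 : P *m P = 1%:M.
  by apply/matrixP => i j; rewrite mulP !mxE rev_ordK eq_sym.
have uP : P \in unitmx by case/mulmx1_unit: P2.
have r_n := rank_leq_row A.
exists (n - \rank A)%N, (col_ebase A *m P), (P *m row_ebase A).
split; first exact: leq_subr.
- by rewrite unitmx_mul col_ebase_unit uP.
- by rewrite unitmx_mul row_ebase_unit uP.
rewrite -[LHS]mulmx_ebase !mulmxA; congr (_ *m _).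
rewrite -!mulmxA; congr (_ *m _).
rewrite -[LHS]mul1mx -P2 -mulmxA; congr (_ *m _).
rewrite -[LHS]mulmx1 -P2 mulmxA; congr (_ *m _).
apply/matrixP => i j.
transitivity ((pid_mx (\rank A) : 'M[R]_n) (rev_ord i) (rev_ord j)).
  rewrite -mulP mxE (bigD1 (rev_ord j))//= big1 => [|k kj]; last first.
    by rewrite [P k j]mxE -(inj_eq (@rev_ord_inj n)) rev_ordK eq_sym (negPf kj) mulr0.
  by rewrite [P _ j]mxE rev_ordK eqxx mulr1 addr0.
rewrite !mxE (inj_eq val_inj) (inj_eq (@rev_ord_inj n)); congr ((_ && _)%:R).
by rewrite /= -subSn ?ltn_ord// subSS !leq_subLR addnC.
Qed.

End normal_form.

(** * Growth conditions in Euclidean space *)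

Section range_of_hessian.
Context {R : realType} {n : nat}.
Implicit Types (A G : 'M[R]_n) (u v w k : 'rV[R]_n).

(** For symmetric [A] the transposed columns of [cokermx A] lie in the kernel, so orthogonality to
    the kernel is exactly the criterion [submxE] for lying in the row space. *)
Lemma orthogonal_kernel A v : A^T = A ->
  (forall w, w *m A = 0 -> (v *m w^T) 0 0 = 0) -> exists a, v = a *m A.
Proof.
move=> AT H; suff /submxP [a ->] : (v <= A)%MS by exists a.
rewrite submxE; apply/eqP/rowP => j; rewrite [RHS]mxE.
pose w : 'rV[R]_n := (col j (cokermx A))^T.
have wA : w *m A = 0.
  have -> : w *m A = (A *m col j (cokermx A))^T by rewrite trmx_mul AT.
  by rewrite colE mulmxA mulmx_coker mul0mx trmx0.
rewrite -(H w wA) /w trmxK !mxE; apply: eq_bigr => k _.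
by rewrite [in RHS]mxE.
Qed.

(** [T = A *m invmx G] is the Hessian as an operator, self-adjoint for [G]. Its range meets its
    kernel only in 0, so [T] and [T *m T] have the same range, and a preimage of [v] can be taken in
    the range of [T], that is, among the normal vectors. *)
Lemma normal_preimage A G v : A^T = A -> posdef G ->
  (exists a, v *m G = a *m A) ->
  exists2 w, v *m G = w *m A & exists b, w *m G = b *m A.
Proof.
move=> AT G0 [a va]; have uG := posdef_unitmx G0.
pose T := A *m invmx G.
have vT : v = a *m T by rewrite /T mulmxA -va mulmxK.
have kT : (T :&: kermx T)%MS = 0.
  apply/eqP; rewrite -submx0; apply/rV_subP => x;
    rewrite sub_capmx => /andP[/submxP[c xc] /sub_kermxP xT].
  suff -> : x = 0 by exact: sub0mx.
  apply/eqP; apply: contraT => /G0.2.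
  have xA : x *m A = 0 by rewrite -[x *m A](mulmxKV uG) -[x *m A *m _]mulmxA xT mul0mx.
  rewrite /bform (_ : x *m G = c *m A); last by rewrite xc /T mulmxA mulmxKV.
  rewrite -mulmxA (_ : A *m x^T = (x *m A)^T); last by rewrite trmx_mul AT.
  by rewrite xA trmx0 mulmx0 mxE ltxx.
have rT : \rank (T *m T) = \rank T.
  by have := mxrank_mul_ker T T; rewrite kT mxrank0 addn0.
have TT : (T <= T *m T)%MS.
  by rewrite -(geq_leqif (mxrank_leqif_sup (submxMl T T))) rT.
have : (a *m T <= T *m T)%MS by apply: submx_trans TT; exact: submxMl.
move=> /submxP[b Eb]; exists (b *m T).
  by rewrite vT Eb {2}/T !mulmxA mulmxKV.
by exists b; rewrite /T mulmxA mulmxKV.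
Qed.

End range_of_hessian.

Section error_bounds.
Context {R : realType} {n : nat}.
Variables (F : 'rV[R]_n -> R) (U : set 'rV[R]_n) (u0 : 'rV[R]_n) (G : 'M[R]_n).
Hypotheses (oU : open U) (Uu0 : U u0) (F2 : Ck_on 2 U F) (G0 : posdef G).
Hypothesis F_min : \forall u \near u0, F u0 <= F u.
Local Notation p := (partials F).
Local Notation A := (hessian F u0).
Local Notation N := (gnorm G).
(** The dual norm of a covector; at [q = partials F u] it is the [G]-length of the gradient. *)
Definition dnorm (q : 'rV[R]_n) : R := gnorm G (q *m invmx G).

Definition local_PL m := \forall u \near u0, F u - F u0 <= (2 * m)^-1 * dnorm (p u) ^+ 2.
(** The distance is replaced by a witness [z]. That [z] can be required to lie within any [r] of
    [u0] makes it a critical point to which [taylor] applies. Near [u0], the solutions are the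
    points where [F] takes the value [F u0]. *)
Definition local_QG m := forall r, 0 < r -> \forall u \near u0, exists z,
  [/\ `|z - u0| < r, F z = F u0 & m / 2 * N (u - z) ^+ 2 <= F u - F u0].
Definition local_EB m := forall r, 0 < r -> \forall u \near u0, exists z,
  [/\ `|z - u0| < r, F z = F u0 & m * N (u - z) <= dnorm (p u)].

Lemma dnorm_ge0 q : 0 <= dnorm q.
Proof. exact: gnorm_ge0. Qed.

Lemma dnormD q q' : dnorm (q + q') <= dnorm q + dnorm q'.
Proof. by rewrite /dnorm mulmxDl; apply/gnormD/posdef_psd. Qed.

Lemma dnormZ a q : dnorm (a *: q) = `|a| * dnorm q.
Proof. by rewrite /dnorm -scalemxAl gnormZ. Qed.

Lemma dnorm_le : exists2 C, 0 < C & forall q, dnorm q <= C * `|q|.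
Proof.
have [C1 C10 H1] := gnorm_le G; have [C2 C20 H2] := mulmx_bound (invmx G).
exists (C1 * C2); first by rewrite mulr_gt0.
by move=> q; apply: le_trans (H1 _) _; rewrite -mulrA ler_pM2l.
Qed.

Lemma minimum_ball : exists2 r, 0 < r & forall u, `|u - u0| < r -> U u /\ F u0 <= F u.
Proof.
apply/near_norm; apply: filterS2 (open_nbhs_nbhs (conj oU Uu0)) F_min => u.
exact: conj.
Qed.

Lemma minimizer_critical : exists2 r, 0 < r & forall u, `|u - u0| < r ->
  F u = F u0 -> p u = 0.
Proof.
have [r r0 Hr] := minimum_ball; exists r => // u ur Fu.
apply: (@critical_point _ _ F U oU F2 u (r - `|u - u0|)).
- by rewrite subr_gt0.
- by have [] := Hr _ ur.
- move=> y yu; rewrite Fu; apply: (Hr y _).2.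
  by have := ler_normD (y - u) (u - u0); rewrite addrA subrK; move: yu; lra.
Qed.

Lemma F_continuous u : U u -> {for u, continuous F}.
Proof. by move=> Uu; apply: differentiable_continuous; apply: F2.1. Qed.

Lemma gnorm_continuous (x : 'rV[R]_n) : {for x, continuous N}.
Proof.
have [C C0 HC] := gnorm_le G.
apply/(@continuous_norm R 'rV[R]_n R) => e e0; exists (e / C); first by rewrite divr_gt0.
move=> y; rewrite ltr_pdivlMr// mulrC => yx.
have H1 := gnormD (y - x) x (posdef_psd G0); have H2 := gnormD (x - y) y (posdef_psd G0).
have H3 : N (x - y) = N (y - x) by rewrite -gnormN opprB.
rewrite !subrK in H1 H2; have := HC (y - x); rewrite ler_norml.
by move: yx H1 H2; rewrite H3 => *; apply/andP; split; lra.
Qed.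

Lemma gnorm_dist_continuous (u x : 'rV[R]_n) :
  {for x, continuous (fun y : 'rV[R]_n => N (y - u))}.
Proof.
apply/(@continuous_norm R 'rV[R]_n R) => e e0.
have [d d0 Hd] := (@continuous_norm R 'rV[R]_n R _ _).1 (@gnorm_continuous (x - u)) e e0.
exists d => // y yx; apply: Hd; rewrite opprB addrA subrK//.
Qed.

(* Ekeland-type argument: a minimizer [y] of [sqrt (F - F u0) + a N (. - u)]
   with [F y > F u0] would have too small a gradient for the PL inequality. *)
Lemma PL_QG m m' : 0 < m' -> m' < m -> local_PL m -> local_QG m'.
Proof.
move=> m'0 m'm PLm r r0; have m0 : 0 < m by exact: lt_trans m'm.
have [r1 r10 Hr1] := minimum_ball.
have [r2 r20 Hr2] : exists2 r, 0 < r & forall u, `|u - u0| < r ->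
   F u - F u0 <= (2 * m)^-1 * dnorm (p u) ^+ 2 by apply/near_norm.
pose rho := Num.min r (Num.min r1 r2) / 2.
have M0 : 0 < Num.min r (Num.min r1 r2) by rewrite !lt_min r0 r10.
have rho0 : 0 < rho by rewrite divr_gt0.
have rhoP u : `|u - u0| <= rho -> [/\ `|u - u0| < r, U u, F u0 <= F u &
   F u - F u0 <= (2 * m)^-1 * dnorm (p u) ^+ 2].
  move=> ur; have : `|u - u0| < Num.min r (Num.min r1 r2).
    by apply: le_lt_trans ur _; rewrite ltr_pdivrMr// ltr_pMr// ltr1n.
  rewrite !lt_min => /and3P[k1 k2 k3].
  by have [] := Hr1 _ k2; split => //; exact: Hr2.
(* With this weight, squaring [a * N (y - u) <= g u] gives exactly quadratic growth with constant
   [m']. *)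
pose a := Num.sqrt (m' / 2).
have a0 : 0 < a by rewrite sqrtr_gt0 divr_gt0.
have a2 : a ^+ 2 = m' / 2 by rewrite sqr_sqrtr// ltW// divr_gt0.
have [C C0 HC] := norm_le_gnorm G0.
pose g u := Num.sqrt (F u - F u0).
(* Comparing the minimum with the value at [u] gives [N (y - u) <= g u / a]; for [u] this close to
   [u0] the minimizer is interior to the ball of radius [rho]. *)
have [d d0 Hd] : exists2 d, 0 < d & forall u, `|u - u0| < d ->
    `|u - u0| < rho / 2 /\ C * (g u / a) < rho / 2.
  apply/near_norm.
  have K0 : 0 < (a * (rho / 4 / C)) ^+ 2 by rewrite exprn_gt0// mulr_gt0// !divr_gt0.
  have cF : {for u0, continuous F} by exact: F_continuous.
  move/cvgrPdist_le/(_ _ K0) : cF => cF.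
  have K : \forall u \near (u0 : 'rV[R]_n), `|u - u0| < rho / 2.
    by apply/near_norm; exists (rho / 2) => //; rewrite divr_gt0.
  apply: filterS2 K cF => u ur; rewrite ler_norml => /andP[H _]; split => //.
  apply: (@le_lt_trans _ _ (rho / 4)); last by move: rho0; lra.
  rewrite mulrC -ler_pdivlMr// ler_pdivrMr// mulrC.
  have w0 : 0 <= a * (rho / 4 / C) by rewrite ltW// mulr_gt0// !divr_gt0.
  rewrite -(@ler_pXn2r _ 2)// ?nnegrE ?sqrtr_ge0//.
  rewrite sqr_sqrtr; first by move: H; lra.
  have [] := rhoP u; last by move=> *; lra.
  by apply: ltW; apply: lt_trans ur _; move: rho0; lra.
apply/near_norm; exists d => // u /Hd [ur gur].
have ur' : `|u - u0| <= rho by move: ur rho0; lra.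
have [|||y] := @EVT_min_rV R n (fun y => g y + a * N (y - u)) [set x | `|x - u0| <= rho].
- by exists u0; rewrite /= subrr normr0 ltW.
- exact: closed_ball_compact.
- apply: continuous_in_subspaceT => x; rewrite inE/= => xr.
  have [_ Ux _ _] := rhoP _ xr.
  have c1 : {for x, continuous g}.
    apply: (@continuous_comp _ _ _ (fun x => F x - F u0) Num.sqrt); last exact: sqrt_continuous.
    by apply: (@continuousB R R^o 'rV[R]_n F (cst (F u0)) x);
      [exact: F_continuous|exact: cst_continuous].
  have c2 := @gnorm_dist_continuous u x.
  apply: (@continuousD R R^o 'rV[R]_n g (fun y => a * N (y - u)) x) => //.
  by apply: (@continuousM R 'rV[R]_n (cst a) (fun y => N (y - u)) x) => //; exact: cst_continuous.
rewrite inE/= => yr ymin.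
have yu : g y + a * N (y - u) <= g u.
  by have := ymin u; rewrite inE/= subrr gnorm0 mulr0 addr0; exact.
have gy0 : 0 <= g y by exact: sqrtr_ge0.
have Nyu : N (y - u) <= g u / a by rewrite ler_pdivlMr// mulrC; lra.
have yr' : `|y - u0| < rho.
  have := ler_normD (y - u) (u - u0); rewrite addrA subrK.
  have := HC (y - u); have : C * N (y - u) <= C * (g u / a) by rewrite ler_pM2l.
  by move: gur ur; lra.
have [y1 Uy Fy PLy] := rhoP _ yr.
have Nuy : N (u - y) = N (y - u) by rewrite -gnormN opprB.
have [_ _ Fu _] := rhoP _ ur'.
have gg x : F u0 <= F x -> g x ^+ 2 = F x - F u0 by move=> Fx; rewrite sqr_sqrtr// subr_ge0.
suff Fyu0 : F y = F u0.
  exists y; split => //; rewrite -a2 -exprMn Nuy -gg//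
    ler_pXn2r ?nnegrE ?mulr_ge0 ?gnorm_ge0 ?sqrtr_ge0 ?(ltW a0)//.
  by lra.
apply/eqP; apply: contraT => Fne.
have gpos : 0 < g y by rewrite sqrtr_gt0 subr_gt0 lt_def Fne.
(* Along [v], minimality lets [g] decrease at a rate of at most [a * N v]; squaring yields a bound
   on the slope of [F]. The step is kept so small that [g y - t * (a * N v)] stays nonnegative,
   which squaring needs. *)
have slope v : - (2 * a * g y * N v) <= (p y *m v^T) 0 0.
  have Q0 : 0 < `|v| + a * N v + 1 by rewrite ltr_wpDl// addr_ge0// mulr_ge0 ?gnorm_ge0// ltW.
  pose tau := Num.min (rho - `|y - u0|) (g y) / (`|v| + a * N v + 1).
  have m1 : 0 < Num.min (rho - `|y - u0|) (g y) by rewrite lt_min subr_gt0 yr'.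
  apply: (@slope_ge _ _ F U oU F2 y v (2 * a * g y * N v) tau) => //.
    by rewrite divr_gt0.
  move=> t t0; rewrite ltr_pdivlMr// lt_min !mulrDr mulr1 => /andP[t1 t2].
  have tv : 0 <= t * `|v| by rewrite mulr_ge0// ltW.
  have taN : 0 <= t * (a * N v) by rewrite !mulr_ge0 ?gnorm_ge0 ?ltW.
  have yt : `|y + t *: v - u0| <= rho.
    rewrite addrAC; apply: le_trans (ler_normD _ _) _; rewrite normrZ gtr0_norm//; lra.
  have [_ _ Fyt _] := rhoP _ yt.
  have := ymin (y + t *: v); rewrite inE/= => /(_ yt).
  have : N (y + t *: v - u) <= N (y - u) + t * N v.
    by rewrite addrAC; apply: le_trans (gnormD _ _ (posdef_psd G0)) _; rewrite gnormZ gtr0_norm.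
  rewrite -(ler_pM2l a0) mulrDr => k1 k2.
  have k3 : g y - t * (a * N v) <= g (y + t *: v) by move: k1 k2; lra.
  have k4 : (g y - t * (a * N v)) ^+ 2 <= g (y + t *: v) ^+ 2.
    by rewrite ler_pXn2r ?nnegrE ?sqrtr_ge0//; lra.
  rewrite !gg// sqrrB gg// in k4.
  have := sqr_ge0 (t * (a * N v)).
  have -> : 2 * a * g y * N v * t = g y * (t * (a * N v)) *+ 2 by rewrite -mulr_natr; ring.
  by move: k4; lra.
(* Against minus the gradient, the slope bound reads [dnorm (p y) <= 2 * a * g y]. Then PL gives
   [F y - F u0 <= m' / m * (F y - F u0)], impossible for [m' < m]. *)
have := slope (- (p y *m invmx G)); rewrite gnormN -/(dnorm (p y)) linearN/= mulmxN mxE lerN2.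
rewrite -dual_sqr// -/(dnorm (p y)) => K.
have K1 : dnorm (p y) <= 2 * a * g y.
  have := dnorm_ge0 (p y); rewrite le_eqVlt => /orP[/eqP <-|D0].
    by rewrite !mulr_ge0// ltW.
  by move: K; rewrite expr2 ler_pM2r.
have K2 : dnorm (p y) ^+ 2 <= (2 * a * g y) ^+ 2.
  by rewrite ler_pXn2r ?nnegrE ?dnorm_ge0// !mulr_ge0// ltW.
have K3 : (2 * a * g y) ^+ 2 = 2 * m' * (F y - F u0) by rewrite !exprMn a2 gg//; field.
have : F y - F u0 <= (2 * m)^-1 * (2 * m' * (F y - F u0)).
  by apply: le_trans PLy _; rewrite -K3 ler_pM2l// invr_gt0 mulr_gt0.
have Fpos : 0 < F y - F u0 by rewrite subr_gt0 lt_def Fne.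
rewrite ler_pdivlMl ?mulr_gt0// ler_pM2r// ler_pM2l//.
by rewrite leNgt m'm.
Qed.

(** At the solution [z], the increment of [F] is about half of [bform A h h], and the gradient
    paired with [h] is about [bform A h h]. Growth thus bounds this pairing below by almost
    [m * N h ^+ 2], and it is at most [dnorm (p u) * N h]. *)
Lemma QG_EB m m' : 0 < m' -> m' < m -> local_QG m -> local_EB m'.
Proof.
move=> m'0 m'm QGm r r0.
have [C C0 HC] := norm_le_gnorm G0.
(* The gradient expansion costs [n%:R * e] and twice the expansion of [F] costs [2 * e], both times
   [|h|^2]; [C ^+ 2] converts this to [N h ^+ 2], and [m - m'] absorbs the total. *)
pose e := (m - m') / ((n%:R + 2) * C ^+ 2).
have n2 : 0 < n%:R + 2 :> R by rewrite ltr_wpDl.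
have e0 : 0 < e by rewrite divr_gt0 ?subr_gt0// mulr_gt0// exprn_gt0.
have [d d0 Hd] := taylor oU Uu0 F2 e0.
have [r1 r10 Hr1] := minimizer_critical.
have R0 : 0 < Num.min r (Num.min r1 d) by rewrite !lt_min r0 r10.
have := QGm _ R0.
have K : \forall u \near u0, `|u - u0| < d by apply/near_norm; exists d.
apply: filterS2 K => u ud [z [zr Fz QGz]].
move: zr; rewrite !lt_min => /and3P[zr zr1 zd].
exists z; split => //.
have [H1 H2] := Hd u z ud zd (Hr1 _ zr1 Fz).
set h := u - z in QGz H1 H2 *.
have : `|((p u - h *m A) *m h^T) 0 0| <= n%:R * (e * `|h| * `|h|).
  apply: le_trans (dot_norm_le _ _) _; rewrite ler_wpM2l// ler_wpM2r//.
rewrite mulmxBl mxE [X in _ + X]mxE -/(bform A h h).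
have := dot_le (p u) h G0; rewrite -/(dnorm (p u)).
move: H2; rewrite Fz expr2; set b := bform A h h.
set s := (_ *m _) 0 0 => H2 H3 H4.
have H5 : (m - m') * N h ^+ 2 >= (n%:R + 2) * (e * `|h| * `|h|).
  have : `|h| * `|h| <= C ^+ 2 * N h ^+ 2.
    by rewrite -expr2 -exprMn ler_pXn2r ?nnegrE// mulr_ge0 ?gnorm_ge0// ltW.
  rewrite -(ler_pM2l (mulr_gt0 n2 e0)) => k.
  rewrite -[e * _ * _]mulrA mulrA; apply: le_trans k _.
  rewrite le_eqVlt; apply/orP; left; apply/eqP; rewrite /e; field.
  by rewrite !gt_eqF.
move: H2 H4; rewrite !ler_norml => /andP[H2 H2'] /andP[H4 H4'].
have H6 : m' * (N h * N h) <= dnorm (p u) * N h.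
  by move: QGz H3 H5; rewrite !expr2; lra.
have := gnorm_ge0 G h; rewrite le_eqVlt => /orP[/eqP <-|Nh0].
  by rewrite mulr0 dnorm_ge0.
by move: H6; rewrite mulrA ler_pM2r.
Qed.

(** Take the error bound at [u0 + t *: v], with solution [z]. Both [u0] and [z] are critical, so
    [(z - u0) *m A] is o(t), and since [v *m G] lies in the range of [A], so is the [G]-product of
    [v] with [z - u0]. Hence [z] is at distance at least [t * N v - o(t)], while the gradient is
    [t *: (v *m A)] up to o(t). *)
Lemma EB_normal_bound m v : 0 < m -> local_EB m ->
  (exists a, v *m G = a *m A) -> m * N v <= dnorm (v *m A).
Proof.
move=> m0 EBm [a va].
have [C C0 HC] := norm_le_gnorm G0.
have [C1 C10 HC1] := dnorm_le.
have [->|v0] := eqVneq v 0; first by rewrite gnorm0 mulr0 dnorm_ge0.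
have Nv0 : 0 < N v by rewrite gnorm_gt0.
(* These bound the distance to [z] by [t * K1], the displacement of [z] from [u0] by [t * K2], and
   the total error by [t * (e' * K3)]. *)
pose K1 := C / m * (dnorm (v *m A) + C1 * `|v|).
pose K2 := `|v| + K1.
pose K3 := m * (n%:R * (`|a| * K2)) + N v * (C1 * `|v|).
have K10 : 0 <= K1.
  by rewrite mulr_ge0 ?divr_ge0 ?addr_ge0 ?mulr_ge0 ?dnorm_ge0 ?(ltW C10) ?(ltW C0) ?(ltW m0).
have K20 : 0 <= K2 by rewrite addr_ge0.
have K30 : 0 <= K3.
  by rewrite addr_ge0 ?mulr_ge0 ?gnorm_ge0 ?(ltW m0) ?(ltW C10).
suff : m * (N v * N v) <= dnorm (v *m A) * N v by rewrite mulrA ler_pM2r.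
apply/ler_addgt0Pr => e e0.
(* Capping [e'] at 1 allows [K1], and with it [K2] and [K3], to be fixed before [e']. *)
pose e' := Num.min 1 (e / (K3 + 1)).
have e'0 : 0 < e' by rewrite lt_min ltr01 divr_gt0// ltr_wpDl.
have e'1 : e' <= 1 by rewrite ge_min lexx.
have e'K : e' * K3 <= e.
  apply: (@le_trans _ _ (e / (K3 + 1) * (K3 + 1))); last by rewrite divfK// gt_eqF// ltr_wpDl.
  by apply: ler_pM; rewrite ?(ltW e'0)// ?lerDl// ge_min lexx orbT.
have [d d0 Hd] := taylor oU Uu0 F2 e'0.
have [r1 r10 Hr1] := minimizer_critical.
have R0 : 0 < Num.min r1 d by rewrite !lt_min r10.
have /near_norm [d2 d20 Hd2] := EBm _ R0.
have M0 : 0 < Num.min d d2 by rewrite lt_min d0.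
have v1 : 0 < `|v| + 1 by rewrite ltr_wpDl.
have [t t0 tE] : exists2 t, 0 < t & t * (`|v| + 1) = Num.min d d2.
  by exists (Num.min d d2 / (`|v| + 1)); rewrite ?divfK ?gt_eqF// divr_gt0.
have tn : `|u0 + t *: v - u0| = t * `|v| by rewrite addrC addKr normrZ gtr0_norm.
have : `|u0 + t *: v - u0| < Num.min d d2.
  by rewrite tn -tE ltr_pM2l// ltrDl.
rewrite lt_min => /andP[td td2].
have [z [zr Fz EBz]] := Hd2 _ td2.
move: zr; rewrite lt_min => /andP[zr zd].
have pz := Hr1 _ zr Fz.
have u0d : `|u0 - u0| < d by rewrite subrr normr0.
have p0 : p u0 = 0 by apply: Hr1 => //; rewrite subrr normr0.
have [T1 _] := Hd _ _ td u0d p0; have [T2 _] := Hd _ _ zd u0d p0.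
rewrite tn [u0 + _ - _]addrC addKr in T1.
rewrite pz sub0r normrN in T2.
set x := u0 + t *: v in T1 EBz *; set w := z - u0 in T2 *; set h := x - z in EBz *.
have hE : h = t *: v - w by rewrite /h /x /w opprB addrA addrAC addrC addrA.
have D1 : dnorm (p x) <= t * dnorm (v *m A) + C1 * (e' * (t * `|v|)).
  rewrite -[p x](subrK ((t *: v) *m A)) addrC; apply: le_trans (dnormD _ _) _.
  apply: lerD; first by rewrite -scalemxAl dnormZ gtr0_norm.
  by apply: le_trans (HC1 _) _; rewrite ler_pM2l.
have hK1 : `|h| <= t * K1.
  apply: le_trans (HC _) _; rewrite /K1.
  have : C * N h <= C / m * (m * N h) by rewrite mulrA divfK ?gt_eqF.
  move=> /le_trans; apply; rewrite [t * _]mulrCA ler_pM2l ?divr_gt0//.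
  apply: le_trans EBz _; apply: le_trans D1 _; rewrite mulrDr lerD2l mulrCA.
  by rewrite [X in _ <= X]mulrCA ler_piMl// !mulr_ge0// ltW.
have wK2 : `|w| <= t * K2.
  have -> : w = t *: v - h by rewrite hE opprB addrCA subrr addr0.
  apply: le_trans (ler_normB _ _) _; rewrite normrZ gtr0_norm// /K2 mulrDr.
  by rewrite lerD2l.
have Bw : `|bform G v w| <= n%:R * (`|a| * (e' * (t * K2))).
  rewrite /bform va -mulmxA.
  have -> : A *m w^T = (w *m A)^T by rewrite trmx_mul (hessian_sym oU Uu0 F2).
  apply: le_trans (dot_norm_le _ _) _; rewrite ler_wpM2l// ler_wpM2l//.
  by apply: le_trans T2 _; rewrite ler_pM2l.
have Bh : t * (N v * N v) - n%:R * (`|a| * (e' * (t * K2))) <= N v * N h.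
  have := bform_le v h (posdef_psd G0).
  have -> : bform G v h = t * (N v * N v) - bform G v w.
    by rewrite hE bformDr bformNr bformZr -expr2 sqr_gnorm//; exact: posdef_psd.
  by move: Bw; rewrite ler_norml => /andP[_]; lra.
have Fin : t * (m * (N v * N v)) <= t * (dnorm (v *m A) * N v + e).
  have L1 : m * (N v * N h) <= N v * dnorm (p x) by rewrite mulrCA ler_pM2l.
  have L2 : N v * dnorm (p x) <= N v * (t * dnorm (v *m A) + C1 * (e' * (t * `|v|))).
    by rewrite ler_pM2l.
  have L3 : m * (t * (N v * N v) - n%:R * (`|a| * (e' * (t * K2)))) <= m * (N v * N h).
    by rewrite ler_pM2l.
  have L4 : t * (e' * K3) <= t * e by rewrite ler_pM2l.
  by move: L1 L2 L3 L4; rewrite /K3; lra.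
by move: Fin; rewrite ler_pM2l.
Qed.

Lemma EB_normal_coercive m v : 0 < m -> (forall m', 0 < m' -> m' < m -> local_EB m') ->
  (forall w, w *m A = 0 -> bform G v w = 0) -> m * N v ^+ 2 <= bform A v v.
Proof.
move=> m0 EBm vN.
have bound u : (exists a, u *m G = a *m A) -> m * N u <= dnorm (u *m A).
  move=> uN; apply/ler_addgt0Pr => e e0.
  (* Replacing [m] by [m'] costs at most [e] in the bound; the maximum with [m / 2] keeps [m']
     positive. *)
  pose m' := Num.max (m / 2) (m - e / (N u + 1)).
  have N1 : 0 < N u + 1 by rewrite ltr_wpDl// gnorm_ge0.
  have m'0 : 0 < m' by rewrite lt_max divr_gt0.
  have m'm : m' < m.
    by rewrite gt_max ltr_pdivrMr// ltr_pMr// ltr1n/= ltrBlDr ltrDl divr_gt0.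
  have := EB_normal_bound m'0 (EBm _ m'0 m'm) uN.
  have : (m - e / (N u + 1)) * N u <= m' * N u.
    by rewrite ler_wpM2r ?gnorm_ge0// le_max lexx orbT.
  have : e / (N u + 1) * N u <= e.
    by rewrite mulrAC ler_pdivrMr// ler_pM2l// lerDl.
  by lra.
have AT := hessian_sym oU Uu0 F2.
have [a va] : exists a, v *m G = a *m A.
  by apply: orthogonal_kernel AT _ => w /vN.
have [w vw wN] := normal_preimage AT G0 (ex_intro _ a va).
have A0 := hessian_psd oU Uu0 F2 F_min.
have [->|v0] := eqVneq v 0; first by rewrite gnorm0 expr0n mulr0 bform0l.
have Nv0 : 0 < N v by rewrite gnorm_gt0.
have E1 : bform A w v = N v ^+ 2.
  by rewrite sqr_gnorm; [rewrite /bform vw|exact: posdef_psd].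
have E2 : m * N w <= N v.
  by apply: le_trans (bound _ wN) _; rewrite -vw /dnorm mulmxK// posdef_unitmx.
have E3 : bform A w w <= N v * N w.
  have := bform_le v w (posdef_psd G0); rewrite {1}/bform vw.
  by rewrite /bform -mulmxA mulmxA.
have := cauchy_schwarz_sq w v A0; rewrite E1 => CS.
have bv : 0 <= bform A v v by exact: A0.2.
have CS2 : m * (N v ^+ 2) ^+ 2 <= (N v * N v) * bform A v v.
  apply: le_trans (_ : m * (bform A w w * bform A v v) <= _); first by rewrite ler_pM2l.
  apply: le_trans (_ : m * (N v * N w * bform A v v) <= _).
    by rewrite ler_pM2l// ler_wpM2r.
  rewrite !mulrA ler_wpM2r// -mulrA mulrCA ler_pM2l//.
by move: CS2; rewrite [in X in X -> _]expr2 -expr2 mulrA -[X in X * bform _ _ _]expr2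
  mulrC ler_pM2l ?exprn_gt0// .
Qed.

(** [L] plays the role of P, and [L'] undoes it on the range of [A]. If [p x *m L = 0], then
    [h *m A *m L], hence [h *m A], hence [p x], is small compared with [h = x - z], whereas the
    error bound makes [h] at most a constant times [p x]. *)
Lemma EB_solution_set m q (L : 'M[R]_(n, q)) (L' : 'M[R]_(q, n)) : 0 < m -> local_EB m ->
  A = A *m L *m L' ->
  exists2 d, 0 < d & forall x, `|x - u0| < d -> (F x = F u0 <-> p x *m L = 0).
Proof.
move=> m0 EBm AL.
have [C C0 HC] := norm_le_gnorm G0.
have [C1 C10 HC1] := dnorm_le.
have [C2 C20 HC2] := mulmx_bound L.
have [C3 C30 HC3] := mulmx_bound L'.
(* The chain of estimates ends in [|h| <= K * (e * |h|)], so [e = (2 * K)^-1] forces [h = 0]. *)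
pose K := C * (m^-1 * (C1 * (C3 * C2 + 1))).
have K0 : 0 < K by rewrite !mulr_gt0 ?invr_gt0// ltr_wpDl// mulr_ge0 ?ltW.
have e0 : 0 < (2 * K)^-1 by rewrite invr_gt0 mulr_gt0.
have [d d0 Hd] := taylor oU Uu0 F2 e0.
have [r1 r10 Hr1] := minimizer_critical.
have R0 : 0 < Num.min r1 d by rewrite !lt_min r10.
have /near_norm [d2 d20 Hd2] := EBm _ R0.
exists (Num.min r1 (Num.min d d2)); first by rewrite !lt_min r10 d0.
move=> x; rewrite !lt_min => /and3P[xr xd xd2]; split=> [Fx|pL].
  by rewrite (Hr1 _ xr Fx) mul0mx.
have [z [zr Fz EBz]] := Hd2 _ xd2.
move: zr; rewrite lt_min => /andP[zr zd].
have [T _] := Hd _ _ xd zd (Hr1 _ zr Fz).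
set h := x - z in T EBz *; set e := (2 * K)^-1 in e0 T.
have hA : `|h *m A| <= C3 * (C2 * (e * `|h|)).
  rewrite AL !mulmxA; apply: le_trans (HC3 _) _; rewrite ler_pM2l//.
  have -> : h *m A *m L = - ((p x - h *m A) *m L) by rewrite [(p x - _) *m L]mulmxBl pL sub0r opprK.
  by rewrite normrN; apply: le_trans (HC2 _) _; rewrite ler_pM2l.
have px : `|p x| <= (C3 * C2 + 1) * (e * `|h|).
  rewrite -[p x](subrK (h *m A)) mulrDl addrC mul1r -mulrA.
  by apply: le_trans (ler_normD _ _) _; exact: lerD.
have hh : `|h| <= K * (e * `|h|).
  apply: le_trans (HC _) _; rewrite /K -!mulrA ler_pM2l// ler_pdivlMl//.
  by apply: le_trans EBz _; apply: le_trans (HC1 _) _; rewrite ler_pM2l.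
have : `|h| <= 2^-1 * `|h|.
  by apply: le_trans hh _; rewrite /e invfM mulrA [K * (_ * _)]mulrCA mulfV ?mulr1// gt_eqF.
have := normr_ge0 h => h0 h1.
have : h = 0 by apply/eqP; rewrite -normr_le0; lra.
by move/eqP; rewrite subr_eq0 => /eqP ->.
Qed.

End error_bounds.

(** * Charts and the metric *)

Section integral_minorants.
Context {R : realType}.

(** The integral of a nonnegative function is the supremum over the simple functions below it, hence
    monotone whether or not [f] is measurable; here [f] will be the speed of a curve. *)
Lemma le_integral_minorant d (T : measurableType d) (mu : {measure set T -> \bar R})
    (D : set T) (g f : T -> R) :
  (forall x, D x -> 0 <= g x <= f x) ->
  (\int[mu]_(x in D) (g x)%:E <= \int[mu]_(x in D) (f x)%:E)%E.
Proof.
move=> H.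
have g0 x : D x -> (0 <= (g x)%:E)%E by move=> /H /andP[]; rewrite lee_fin.
have f0 x : D x -> (0 <= (f x)%:E)%E.
  by move=> /H /andP[g0x gfx]; rewrite lee_fin; exact: le_trans gfx.
rewrite !ge0_integralE//; apply: ereal_sup_le => _ [h hg <-]; exists h => // x.
apply: le_trans (hg x) _; rewrite /patch; case: ifPn => //; rewrite inE => /H /andP[_].
by rewrite lee_fin.
Qed.

(** [g] is the positive part of [k'] on the open interval, extended by 0. Nonnegativity and the
    extension let the minorants of successive segments be added, and the break points of a piecewise
    curve are left out. *)
Lemma positive_part_minorant (a b : R) (k k' : R -> R) : a < b ->
  (forall t, a <= t <= b -> is_derive t 1 k (k' t) /\ {for t, continuous k'}) ->
  exists g : R -> R, [/\ measurable_fun setT g, (forall t, 0 <= g t),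
    (forall t, ~~ (a < t < b) -> g t = 0),
    (forall t, a < t < b -> g t = Num.max 0 (k' t)) &
    ((k b - k a)%:E <= \int[lebesgue_measure]_t (g t)%:E)%E].
Proof.
move=> ab H.
have cc : {within `[a, b], continuous k'}.
  by apply: continuous_in_subspaceT => t; rewrite inE/= in_itv/= => /H[].
have coo : {within `]a, b[, continuous k'}.
  apply: continuous_in_subspaceT => t; rewrite inE/= in_itv/= => /andP[t1 t2].
  by apply: (H _ _).2; rewrite !ltW.
have mk' : measurable_fun `]a, b[ k' by apply: subspace_continuous_measurable_fun.
pose m t := Num.max 0 (k' t).
have mm : measurable_fun `]a, b[ m by apply: measurable_maxr => //; exact: measurable_cst.
exists (m \_ `]a, b[); split.
- exact/(measurable_restrictT _ _).1.
- by move=> t; rewrite /patch; case: ifP => // _; rewrite le_max lexx.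
- by move=> t tab; rewrite /patch; case: ifPn => //; rewrite inE/= in_itv/= (negPf tab).
- by move=> t tab; rewrite /patch mem_set//= in_itv/=.
have -> : (\int[lebesgue_measure]_t ((m \_ `]a, b[) t)%:E =
    \int[lebesgue_measure]_(t in `]a, b[) (m t)%:E)%E.
  by rewrite [RHS]integral_mkcond; apply: eq_integral => t _; rewrite /patch; case: ifP.
have dk : derivable_oo_LRcontinuous k a b.
  have ck t : a <= t <= b -> {for t, continuous k}.
    by move=> /H[+ _]; exact: is_derive_continuous.
  have kw : {within `[a, b], continuous k}.
    by apply: continuous_in_subspaceT => t; rewrite inE/= in_itv/=; exact: ck.
  have [_ kR kL] := (continuous_within_itvP k ab).1 kw.
  split=> // t; rewrite in_itv/= => /andP[t1 t2].
  by have [|[dk _] _] := H t; [rewrite !ltW|exact: dk].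
have dkE : {in `]a, b[, derive1 k =1 k'}.
  move=> t; rewrite in_itv/= => /andP[t1 t2]; rewrite derive1E.
  by apply: derive_val; apply: (H t _).1; rewrite !ltW.
have := continuous_FTC2 ab cc dk dkE; rewrite -EFinB => <-.
rewrite integral_itv_bndoo; last exact/measurable_EFinP.
rewrite [leLHS]integralE.
apply: (@le_trans _ _ (\int[lebesgue_measure]_(x in `]a, b[) ((fun x => (k' x)%:E)^\+ x)))%E.
  rewrite -[leRHS]adde0; apply: leeD2l; rewrite oppe_le0; exact: integral_ge0.
rewrite le_eqVlt; apply/orP; left; apply/eqP; apply: eq_integral => t _.
by rewrite funeposE /m EFin_max maxC.
Qed.

End integral_minorants.

Section chart_computations.
Context {R : realType} {n : nat} {M : riemannianManifold R n}.
Implicit Types (c : chart R n M) (x y : M).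

Lemma chart_codP c u : chart_cod c u ->
  chart_dom c (chart_inv c u) /\ chart_map c (chart_inv c u) = u.
Proof. by move=> [x xc <-]; rewrite chart_mapK. Qed.

Lemma chart_dom_cod c x : chart_dom c x -> chart_cod c (chart_map c x).
Proof. by exists x. Qed.

Lemma chart_cod_near c u : chart_cod c u -> \forall v \near u, chart_cod c v.
Proof. by move=> cu; apply: open_nbhs_nbhs; split => //; exact: chart_cod_open. Qed.

Lemma chart_dom_near c x : chart_dom c x -> \forall y \near x, chart_dom c y.
Proof. by move=> cx; apply: open_nbhs_nbhs; split => //; exact: chart_dom_open. Qed.

Lemma metric_posdef c u : atlas c -> chart_cod c u -> posdef (metric c u).
Proof.
move=> ac cu; split=> [|v v0]; first exact: (Defs.metric_sym ac cu).
exact: (metric_pos ac cu v0).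
Qed.

(** By continuity of the metric, the two quadratic forms at [v] differ by at most [n^2 * e * |v|^2];
    [e] is chosen so that this is at most [1 - k ^+ 2] times the form at [u0]. *)
Lemma metric_comparison c u0 (k : R) : atlas c -> chart_cod c u0 -> 0 < k -> k < 1 ->
  \forall u \near u0, forall v, k * gnorm (metric c u0) v <= gnorm (metric c u) v.
Proof.
move=> ac cu0 k0 k1.
have G0 := metric_posdef ac cu0.
have [C C0 HC] := norm_le_gnorm G0.
have n1 : 0 < n%:R * n%:R + 1 :> R by rewrite ltr_wpDl// mulr_ge0.
have k2 : 0 < 1 - k ^+ 2 by rewrite subr_gt0 expr_lt1// ltW.
have [e e0 eE] : exists2 e, 0 < e & (n%:R * n%:R + 1) * e * C ^+ 2 = 1 - k ^+ 2.
  exists ((1 - k ^+ 2) / ((n%:R * n%:R + 1) * C ^+ 2)).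
    by rewrite divr_gt0// mulr_gt0// exprn_gt0.
  by field; rewrite !gt_eqF.
have cm : {for u0, continuous (metric c)} by exact: (metric_smooth 0 ac).
have /near_norm[d d0 Hd] : \forall u \near u0, `|metric c u0 - metric c u| <= e.
  by move/cvgrPdist_le : cm => /(_ _ e0).
have /near_norm[d' d'0 Hd'] := chart_cod_near cu0.
apply/near_norm; exists (Num.min d d'); first by rewrite lt_min d0.
move=> u; rewrite lt_min => /andP[/Hd du /Hd' cu] v.
have Gu := metric_posdef ac cu.
rewrite -(@ler_pXn2r _ 2)// ?nnegrE ?mulr_ge0 ?gnorm_ge0 ?(ltW k0)//.
rewrite exprMn !sqr_gnorm; [|exact: posdef_psd..].
set q0 := bform _ v v.
have E : bform (metric c u) v v = q0 - bform (metric c u0 - metric c u) v v.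
  by rewrite /q0 /bform mulmxBr mulmxBl [X in _ = _ - X]mxE [X in _ - (_ + X)]mxE; ring.
have B : `|bform (metric c u0 - metric c u) v v| <= n%:R * n%:R * e * (`|v| * `|v|).
  apply: le_trans (dot_norm_le _ _) _; rewrite -!mulrA ler_wpM2l// !mulrA ler_wpM2r//.
  apply: le_trans (mulmx_norm_le _ _) _; rewrite -[leRHS]mulrA ler_wpM2l// mulrC ler_wpM2r//.
have V : `|v| * `|v| <= C ^+ 2 * q0.
  rewrite /q0 -sqr_gnorm; last exact: posdef_psd.
  by rewrite -exprMn -expr2 ler_pXn2r ?nnegrE ?mulr_ge0 ?gnorm_ge0 ?(ltW C0).
have K : n%:R * n%:R * e * (`|v| * `|v|) <= (1 - k ^+ 2) * q0.
  have -> : (1 - k ^+ 2) * q0 = (n%:R * n%:R + 1) * e * (C ^+ 2 * q0).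
    by rewrite -eE; ring.
  apply: ler_pM => //; rewrite ?mulr_ge0 ?(ltW e0)//.
  by rewrite ler_pM2r// lerDl.
by move: B; rewrite ler_norml E => /andP[_]; move: K; lra.
Qed.

Lemma transition_differentiable c c' x : atlas c -> atlas c' ->
  chart_dom c x -> chart_dom c' x -> differentiable (transition c c') (chart_map c x).
Proof.
move=> ac ac' cx c'x; have [[dt _] _] := atlas_smooth 1 ac ac'.
by apply: dt; exists x.
Qed.

Lemma overlap_nbhs c c' x : chart_dom c x -> chart_dom c' x ->
  \forall u \near chart_map c x, chart_cod c u /\ chart_dom c' (chart_inv c u).
Proof.
move=> cx c'x.
have oc : \forall u \near chart_map c x, chart_cod c u.
  by apply: open_nbhs_nbhs; split; [exact: chart_cod_open|exact: chart_dom_cod].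
have : \forall u \near chart_map c x, chart_dom c' (chart_inv c u).
  apply: (chart_inv_continuous (chart_dom_cod cx)); rewrite chart_mapK//.
  by apply: open_nbhs_nbhs; split => //; exact: chart_dom_open.
by move: oc; apply: filterS2.
Qed.

(** [velocity] is read in the preferred chart at [gamma t], which changes along the curve; the
    Jacobian this introduces is cancelled by the transformation law of the metric. *)
Lemma rnorm_velocity c (gamma : R -> M) t : atlas c -> {for t, continuous gamma} ->
  chart_dom c (gamma t) -> differentiable (chart_map c \o gamma) t ->
  rnorm (gamma t) (velocity gamma t) =
  gnorm (metric c (chart_map c (gamma t))) ('D_1 (chart_map c \o gamma) t).
Proof.
move=> ac cg cgt dw; set c' := chart_at (gamma t).
have ac' : atlas c' by exact: chart_at_atlas.
have c'gt : chart_dom c' (gamma t) by exact: chart_at_dom.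
have dt := transition_differentiable ac ac' cgt c'gt.
have E : velocity gamma t = 'D_1 (chart_map c \o gamma) t *m 'J (transition c c')
  (chart_map c (gamma t)).
  rewrite /velocity derive1E -deriveEjacobian//.
  have -> : 'D_1 (chart_map c' \o gamma) t = 'D_1 (transition c c' \o (chart_map c \o gamma)) t.
    apply: near_eq_derive.
    have : \forall s \near t, chart_dom c (gamma s).
      by apply: cg; apply: open_nbhs_nbhs; split => //; exact: chart_dom_open.
    by apply: filterS => s cs; rewrite /transition /= chart_mapK.
  exact: derive_comp dw dt.
rewrite /rnorm /gnorm; congr Num.sqrt.
rewrite /inner /bform E (metric_change ac ac' cgt c'gt) -/c'.
by rewrite trmx_mul !mulmxA.
Qed.

Lemma partials_transition c c' (f : M -> R) x : atlas c -> atlas c' ->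
  chart_dom c x -> chart_dom c' x -> differentiable (f \o chart_inv c') (chart_map c' x) ->
  partials (f \o chart_inv c) (chart_map c x) =
  partials (f \o chart_inv c') (chart_map c' x) *m
     ('J (transition c c') (chart_map c x))^T.
Proof.
move=> ac ac' cx c'x df; set u := chart_map c x.
have dt := transition_differentiable ac ac' cx c'x.
have tu : transition c c' u = chart_map c' x by rewrite /transition/= chart_mapK.
have D v : 'D_v (f \o chart_inv c) u
  = 'D_(v *m 'J (transition c c') u) (f \o chart_inv c') (chart_map c' x).
  have -> : 'D_v (f \o chart_inv c) u = 'D_v ((f \o chart_inv c') \o transition c c') u.
    apply: near_eq_derive; apply: filterS (overlap_nbhs cx c'x) => w [_ c'w].
    by rewrite /transition /= chart_mapK.
  have df' : differentiable (f \o chart_inv c') (transition c c' u) by rewrite tu.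
  by rewrite (derive_comp v dt df') tu deriveEjacobian.
apply/rowP => i; rewrite [LHS]mxE D derive_partials// dotC.
by rewrite [in LHS]trmx_mul mulmxA trmx_delta -colE mxE.
Qed.

Lemma rnorm_grad c (f : M -> R) x : atlas c -> chart_dom c x ->
  (forall c, atlas c -> chart_dom c x -> differentiable (f \o chart_inv c) (chart_map c x)) ->
  let G := metric c (chart_map c x) in
  rnorm x (grad f x) = gnorm G (partials (f \o chart_inv c) (chart_map c x) *m invmx G).
Proof.
move=> ac cx df /=; set c' := chart_at x.
have ac' : atlas c' by exact: chart_at_atlas.
have c'x : chart_dom c' x by exact: chart_at_dom.
rewrite (partials_transition ac ac' cx c'x (df _ ac' c'x)).
have GE := metric_change ac ac' cx c'x.
have uG := posdef_unitmx (metric_posdef ac (chart_dom_cod cx)).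
have uG' := posdef_unitmx (metric_posdef ac' (chart_dom_cod c'x)).
rewrite /rnorm /gnorm /inner /bform /grad /local_grad -/c'.
rewrite -/(partials (f \o chart_inv c') (chart_map c' x)).
move: uG uG' GE => /=; set G := metric c _; set G' := metric c' _; set J := 'J _ _.
set p := partials _ _ => uG uG' GE.
have uJ : J^T \in unitmx.
  by move: uG; rewrite GE unitmx_mul => /andP[].
(* The partial derivatives transform as a covector; this identity says that the gradient transforms
   as a vector. *)
suff -> : p *m invmx G' = p *m J^T *m invmx G *m J.
  by rewrite GE !trmx_mul !mulmxA.
apply: (can_inj (mulmxK uG')); rewrite mulmxKV//.
apply: (can_inj (mulmxK uJ)).
have -> : p *m J^T *m invmx G *m J *m G' *m J^T = p *m J^T *m invmx G *m (J *m G' *m J^T).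
  by rewrite !mulmxA.
by rewrite -GE mulmxKV.
Qed.

(** Passing to dual norms reverses the comparison: test the covector against its own gradient
    [g]. *)
Lemma dual_gnorm_comparison (G0 G : 'M[R]_n) (k : R) (p : 'rV[R]_n) :
  posdef G0 -> posdef G -> 0 < k -> (forall v, k * gnorm G0 v <= gnorm G v) ->
  gnorm G (p *m invmx G) <= dnorm G0 p / k.
Proof.
move=> pG0 pG k0 H; set g := p *m invmx G.
have := dual_sqr p pG; rewrite -/g => E.
have := dot_le p g pG0; rewrite -E -/(dnorm G0 p) => K.
have := gnorm_ge0 G g; rewrite le_eqVlt => /orP[/eqP <-|g0].
  by rewrite divr_ge0 ?dnorm_ge0 ?(ltW k0).
rewrite ler_pdivlMr// -(ler_pM2r g0).
apply: (@le_trans _ _ (k * (dnorm G0 p * gnorm G0 g))).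
  by rewrite mulrAC mulrC ler_pM2l// -expr2.
by rewrite mulrCA ler_wpM2l ?dnorm_ge0.
Qed.

End chart_computations.

(** * Lower bounds for the Riemannian distance *)

Section first_exit.
Context {R : realType}.

Lemma first_exit (P : R -> Prop) :
  (forall t, 0 <= t <= 1 -> P t -> exists2 e, 0 < e &
     forall s, 0 <= s <= 1 -> `|s - t| < e -> P s) ->
  P 0 -> ~ P 1 -> exists T, [/\ 0 < T, T <= 1, ~ P T & forall t, 0 <= t -> t < T -> P t].
Proof.
move=> oP P0 P1; pose E : set R := [set t | 0 <= t <= 1 /\ ~ P t].
have E1 : E 1 by split=> //; rewrite ler01 lexx.
have hE : has_inf E by split; [exists 1|exists 0 => t [/andP[]]].
have lbE t : E t -> inf E <= t by move=> Et; apply: ge_inf => //; case: hE.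
have T0 : 0 <= inf E by apply: lb_le_inf; [exists 1|move=> t [/andP[]]].
have T1 : inf E <= 1 by exact: lbE.
have PT : ~ P (inf E).
  move=> PT; have [|e e0 He] := oP _ _ PT; first by rewrite T0.
  have [t [t01 Pt] te] := inf_adherent e0 hE.
  have tE := lbE t (conj t01 Pt).
  apply: Pt; apply: He => //; rewrite ger0_norm ?subr_ge0; first by rewrite ltrBlDl.
  by [].
exists (inf E); split => //.
  by rewrite lt_def T0 andbT; apply/eqP => T00; apply: PT; rewrite T00.
move=> t t0 tT; apply: contrapT => Pt.
suff : inf E <= t by rewrite leNgt tT.
by apply: lbE; split => //; rewrite t0/= ltW// (lt_le_trans tT).
Qed.

End first_exit.

Section curve_length_bound.
Context {R : realType} {n : nat} {M : riemannianManifold R n}.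
Implicit Types (gamma : R -> M).

Lemma rnorm_ge0 (x : M) v : 0 <= rnorm x v.
Proof. exact: sqrtr_ge0. Qed.

Lemma C1_segment_sub (a b a' b' : R) gamma : a <= a' -> b' <= b ->
  C1_segment a b gamma -> C1_segment a' b' gamma.
Proof.
move=> aa bb [delta [I [oI abI cd E]]].
have sub t : t \in `[a', b'] -> t \in `[a, b].
  rewrite !in_itv/= => /andP[t1 t2].
  by rewrite (le_trans aa t1) (le_trans t2 bb).
exists delta, I; split=> // t /sub; [exact: abI|exact: E].
Qed.

Lemma C1_segment_near (a b : R) gamma t (O : set M) : C1_segment a b gamma ->
  a <= t <= b -> open O -> O (gamma t) ->
  exists2 e, 0 < e & forall s, a <= s <= b -> `|s - t| < e -> O (gamma s).
Proof.
move=> [delta [I [oI abI [cd _] E]]] tab oO Ot.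
have It : I t by apply: abI; rewrite /= in_itv.
have Odt : O (delta t) by rewrite -E// in_itv.
have /near_norm[e e0 He] : \forall s \near t, O (delta s).
  by apply: (cd _ It); exact: open_nbhs_nbhs.
by exists e => // s sab /He; rewrite E// in_itv.
Qed.

(** Continuity of a piecewise C^1 curve relative to its interval. [C1_segment] controls [gamma] on
    one closed segment only, so at a break point the neighborhoods on the two sides are merged. *)
Lemma segments_near s (a : R) gamma t (O : set M) : path <%R a s ->
  (forall i, (i < size s)%N -> C1_segment (nth 0 (a :: s) i) (nth 0 (a :: s) i.+1) gamma) ->
  a <= t <= last a s -> open O -> O (gamma t) ->
  exists2 e, 0 < e & forall r, a <= r <= last a s -> `|r - t| < e -> O (gamma r).
Proof.
elim: s a => [|b s IH] a /=.
  move=> _ _ tA _ Ot; exists 1 => // r rA _.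
  by rewrite -(le_anti rA) (le_anti tA).
move=> /andP[ab pbs] H tab oO Ot.
have S0 : C1_segment a b gamma := H 0%N isT.
have H' i : (i < size s)%N -> C1_segment (nth 0 (b :: s) i) (nth 0 (b :: s) i.+1) gamma.
  by move=> si; exact: H i.+1 si.
case/andP: tab => at_ tl.
have [tb|bt|tb] := ltgtP t b.
- have tab : a <= t <= b by rewrite at_ (ltW tb).
  have [e e0 He] := C1_segment_near S0 tab oO Ot.
  exists (Num.min e (b - t)); first by rewrite lt_min e0 subr_gt0.
  move=> r /andP[ar rl]; rewrite lt_min => /andP[re rb]; apply: He => //.
  rewrite ar/=; apply: ltW; move: rb; have := ler_norm (r - t); lra.
- have tbl : b <= t <= last b s by rewrite (ltW bt).
  have [e e0 He] := IH b pbs H' tbl oO Ot.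
  exists (Num.min e (t - b)); first by rewrite lt_min e0 subr_gt0.
  move=> r /andP[ar rl]; rewrite lt_min => /andP[re rb]; apply: He => //.
  rewrite rl andbT; apply: ltW; move: rb; have := ler_norm (t - r); rewrite distrC; lra.
- have tab : a <= t <= b by rewrite at_ tb lexx.
  have tbl : b <= t <= last b s by rewrite tl andbT tb.
  have [e e0 He] := C1_segment_near S0 tab oO Ot.
  have [e' e'0 He'] := IH b pbs H' tbl oO Ot.
  exists (Num.min e e'); first by rewrite lt_min e0.
  move=> r /andP[ar rl]; rewrite lt_min => /andP[re re'].
  by have [rb|/ltW br] := leP r b; [apply: He|apply: He']; rewrite ?ar ?rb ?br.
Qed.

Variables (c : chart R n M) (a0 : 'rV[R]_n) (G : 'M[R]_n) (k rho : R).
Hypotheses (ac : atlas c) (G0 : posdef G) (k0 : 0 < k) (rho0 : 0 < rho).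
Hypothesis ball_cod : forall u, gnorm G (u - a0) <= rho -> chart_cod c u.
Hypothesis ball_metric : forall u, gnorm G (u - a0) <= rho ->
  forall v, k * gnorm G v <= gnorm (metric c u) v.
Local Notation in_ball y := (chart_dom c y /\ gnorm G (chart_map c y - a0) <= rho).
Local Notation coord_ball y := (chart_dom c y /\ gnorm G (chart_map c y - a0) < rho).

(** Displacement is measured in a fixed direction [l], so it is linear and adds up over segments,
    and no norm has to be differentiated along the curve. *)
Definition speed_minorant gamma (a b : R) (l : 'rV[R]_n) (g : R -> R) :=
  [/\ measurable_fun setT g, (forall t, 0 <= g t <= rnorm (gamma t) (velocity gamma t)),
      (forall t, ~~ (a < t < b) -> g t = 0) &
      ((k * bform G (chart_map c (gamma b) - chart_map c (gamma a)) l)%:E <=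
        \int[lebesgue_measure]_t (g t)%:E)%E].

Lemma speed_minorant0 gamma a l : speed_minorant gamma a a l (cst 0).
Proof.
split=> [|t||]//; first by rewrite lexx rnorm_ge0.
by rewrite subrr bform0l mulr0 integral0.
Qed.

(** The function [kf] is [k] times the [G]-product of the coordinates with [l]. Its derivative is at
    most [k] times the [G]-norm of the coordinate velocity, hence at most the Riemannian speed in
    the ball. At the end points [delta] replaces [gamma], as [gamma] need not be differentiable
    there. *)
Lemma segment_speed_minorant gamma a b l : a < b -> C1_segment a b gamma ->
  (forall t, a <= t <= b -> in_ball (gamma t)) -> gnorm G l <= 1 ->
  exists g, speed_minorant gamma a b l g.
Proof.
move=> ab [delta [I [oI abI [cd dd] E]]] H l1.
pose w := chart_map c \o delta.
pose O := I `&` delta @^-1` chart_dom c.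
have oO : open O.
  apply/(@open_norm R R^o) => t [It dt]; apply/(@near_norm R R^o).
  apply: filterI; first exact: open_nbhs_nbhs.
  by apply: (cd t It); apply: open_nbhs_nbhs; split => //; exact: chart_dom_open.
have w1 : Ck_on 1 O w := dd c ac.
have gd t : a <= t <= b -> gamma t = delta t by move=> tab; apply: E; rewrite in_itv.
have Oab t : a <= t <= b -> O t.
  move=> tab; split; first by apply: abI; rewrite /= in_itv.
  by rewrite /= -gd//; exact: (H t tab).1.
pose B : 'M[R]_(n, 1) := k *: (G *m l^T).
have BE v : (v *m B) 0 0 = k * bform G v l.
  by rewrite /B -scalemxAr mxE /bform mulmxA.
pose kf t := (w t *m B) 0 0.
have kf1 : Ck_on 1 O kf.
  exact: (C1_coord 0 oO (C1_mulmxr B oO w1)).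
have [|g [mg g0 goff gon gint]] := @positive_part_minorant R a b kf ('D_1 kf) ab.
  move=> t /Oab Ot; split; last exact: (kf1.2 1 t Ot).
  by apply: derivableP; apply: diff_derivable; exact: kf1.1.
exists g; split => //; last first.
  have -> : k * bform G (chart_map c (gamma b) - chart_map c (gamma a)) l = kf b - kf a.
    rewrite -BE mulmxBl mxE [X in _ + X]mxE /kf /w /= !gd//.
      by rewrite lexx ltW.
    by rewrite lexx ltW.
  exact: gint.
move=> t; rewrite g0/=; have [tab|tab] := boolP (a < t < b); last by rewrite goff// rnorm_ge0.
rewrite gon// ge_max rnorm_ge0/=.
have tab' : a <= t <= b by case/andP: tab => *; rewrite !ltW.
have Ot := Oab t tab'.
have oab : open [set` `]a, b[] by exact: interval_open.
have tab'' : [set` `]a, b[] t by rewrite /= in_itv.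
have gdn : \forall s \near t, delta s = gamma s.
  by apply: filterS (open_nbhs_nbhs (conj oab tab'')) => s /=;
    rewrite in_itv/= => /andP[s1 s2]; rewrite gd// !ltW.
have cg : {for t, continuous gamma}.
  have := cd t Ot.1; rewrite /prop_for /continuous_at gd// => cdt.
  by apply: cvg_trans cdt; exact: near_eq_cvg.
have w1' : Ck_on 1 [set` `]a, b[] (chart_map c \o gamma).
  apply: (C1_ext oab (f := w)).
    by move=> s /=; rewrite in_itv/= => /andP[s1 s2]; rewrite /w /= gd// !ltW.
  apply: C1_subset w1 => s /=; rewrite in_itv/= => /andP[s1 s2]; apply: Oab.
  by rewrite !ltW.
have [domt ballt] := H t tab'.
rewrite (rnorm_velocity ac cg domt (w1'.1 _ tab'')).
apply: le_trans (ball_metric ballt _).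
have -> : 'D_1 (chart_map c \o gamma) t = 'D_1 w t.
  by apply: near_eq_derive; apply: filterS gdn => s; rewrite /w /= => ->.
rewrite /kf derive_mulmxr_coord; last exact: w1.1.
rewrite BE ler_pM2l//; apply: le_trans (bform_le _ _ (posdef_psd G0)) _.
by rewrite ler_piMr// gnorm_ge0.
Qed.

Lemma segments_speed_minorant s (a : R) gamma l T : path <%R a s ->
  (forall i, (i < size s)%N -> C1_segment (nth 0 (a :: s) i) (nth 0 (a :: s) i.+1) gamma) ->
  a <= T <= last a s -> (forall t, a <= t <= T -> in_ball (gamma t)) -> gnorm G l <= 1 ->
  exists g, speed_minorant gamma a T l g.
Proof.
elim: s a => [|b s IH] a /=.
  move=> _ _ aT _ _; rewrite -(le_anti aT); exists (cst 0); exact: speed_minorant0.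
move=> /andP[ab pbs] H /andP[aT Tl] HB l1.
have S0 : C1_segment a b gamma := H 0%N isT.
have H' i : (i < size s)%N -> C1_segment (nth 0 (b :: s) i) (nth 0 (b :: s) i.+1) gamma.
  by move=> si; exact: H i.+1 si.
have [Tb|bT] := leP T b.
  move: aT; rewrite le_eqVlt => /orP[/eqP <-|aT].
    by exists (cst 0); exact: speed_minorant0.
  by apply: segment_speed_minorant => //; exact: C1_segment_sub S0.
have [|g1 [m1 p1 o1 i1]] := @segment_speed_minorant gamma a b l ab S0 _ l1.
  by move=> t /andP[t1 t2]; apply: HB; rewrite t1 (le_trans t2)// ltW.
have [||g2 [m2 p2 o2 i2]] := IH b pbs H' _ _ l1.
- by rewrite (ltW bT).
- by move=> t /andP[t1 t2]; apply: HB; rewrite t2 (le_trans (ltW ab) t1).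
exists (g1 \+ g2); split.
- exact: measurable_funD.
- move=> t /=; have /andP[a1 b1] := p1 t; have /andP[a2 b2] := p2 t.
  rewrite addr_ge0//=; have [tb|bt] := leP t b.
    by rewrite (o2 t) ?addr0// ltNge tb.
  by rewrite (o1 t) ?add0r// (ltNge t b) (ltW bt) andbF.
- move=> t tn; rewrite /= o1 ?o2 ?addr0//.
    by apply: contra tn => /andP[t1 ->]; rewrite (lt_trans ab t1).
  by apply: contra tn => /andP[-> t1]; rewrite (lt_trans t1 bT).
have -> : (\int[lebesgue_measure]_t ((g1 \+ g2) t)%:E =
    \int[lebesgue_measure]_t (g1 t)%:E + \int[lebesgue_measure]_t (g2 t)%:E)%E.
  rewrite -ge0_integralD//.
  - by move=> t _; rewrite lee_fin; have /andP[] := p1 t.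
  - exact/measurable_EFinP.
  - by move=> t _; rewrite lee_fin; have /andP[] := p2 t.
  - exact/measurable_EFinP.
apply: le_trans (leeD i1 i2); rewrite -EFinD lee_fin -mulrDr -bformDl.
suff -> : forall x y z : 'rV[R]_n, y - x + (z - y) = z - x by [].
by move=> x y z; rewrite addrC addrA subrK.
Qed.

Lemma coord_ball_open : open [set y | coord_ball y].
Proof.
rewrite openE => y [cy ry]; apply: filterI.
  by apply: open_nbhs_nbhs; split => //; exact: chart_dom_open.
suff K : \forall u \near chart_map c y, gnorm G (u - a0) < rho.
  exact: (chart_map_continuous cy K).
have [C C0 HC] := gnorm_le G.
apply/near_norm; exists ((rho - gnorm G (chart_map c y - a0)) / C).
  by rewrite divr_gt0// subr_gt0.
move=> u; rewrite ltr_pdivlMr// mulrC => ur.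
have := gnormD (u - chart_map c y) (chart_map c y - a0) (posdef_psd G0).
rewrite addrA subrK; have := HC (u - chart_map c y); move: ur; lra.
Qed.

(** The image of a compact ball is compact, hence closed in a Hausdorff space. This prevents a curve
    from leaving the chart without meeting the coordinate sphere. *)
Lemma coord_ball_closure : closed (chart_inv c @` [set u | gnorm G (u - a0) <= rho]).
Proof.
apply: (compact_closed (@manifold_hausdorff _ _ M)).
apply: continuous_compact.
  apply: continuous_in_subspaceT => u; rewrite inE/= => ur.
  exact: chart_inv_continuous (ball_cod ur).
have [C C0 HC] := norm_le_gnorm G0.
apply: (subclosed_compact _ (@closed_ball_compact R n a0 (C * rho))).
  rewrite (_ : [set u | _] = (fun u : 'rV[R]_n => gnorm G (u - a0)) @^-1` [set s | s <= rho])//.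
  apply: closed_comp => [x _|]; last exact: closed_le.
  exact: gnorm_dist_continuous.
by move=> u /= ur; apply: le_trans (HC _) _; rewrite ler_pM2l.
Qed.

(** At the first exit time the curve is still in the closed coordinate ball, being a limit of points
    of the open one; so it is at radius exactly [rho], and its length up to then is at least
    [k * rho]. *)
Lemma short_curve_in_ball gamma : piecewise_C1 gamma ->
  chart_dom c (gamma 0) -> chart_map c (gamma 0) = a0 ->
  (curve_length gamma < (k * rho)%:E)%E -> coord_ball (gamma 1).
Proof.
move=> [s [ps ls Hs]] d0 g0 len; apply: contrapT => out.
have near01 t (O : set M) : 0 <= t <= 1 -> open O -> O (gamma t) ->
    exists2 e, 0 < e & forall r, 0 <= r <= 1 -> `|r - t| < e -> O (gamma r).
  by rewrite -ls; exact: segments_near.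
have [||//|T [T0 T1 PT Tlt]] := @first_exit R (fun t => coord_ball (gamma t)).
- by move=> t t01; exact: (near01 t _ t01 coord_ball_open).
- by split; rewrite // g0 subrr gnorm0.
have KT : (chart_inv c @` [set u | gnorm G (u - a0) <= rho]) (gamma T).
  apply: contrapT => nK.
  have [e e0 He] := near01 T _ ltac:(by rewrite (ltW T0)) (closed_openC coord_ball_closure) nK.
  pose r := Num.max 0 (T - e / 2).
  have r0 : 0 <= r by rewrite le_max lexx.
  have rT : r < T by rewrite gt_max T0 ltrBlDr ltrDl divr_gt0.
  have re : `|r - T| < e.
    rewrite distrC ger0_norm ?subr_ge0 ?(ltW rT)//.
    have : T - e / 2 <= r by rewrite le_max lexx orbT.
    by move: e0; lra.
  apply: (He r ltac:(by rewrite r0 (ltW (lt_le_trans rT T1))) re).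
  have [dr br] := Tlt r r0 rT.
  by exists (chart_map c (gamma r)); [exact: ltW|exact: chart_mapK].
have [u ur uT] := KT.
have [dT mT] := chart_codP (ball_cod ur).
rewrite uT in dT mT.
have bT : gnorm G (chart_map c (gamma T) - a0) = rho.
  apply/le_anti; rewrite mT ur/= leNgt; apply/negP => lt.
  by apply: PT; rewrite mT.
have ballT t : 0 <= t <= T -> in_ball (gamma t).
  move=> /andP[t0]; rewrite le_eqVlt => /orP[/eqP ->|tT].
    by split; rewrite // bT.
  by have [? /ltW] := Tlt t t0 tT.
(* The unit vector towards the exit point, for which the displacement is the full radius. *)
pose l := rho^-1 *: (chart_map c (gamma T) - a0).
have l1 : gnorm G l <= 1 by rewrite gnormZ bT gtr0_norm ?invr_gt0// mulVf// gt_eqF.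
have [|g [mg pg og ig]] := segments_speed_minorant ps Hs _ ballT l1.
  by rewrite (ltW T0) ls.
suff : ((k * rho)%:E <= curve_length gamma)%E by rewrite leNgt len.
apply: (@le_trans _ _ (\int[lebesgue_measure]_t (g t)%:E)%E).
  apply: le_trans ig; rewrite lee_fin ler_pM2l// g0 /l bformZr.
  rewrite -sqr_gnorm; last exact: posdef_psd.
  by rewrite bT expr2 mulKf// gt_eqF.
have -> : (\int[lebesgue_measure]_t (g t)%:E
  = \int[lebesgue_measure]_(t in `[0%R, 1%R]) (g t)%:E)%E.
  rewrite [RHS]integral_mkcond; apply: eq_integral => t _; rewrite /patch.
  case: ifPn => //; rewrite notin_setE/= in_itv/= => tn; congr EFin; apply: og.
  apply/negP => /andP[t1 t2]; apply: tn; rewrite (ltW t1)/= ltW//.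
  exact: lt_le_trans t2 T1.
by apply: le_integral_minorant => t _; exact: pg.
Qed.

Lemma set_dist_coord_ball (x : M) S : chart_dom c x -> chart_map c x = a0 ->
  (set_dist x S < (k * rho)%:E)%E -> exists2 y, S y & coord_ball y.
Proof.
move=> dx mx /ereal_inf_lt[_ [y Sy <-]] /ereal_inf_lt[_ [gamma [pg g0 g1] <-]] len.
exists y => //; rewrite -g1; apply: short_curve_in_ball len => //; by rewrite g0.
Qed.

End curve_length_bound.

Section distance_near_a_point.
Context {R : realType} {n : nat} {M : riemannianManifold R n}.

(** The coordinate balls are centered at the varying point [u], but their norm is the one at [u0],
    so that a single comparison of metrics near [u0] serves all of them. A strict bound on the
    distance yields a point of [S] although the infimum may not be attained. *)
Lemma set_dist_lower_bound (c : chart R n M) u0 (k : R) : atlas c -> chart_cod c u0 ->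
  0 < k -> k < 1 -> exists2 rho0, 0 < rho0 & \forall u \near u0,
    forall (rho : R) (S : set M), 0 < rho -> rho <= rho0 ->
    (set_dist (chart_inv c u) S < (k * rho)%:E)%E ->
    exists y, [/\ S y, chart_dom c y &
      gnorm (metric c u0) (chart_map c y - u) < rho].
Proof.
move=> ac cu0 k0 k1.
have G0 := metric_posdef ac cu0.
have [C C0 HC] := norm_le_gnorm G0.
have /near_norm[d d0 Hd] : \forall u \near u0, chart_cod c u /\
    forall v, k * gnorm (metric c u0) v <= gnorm (metric c u) v.
  by apply: filterS2 (chart_cod_near cu0) (metric_comparison ac cu0 k0 k1) => u; split.
have rho0 : 0 < d / (2 * C) by rewrite divr_gt0// mulr_gt0.
exists (d / (2 * C)) => //; apply/near_norm; exists (d / 2); first by rewrite divr_gt0.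
move=> u ud rho S rho_gt0 rhole.
have ball v : gnorm (metric c u0) (v - u) <= rho -> `|v - u0| < d.
  move=> vr; have := ler_normD (v - u) (u - u0); rewrite addrA subrK.
  have := HC (v - u); have : C * gnorm (metric c u0) (v - u) <= d / 2.
    rewrite mulrC -ler_pdivlMr//; apply: le_trans vr _; apply: le_trans rhole _.
    by rewrite invfM mulrA.
  by move: ud; lra.
have cu : chart_cod c u.
  by have [] // := Hd u _; move: ud d0; lra.
have [du mu] := chart_codP cu.
move=> len.
have [v vr|v vr|||y Sy [dy yr]] := @set_dist_coord_ball _ _ _ c u (metric c u0) k rho ac G0
    k0 rho_gt0 _ _ (chart_inv c u) S _ _ len => //.
- by have [] := Hd v (ball v vr).
- by have [] := Hd v (ball v vr).
- by exists y.
Qed.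

End distance_near_a_point.

(** * Transfer to a chart *)

(** With [q] the gradient covector at [u] and [H] the metric there, both terms on the right are
    small compared with [h]: the first by differentiability of the partial derivatives, the second
    by continuity of the metric. *)
Lemma resolvent_expansion (R : realType) n (q h : 'rV[R]_n) (A G H : 'M[R]_n) :
  G \in unitmx -> H \in unitmx ->
  q *m invmx H - h *m (A *m invmx G) = (q - h *m A) *m invmx H +
    (h *m (A *m invmx G) *m (G - H)) *m invmx H.
Proof.
move=> uG uH; set X := h *m (A *m invmx G).
have XG : X *m G = h *m A by rewrite /X mulmxA mulmxKV.
by rewrite mulmxBr XG mulmxBl [in RHS]mulmxBl mulmxK// addrA subrK.
Qed.

Section transfer_to_a_chart.
Context {R : realType} {n : nat} {M : riemannianManifold R n}.
Variables (f : M -> R) (xbar : M).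
Hypotheses (f_C2 : Ck_function 2 f) (xbar_min : local_min f xbar).
Local Notation c := (chart_at xbar).
Local Notation u0 := (chart_map (chart_at xbar) xbar).
Local Notation G := (metric (chart_at xbar) (chart_map (chart_at xbar) xbar)).
Local Notation F := (f \o chart_inv (chart_at xbar)).
Local Notation U := (chart_cod (chart_at xbar)).
Local Notation p := (partials (f \o chart_inv (chart_at xbar))).
Local Notation A := (hessian (f \o chart_inv (chart_at xbar)) (chart_map (chart_at xbar) xbar)).

Let ac : atlas c. Proof. exact: chart_at_atlas. Qed.
Let dc : chart_dom c xbar. Proof. exact: chart_at_dom. Qed.
Let Uu0 : U u0. Proof. exact: chart_dom_cod. Qed.
Let oU : open U. Proof. exact: chart_cod_open. Qed.
Let F2 : Ck_on 2 U F. Proof. exact: f_C2. Qed.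
Let pG : posdef G. Proof. exact: metric_posdef. Qed.

Lemma Fu0 : F u0 = f xbar.
Proof. by rewrite /= chart_mapK. Qed.

Lemma near_chart (P : M -> Prop) : (\forall x \near xbar, P x) ->
  \forall u \near u0, P (chart_inv c u).
Proof. by move=> H; apply: (chart_inv_continuous Uu0); rewrite chart_mapK. Qed.

Lemma chart_local_min : \forall u \near u0, F u0 <= F u.
Proof. by rewrite Fu0; exact: near_chart xbar_min. Qed.

(** Near a local minimum, every point with the same value is again a local minimum, so membership
    becomes a level equation. *)
Lemma min_set_chart : \forall u \near u0, min_set f xbar (chart_inv c u) <-> F u = F u0.
Proof.
rewrite Fu0; apply: (@near_chart (fun x => min_set f xbar x <-> f x = f xbar)).
have := nbhs_interior xbar_min; apply: filterS => x xI.
by split=> [[]//|fx]; split => //; rewrite /local_min fx.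
Qed.

Lemma f_differentiable_chart c' x : atlas c' -> chart_dom c' x ->
  differentiable (f \o chart_inv c') (chart_map c' x).
Proof. by move=> ac' c'x; apply: (f_C2 ac').1; exact: chart_dom_cod. Qed.

Lemma rnorm_grad_le (k : R) : 0 < k -> k < 1 -> \forall u \near u0,
  rnorm (chart_inv c u) (grad f (chart_inv c u)) <= dnorm G (p u) / k.
Proof.
move=> k0 k1; apply: filterS2 (chart_cod_near Uu0) (metric_comparison ac Uu0 k0 k1).
move=> u cu H; have [du mu] := chart_codP cu.
rewrite (rnorm_grad ac du (fun c' ac' => f_differentiable_chart ac')) mu.
by apply: dual_gnorm_comparison => //; exact: metric_posdef.
Qed.

Lemma PL_chart mu (k : R) : 0 < mu -> 0 < k -> k < 1 -> PL mu f xbar ->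
  local_PL F u0 G (mu * k ^+ 2).
Proof.
move=> mu0 k0 k1 /near_chart PLf; apply: filterS2 PLf (rnorm_grad_le k0 k1).
move=> u H1 H2; rewrite Fu0; apply: le_trans H1 _.
apply: (@le_trans _ _ ((2 * mu)^-1 * (dnorm G (p u) / k) ^+ 2)).
  by rewrite ler_pM2l ?invr_gt0 ?mulr_gt0// ler_pXn2r ?nnegrE ?rnorm_ge0//
    divr_ge0 ?dnorm_ge0 ?(ltW k0).
by rewrite le_eqVlt; apply/orP; left; apply/eqP; field; rewrite !gt_eqF.
Qed.

(** Freezing the metric costs [k] twice: in the distance and in the gradient norm for EB, in a
    squared gradient norm for PL, in a squared distance for QG. Taking [q = m / mu] leaves the
    constant above [m]. *)
Lemma exists_factor (q : R) : 0 < q -> q < 1 -> exists k : R, [/\ 0 < k, k < 1 & q < k ^+ 2].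
Proof.
move=> q0 q1; exists ((1 + q) / 2); split; [lra|lra|].
rewrite -subr_gt0 (_ : _ - _ = ((1 - q) / 2) ^+ 2); last by field.
by rewrite exprn_gt0//; lra.
Qed.

Lemma solution_near (k : R) : 0 < k -> k < 1 -> exists2 rho0, 0 < rho0 & \forall u \near u0,
  forall rho : R, 0 < rho -> rho <= rho0 ->
  (set_dist (chart_inv c u) (min_set f xbar) < (k * rho)%:E)%E ->
  exists2 z, F z = F u0 & gnorm G (u - z) < rho.
Proof.
move=> k0 k1; have [rho0 rho00 H] := set_dist_lower_bound ac Uu0 k0 k1.
exists rho0 => //; apply: filterS H => u H rho rho_gt0 rhole /(H _ _ rho_gt0 rhole)[y [Sy dy yu]].
exists (chart_map c y); first by rewrite Fu0 /= chart_mapK//; case: Sy.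
by rewrite -gnormN opprB.
Qed.

Lemma solution_close (r : R) : 0 < r -> exists2 eta, 0 < eta & \forall u \near u0,
  forall z, gnorm G (u - z) < eta -> `|z - u0| < r.
Proof.
move=> r0; have [C C0 HC] := norm_le_gnorm pG.
exists (r / 2 / C); first by rewrite !divr_gt0.
apply/near_norm; exists (r / 2); first by rewrite divr_gt0.
move=> u ur z; rewrite ltr_pdivlMr// mulrC => uz.
have := ler_normD (z - u) (u - u0); rewrite addrA subrK [`|z - u|]distrC.
by have := HC (u - z); move: ur uz; lra.
Qed.

Lemma dnorm_partials_small (eta : R) : 0 < eta -> \forall u \near u0, dnorm G (p u) < eta.
Proof.
move=> eta0; have [C C0 HC] := dnorm_le G.
have [r r0 Hr] := minimizer_critical oU Uu0 F2 chart_local_min.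
have pu0 : p u0 = 0 by apply: Hr => //; rewrite subrr normr0.
have cp : {for u0, continuous p}.
  by apply: differentiable_continuous; apply: (C1_partials oU F2).1.
have /(@continuous_norm R 'rV[R]_n 'rV[R]_n)/(_ (eta / 2 / C)) := cp.
move=> [|d d0 Hd]; first by rewrite !divr_gt0.
apply/near_norm; exists d => // u /Hd; rewrite pu0 subr0 ler_pdivlMr// mulrC => K.
by apply: le_lt_trans (HC _) _; move: eta0; lra.
Qed.

(** If no solution were within [rho = dnorm G (p u) / m] of [u], the distance would be at least
    [k * rho], and EB would give [mu * k ^+ 2 <= m]. As the gradient tends to 0 at [u0], this [rho]
    is as small as required. *)
Lemma EB_chart mu m : 0 < m -> m < mu -> EB mu f xbar -> local_EB F u0 G m.
Proof.
move=> m0 mmu /near_chart EBf r r0.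
have mu0 : 0 < mu by exact: lt_trans mmu.
have [|k [k0 k1 mk]] := @exists_factor (m / mu) (divr_gt0 m0 mu0).
  by rewrite ltr_pdivrMr// mul1r.
have [rho0 rho00 H1] := solution_near k0 k1.
have [eta eta0 H2] := solution_close r0.
have M0 : 0 < Num.min rho0 eta by rewrite lt_min rho00.
have H3 := dnorm_partials_small (mulr_gt0 m0 M0).
have H4 : \forall u \near u0, `|u - u0| < r by apply/near_norm; exists r.
have H : \forall u \near u0,
    [/\ (mu%:E * set_dist (chart_inv c u) (min_set f xbar) <=
        (rnorm (chart_inv c u) (grad f (chart_inv c u)))%:E)%E,
       rnorm (chart_inv c u) (grad f (chart_inv c u)) <= dnorm G (p u) / k,
       U u & `|u - u0| < r].
  have Q := near_and EBf (rnorm_grad_le k0 k1).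
  have Q' := near_and (chart_cod_near Uu0) H4.
  by apply: filterS2 Q Q' => u [? ?] [? ?]; split.
have H5 : \forall u \near u0, (forall rho : R, 0 < rho -> rho <= rho0 ->
      (set_dist (chart_inv c u) (min_set f xbar) < (k * rho)%:E)%E ->
      exists2 z, F z = F u0 & gnorm G (u - z) < rho) /\
    (forall z, gnorm G (u - z) < eta -> `|z - u0| < r).
  exact: near_and H1 H2.
apply: filterS3 H H5 H3 => u [EBu gk Uu ur] [{}H1 {}H2] D.
have dist_lt rho : rnorm (chart_inv c u) (grad f (chart_inv c u)) < mu * (k * rho) ->
    (set_dist (chart_inv c u) (min_set f xbar) < (k * rho)%:E)%E.
  move=> lt; rewrite ltNge; apply/negP => le.
  have : ((mu * (k * rho))%:E <= (rnorm (chart_inv c u) (grad f (chart_inv c u)))%:E)%E.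
    by apply: le_trans EBu; rewrite EFinM lee_wpmul2l// lee_fin ltW.
  by rewrite lee_fin leNgt lt.
(* When the gradient vanishes, [rho] would be 0. Instead, solutions exist arbitrarily close to [u],
   and continuity of [F] makes [u] itself a solution. *)
have := dnorm_ge0 G (p u); rewrite le_eqVlt => /orP[/eqP D0|D0].
  suff Fu : F u = F u0 by exists u; split => //; rewrite subrr gnorm0 mulr0 dnorm_ge0.
  apply: contrapT => Fu.
  have cF : {for u, continuous F} by exact: (F_continuous F2 Uu).
  have [C C0 HC] := norm_le_gnorm pG.
  have Fpos : 0 < `|F u - F u0| / 2 by rewrite divr_gt0// normr_gt0 subr_eq0; apply/eqP.
  have /(@continuous_norm R 'rV[R]_n R)/(_ _ Fpos)[d d0 Hd] := cF.
  have rr0 : 0 < Num.min rho0 (d / C) by rewrite lt_min rho00 divr_gt0.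
  have [|||z Fz uz] := H1 (Num.min rho0 (d / C)).
  - exact: rr0.
  - by rewrite ge_min lexx.
  - by apply: dist_lt; apply: le_lt_trans gk _; rewrite -D0 mul0r !mulr_gt0.
  have zd : `|z - u| < d.
    rewrite distrC; apply: le_lt_trans (HC _) _; rewrite mulrC -ltr_pdivlMr//.
    by apply: lt_le_trans uz _; rewrite ge_min lexx orbT.
  have := Hd z zd; rewrite Fz distrC.
  by move: Fpos; lra.
have [|||z Fz uz] := H1 (dnorm G (p u) / m).
- by rewrite divr_gt0.
- rewrite ler_pdivrMr// mulrC; apply: ltW; apply: lt_le_trans D _.
  by rewrite ler_pM2l// ge_min lexx.
- apply: dist_lt; apply: le_lt_trans gk _.
  have -> : mu * (k * (dnorm G (p u) / m)) = dnorm G (p u) * (mu * k / m) by ring.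
  rewrite ltr_pM2l// ltr_pdivlMr// mulrC ltr_pdivrMr// -mulrA -expr2.
  by move: mk; rewrite ltr_pdivrMr// mulrC.
have mz : m * gnorm G (u - z) <= dnorm G (p u).
  by rewrite mulrC -ler_pdivlMr// ltW.
exists z; split => //; apply: H2; apply: lt_le_trans uz _.
rewrite ler_pdivrMr// mulrC; apply: ltW; apply: lt_le_trans D _.
by rewrite ler_pM2l// ge_min lexx orbT.
Qed.

Lemma QG_chart mu m : 0 < m -> m < mu -> QG mu f xbar -> local_QG F u0 G m.
Proof.
move=> m0 mmu /near_chart QGf r r0.
have mu0 : 0 < mu by exact: lt_trans mmu.
have [|k [k0 k1 mk]] := @exists_factor (m / mu) (divr_gt0 m0 mu0).
  by rewrite ltr_pdivrMr// mul1r.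
have [rho0 rho00 H1] := solution_near k0 k1.
have [eta eta0 H2] := solution_close r0.
have M0 : 0 < Num.min rho0 eta by rewrite lt_min rho00.
have K0 : 0 < m / 2 * (Num.min rho0 eta) ^+ 2 by rewrite mulr_gt0 ?divr_gt0// exprn_gt0.
have H3 : \forall u \near u0, F u - F u0 <= m / 2 * (Num.min rho0 eta) ^+ 2.
  have cF : {for u0, continuous F} by exact: (F_continuous F2 Uu0).
  have /(@continuous_norm R 'rV[R]_n R)/(_ _ K0)[d d0 Hd] := cF.
  by apply/near_norm; exists d => // u /Hd; apply: le_trans; exact: ler_norm.
have H4 : \forall u \near u0, `|u - u0| < r by apply/near_norm; exists r.
have H : \forall u \near u0,
    [/\ ((mu / 2)%:E * set_dist (chart_inv c u) (min_set f xbar) ^+ 2 <= (F u - F u0)%:E)%E,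
       F u0 <= F u, F u - F u0 <= m / 2 * (Num.min rho0 eta) ^+ 2 & `|u - u0| < r].
  rewrite -Fu0 in QGf.
  have Q := near_and QGf chart_local_min.
  have Q' := near_and H3 H4.
  by apply: filterS2 Q Q' => u [? ?] [? ?]; split.
apply: filterS3 H H1 H2 => u [QGu Fu Fum ur] {}H1 {}H2.
move: Fu; rewrite -subr_ge0 le_eqVlt => /orP[/eqP Fu|Fu].
  exists u; split => //; first by apply/eqP; rewrite -subr_eq0 -Fu.
  by rewrite subrr gnorm0 expr0n mulr0 -Fu.
(* The radius at which [m / 2 * rho ^+ 2] equals the increment of [F]; a distance of at least
   [k * rho] would contradict QG, since [m < mu * k ^+ 2]. *)
pose rho := Num.sqrt ((F u - F u0) / (m / 2)).
have rho_gt0 : 0 < rho by rewrite sqrtr_gt0 !divr_gt0.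
have rho2 : m / 2 * rho ^+ 2 = F u - F u0.
  by rewrite sqr_sqrtr ?divr_ge0 ?(ltW Fu) ?(ltW m0)//; field; rewrite gt_eqF.
have rhole : rho <= Num.min rho0 eta.
  rewrite -(@ler_pXn2r _ 2)// ?nnegrE ?(ltW M0) ?(ltW rho_gt0)//.
  by rewrite -(ler_pM2l (_ : 0 < m / 2)) ?divr_gt0// rho2.
have [|||z Fz uz] := H1 rho.
- by [].
- by apply: le_trans rhole _; rewrite ge_min lexx.
- rewrite ltNge; apply/negP => le.
  have kr : (0 <= (k * rho)%:E)%E by rewrite lee_fin mulr_ge0// ltW.
  have : ((mu / 2 * (k * rho) ^+ 2)%:E <= (F u - F u0)%:E)%E.
    apply: le_trans QGu; rewrite EFinM lee_wpmul2l//.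
      by rewrite lee_fin divr_ge0// ltW.
    by rewrite expr2 EFinM expe2 lee_pmul.
  rewrite lee_fin -rho2 exprMn mulrA ler_pM2r ?exprn_gt0// mulrAC ler_pM2r ?invr_gt0//.
  by rewrite leNgt mulrC -ltr_pdivrMr// mk.
exists z; split => //.
  by apply: H2; apply: lt_le_trans uz _; apply: le_trans rhole _; rewrite ge_min lexx orbT.
rewrite -rho2 ler_pM2l ?divr_gt0// ler_pXn2r ?nnegrE ?gnorm_ge0 ?(ltW uz) ?(ltW rho_gt0)//.
Qed.

Lemma PL_EB_chart mu m : 0 < m -> m < mu -> PL mu f xbar -> local_EB F u0 G m.
Proof.
move=> m0 mmu PLf; have mu0 : 0 < mu by exact: lt_trans mmu.
have [|k [k0 k1 mk]] := @exists_factor (m / mu) (divr_gt0 m0 mu0).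
  by rewrite ltr_pdivrMr// mul1r.
rewrite ltr_pdivrMr// mulrC in mk.
(* Both implications lose some constant, so quadratic growth is taken at the midpoint between [m]
   and [mu * k ^+ 2]. *)
apply: (QG_EB oU Uu0 F2 pG chart_local_min m0 (_ : m < (m + mu * k ^+ 2) / 2)); first by lra.
apply: (PL_QG oU Uu0 F2 pG chart_local_min _ _ (PL_chart mu0 k0 k1 PLf)); lra.
Qed.

Lemma QG_EB_chart mu m : 0 < m -> m < mu -> QG mu f xbar -> local_EB F u0 G m.
Proof.
move=> m0 mmu QGf.
apply: (QG_EB oU Uu0 F2 pG chart_local_min m0 (_ : m < (m + mu) / 2)); first by lra.
apply: QG_chart QGf; lra.
Qed.

(** With [y] the preimage of [q], the form at [u] applied to [y] is [q] paired with [y], and it is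
    at least a quarter of the form at [u0]; this bounds [y] without continuity of matrix
    inversion. *)
Lemma invmx_bound_near : exists2 K, 0 < K & \forall u \near u0, forall q : 'rV[R]_n,
  `|q *m invmx (metric c u)| <= K * `|q|.
Proof.
have [C C0 HC] := norm_le_gnorm pG.
have h0 : 0 < 2^-1 :> R by rewrite invr_gt0.
have h1 : 2^-1 < 1 :> R by rewrite invf_lt1// ltr1n.
exists (4 * (n%:R * C * C) + 1); first by rewrite ltr_wpDl// !mulr_ge0 ?(ltW C0).
apply: filterS2 (chart_cod_near Uu0) (metric_comparison ac Uu0 h0 h1) => u cu H q.
have pGu := metric_posdef ac cu.
set y := q *m _; have qE : y *m metric c u = q by rewrite /y mulmxKV// posdef_unitmx.
have K1 : bform (metric c u) y y <= n%:R * (`|q| * (C * gnorm G y)).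
  rewrite /bform qE; apply: le_trans (ler_norm _) _; apply: le_trans (dot_norm_le _ _) _.
  by rewrite !ler_wpM2l.
have K2 : (2^-1 * gnorm G y) ^+ 2 <= bform (metric c u) y y.
  rewrite -sqr_gnorm; last exact: posdef_psd.
  by rewrite ler_pXn2r ?nnegrE ?mulr_ge0 ?gnorm_ge0 ?(ltW h0).
have K3 : gnorm G y <= 4 * (n%:R * (`|q| * C)).
  have := gnorm_ge0 G y; rewrite le_eqVlt => /orP[/eqP <-|g0].
    by rewrite !mulr_ge0 ?(ltW C0).
  rewrite -(ler_pM2r g0); move: K1 K2; rewrite expr2; lra.
apply: le_trans (HC _) _.
have : C * gnorm G y <= C * (4 * (n%:R * (`|q| * C))) by rewrite ler_pM2l.
have := normr_ge0 q; lra.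
Qed.

(** The covector [p] vanishes at [u0], so the product rule leaves only the derivative of [p] times
    the inverse metric at [u0]. *)
Lemma local_grad_diff : is_diff u0 (local_grad c f) (mulmxr (A *m invmx G)).
Proof.
have [r r0 Hr] := minimizer_critical oU Uu0 F2 chart_local_min.
have pu0 : p u0 = 0 by apply: Hr => //; rewrite subrr normr0.
have lgE u : local_grad c f u = p u *m invmx (metric c u) by [].
have sl : continuous (mulmxr (A *m invmx G) : 'rV[R]_n -> 'rV[R]_n).
  move=> u; apply: differentiable_continuous.
  by have [] := @strict_diff_is_diff R n n (mulmxr (A *m invmx G)) u (A *m invmx G)
    ltac:(by move=> e e0; exists 1 => // y z _ _; rewrite /= -mulmxBl subrr normr0 mulr_ge0// ltW).
apply: is_diff_eps => // e e0.
have [K K0 /near_norm[d1 d10 Hd1]] := invmx_bound_near.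
have [C C0 HC] := mulmx_bound (A *m invmx G).
have e1 : 0 < e / (2 * K) by rewrite divr_gt0// mulr_gt0.
have nC : 0 < n%:R * C + 1 by rewrite ltr_wpDl// mulr_ge0// ltW.
have e2 : 0 < e / (2 * K * (n%:R * C + 1)) by rewrite divr_gt0// !mulr_gt0.
have [d2 d20 Hd2] := taylor oU Uu0 F2 e1.
have cm : {for u0, continuous (metric c)} by exact: (metric_smooth 0 ac).
have /(@continuous_norm R 'rV[R]_n 'M[R]_n)/(_ _ e2)[d3 d30 Hd3] := cm.
have /near_norm[d4 d40 Hd4] := chart_cod_near Uu0.
exists (Num.min (Num.min d1 d2) (Num.min d3 d4)).
  by rewrite !lt_min d10 d20 d30.
move=> u; rewrite !lt_min => /andP[/andP[ud1 ud2] /andP[ud3 ud4]].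
have cu := Hd4 _ ud4.
have uG := posdef_unitmx pG.
have uGu := posdef_unitmx (metric_posdef ac cu).
have [T _] := Hd2 u u0 ud2 ltac:(by rewrite subrr normr0) pu0.
rewrite !lgE pu0 mul0mx subr0 /=.
set h := u - u0 in T *.
have -> : p u *m invmx (metric c u) - h *m (A *m invmx G) =
   (p u - h *m A) *m invmx (metric c u) +
   (h *m (A *m invmx G) *m (G - metric c u)) *m invmx (metric c u).
  exact: resolvent_expansion.
apply: le_trans (ler_normD _ _) _.
have B1 : `|(p u - h *m A) *m invmx (metric c u)| <= e / 2 * `|h|.
  apply: le_trans (Hd1 _ ud1 _) _.
  have : K * `|p u - h *m A| <= K * (e / (2 * K) * `|h|) by rewrite ler_pM2l.
  move=> /le_trans; apply; rewrite le_eqVlt; apply/orP; left; apply/eqP; field.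
  by rewrite gt_eqF.
have B2 : `|h *m (A *m invmx G) *m (G - metric c u) *m invmx (metric c u)| <= e / 2 * `|h|.
  apply: le_trans (Hd1 _ ud1 _) _.
  have K1 := mulmx_norm_le (h *m (A *m invmx G)) (G - metric c u).
  have K2 := HC h.
  have K3 := Hd3 _ ud3; rewrite distrC in K3.
  have K4 : `|h *m (A *m invmx G)| * `|G - metric c u| <=
     C * `|h| * (e / (2 * K * (n%:R * C + 1))) by apply: ler_pM.
  apply: (@le_trans _ _ (K * (n%:R * (C * `|h| * (e / (2 * K * (n%:R * C + 1))))))).
    by rewrite ler_pM2l//; apply: le_trans K1 _; rewrite ler_wpM2l.
  have -> : K * (n%:R * (C * `|h| * (e / (2 * K * (n%:R * C + 1))))) =
     (e / 2 * `|h|) * (n%:R * C / (n%:R * C + 1)).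
    by field; rewrite !gt_eqF.
  rewrite ler_piMr ?mulr_ge0 ?divr_ge0 ?(ltW e0)//.
  by rewrite ler_pdivrMr// mul1r lerDl.
by move: B1 B2; lra.
Qed.

(** The Christoffel symbols multiply the gradient, which vanishes at [u0]; only the coordinate
    Hessian with one index raised by [G] is left. *)
Lemma hess_chart v : hess f xbar v = v *m A *m invmx G.
Proof.
have [r r0 Hr] := minimizer_critical oU Uu0 F2 chart_local_min.
have pu0 : p u0 = 0 by apply: Hr => //; rewrite subrr normr0.
have lg0 : local_grad c f u0 = 0 by rewrite /local_grad -/(p u0) pu0 mul0mx.
have [dl El] := local_grad_diff.
rewrite /hess /covariant_derivative lg0 deriveE// El/= mulmxA.
rewrite -[RHS]addr0; congr (_ + _); apply/rowP => i; rewrite !mxE.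
by rewrite big1// => j _; rewrite big1// => l _; rewrite mxE mulr0.
Qed.

End transfer_to_a_chart.

(** * Slice charts *)

Section slice_charts.
Context {R : realType} {n : nat} {M : riemannianManifold R n}.

Lemma overlap_open (c c' : chart R n M) : open (overlap c c').
Proof.
apply/(@open_norm R 'rV[R]_n) => _ [x [cx c'x] <-]; apply/(@near_norm R 'rV[R]_n).
apply: filterS (overlap_nbhs cx c'x) => u [cu c'u].
have [du mu] := chart_codP cu.
by exists (chart_inv c u).
Qed.

Variables (c : chart R n M) (W : set 'rV[R]_n) (Psi g : 'rV[R]_n -> 'rV[R]_n).
Hypotheses (ac : atlas c) (oW : open W) (Wcod : W `<=` chart_cod c).
Hypotheses (oV : open (Psi @` W)) (gPsi : forall u, W u -> g (Psi u) = u).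
Hypotheses (Psi1 : Ck_on 1 W Psi) (g1 : Ck_on 1 (Psi @` W) g).

Definition slice_dom : set M := [set y | chart_dom c y /\ W (chart_map c y)].

Lemma slice_dom_open : open slice_dom.
Proof.
rewrite openE => y [cy Wy]; apply: filterI; first exact: chart_dom_near.
exact: (chart_map_continuous cy (open_nbhs_nbhs (conj oW Wy))).
Qed.

Lemma slice_codE : (Psi \o chart_map c) @` slice_dom = Psi @` W.
Proof.
apply/seteqP; split=> [_ [y [cy Wy] <-]|_ [u Wu <-]]; first by exists (chart_map c y).
have [du mu] := chart_codP (Wcod Wu).
by exists (chart_inv c u); rewrite /slice_dom /= ?mu.
Qed.

Lemma slice_cod_open : open ((Psi \o chart_map c) @` slice_dom).
Proof. by rewrite slice_codE. Qed.

Lemma slice_mapK y : slice_dom y -> (chart_inv c \o g) ((Psi \o chart_map c) y) = y.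
Proof. by move=> [cy Wy]; rewrite /= gPsi// chart_mapK. Qed.

Lemma slice_map_continuous y : slice_dom y -> {for y, continuous (Psi \o chart_map c)}.
Proof.
move=> [cy Wy]; apply: continuous_comp; first exact: chart_map_continuous.
by apply: differentiable_continuous; exact: Psi1.1.
Qed.

Lemma slice_inv_continuous v : ((Psi \o chart_map c) @` slice_dom) v ->
  {for v, continuous (chart_inv c \o g)}.
Proof.
rewrite slice_codE => Vv; apply: continuous_comp.
  by apply: differentiable_continuous; exact: g1.1.
case: Vv => u Wu <-; rewrite gPsi//; apply: chart_inv_continuous; exact: Wcod.
Qed.

Definition slice_chart : chart R n M :=
  Chart slice_dom_open slice_cod_open slice_mapK slice_map_continuous slice_inv_continuous.

Lemma slice_compatible c' : atlas c' -> Ck_compatible 1 slice_chart c'.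
Proof.
move=> ac'; have [T1 T2] := atlas_smooth 1 ac ac'; split.
  have E : transition slice_chart c' = transition c c' \o g by [].
  rewrite E; apply: (C1_comp _ _ _ T1); first exact: overlap_open.
    by move=> _ [y [[cy Wy] c'y] <-]; rewrite /= gPsi//; exists y.
  by apply: C1_subset g1 => _ [y [[cy Wy] c'y] <-] /=; exists (chart_map c y).
have E : transition c' slice_chart = Psi \o transition c' c by [].
rewrite E; apply: (C1_comp _ _ _ Psi1); first exact: overlap_open.
  by move=> _ [y [c'y [cy Wy]] <-]; rewrite /transition /= chart_mapK.
by apply: C1_subset T2 => _ [y [c'y [cy Wy]] <-]; exists y.
Qed.

(** A straight line in slice coordinates, read back on the manifold: such curves realize the kernel
    vectors as velocities. *)
Lemma slice_line_C1 (y : 'rV[R]_n) (e : R) :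
  (forall t : R, t \in `]- e, e[ -> (Psi @` W) (t *: y)) ->
  Ck_curve 1 `]- e, e[ (fun t : R => chart_inv c (g (t *: y))).
Proof.
move=> H.
have ld (t : R) : differentiable (fun s : R => s *: y) t.
  by apply: ex_diff.
have contl t : `]- e, e[%classic t -> {for t, continuous (fun t : R => chart_inv c (g (t *: y)))}.
  move=> te.
  apply: (@continuous_comp _ _ _ (fun s : R => s *: y) (chart_inv c \o g)).
    exact: differentiable_continuous.
  by apply: slice_inv_continuous; rewrite slice_codE; exact: H.
split=> // c' ac'.
set O := _ `&` _.
have oO : open O.
  apply/(@open_norm R R^o) => t [te dt]; apply/(@near_norm R R^o).
  have k1 : \forall s \near (t : R), chart_dom c' (chart_inv c (g (s *: y))).
    by apply: (contl t te); exact: chart_dom_near.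
  have k2 : \forall s \near (t : R), `]- e, e[%classic s.
    by apply: open_nbhs_nbhs; split => //; exact: interval_open.
  exact: near_and k2 k1.
have [T1 _] := atlas_smooth 1 ac ac'.
have l1 : Ck_on 1 O (fun t : R => t *: y).
  split=> [t _|v t _]; first exact: ld.
  have -> : (fun x : R => 'D_v (fun t : R => t *: y) x) = cst (v *: y).
    by apply/funext => x; rewrite deriveE// diff_val.
  exact: cst_continuous.
have gl1 : Ck_on 1 O (g \o (fun t : R => t *: y)).
  by apply: (C1_comp oO _ l1 g1) => t [te _]; exact: H.
apply: (C1_comp (f := g \o (fun t : R => t *: y)) (g := transition c c') oO _ gl1 T1).
move=> t [te dt]; have [u Wu uE] := H t te.
exists (chart_inv c (g (t *: y))).
  by split => //; rewrite -uE gPsi//; have [] := chart_codP (Wcod Wu).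
by rewrite /= -uE gPsi//; have [] := chart_codP (Wcod Wu).
Qed.

End slice_charts.

(** * From the error bound to the Morse-Bott property *)

Section morse_bott_property.
Context {R : realType} {n : nat} {M : riemannianManifold R n}.
Variables (f : M -> R) (xbar : M).
Hypotheses (f_C2 : Ck_function 2 f) (xbar_min : local_min f xbar).
Local Notation c := (chart_at xbar).
Local Notation u0 := (chart_map (chart_at xbar) xbar).
Local Notation G := (metric (chart_at xbar) (chart_map (chart_at xbar) xbar)).
Local Notation F := (f \o chart_inv (chart_at xbar)).
Local Notation U := (chart_cod (chart_at xbar)).
Local Notation p := (partials (f \o chart_inv (chart_at xbar))).
Local Notation A := (hessian (f \o chart_inv (chart_at xbar)) (chart_map (chart_at xbar) xbar)).
Local Notation S := (min_set f xbar).

Let ac : atlas c. Proof. exact: chart_at_atlas. Qed.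
Let dc : chart_dom c xbar. Proof. exact: chart_at_dom. Qed.
Let Uu0 : U u0. Proof. exact: chart_dom_cod. Qed.
Let oU : open U. Proof. exact: chart_cod_open. Qed.
Let F2 : Ck_on 2 U F. Proof. exact: f_C2. Qed.
Let pG : posdef G. Proof. exact: metric_posdef. Qed.
Let F_min : \forall u \near u0, F u0 <= F u. Proof. exact: chart_local_min. Qed.

(** The gradient vanishes along a curve of solutions near [xbar]; differentiating it at time 0 gives
    [v *m A = 0]. *)
Lemma tangent_space_sub_kernel v : tangent_space S xbar v -> v *m A = 0.
Proof.
move=> [gamma [e e0 [[cg dg] gS g0 gv]]].
have I0 : `]- e, e[%classic (0 : R) by rewrite /= in_itv/= oppr_lt0 e0.
have oI : open [set` `]- e, e[] by exact: interval_open.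
pose w := chart_map c \o gamma.
have w0 : w 0 = u0 by rewrite /w /= g0.
have [dw _] := dg c ac.
have dw0 : differentiable w 0 by apply: dw; split => //=; rewrite g0.
have Dw : 'D_1 w 0 = v by rewrite -gv /velocity g0 derive1E.
have [r r0 Hr] := minimizer_critical oU Uu0 F2 F_min.
have dp : differentiable p (w 0) by rewrite w0; exact: (C1_partials oU F2).1.
have := derive_comp (1 : R) dw0 dp; rewrite Dw w0.
rewrite (strict_diff_derive _ (partials_strict_diff oU Uu0 F2)) => <-.
have E : 'D_1 (p \o w) 0 = 'D_1 (cst (0 : 'rV[R]_n) : R -> 'rV[R]_n) 0.
  apply: near_eq_derive.
  have k1 : \forall t \near (0 : R), [set` `]- e, e[] t by apply: open_nbhs_nbhs.
  have k2 : \forall t \near (0 : R), chart_dom c (gamma t).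
    by apply: (cg 0 I0); rewrite g0; exact: chart_dom_near.
  have k3 : \forall t \near (0 : R), `|w t - u0| < r.
    have cw := differentiable_continuous dw0.
    have N : nbhs (w 0) [set u : 'rV[R]_n | `|u - u0| < r].
      by rewrite w0; apply/(@near_norm R 'rV[R]_n); exists r.
    exact: (cw _ N).
  near=> t.
  rewrite /= ; apply: Hr; first by near: t.
  have [//|_ ft] := gS t _; first by near: t.
  by rewrite /w /= !chart_mapK//; near: t.
by rewrite E derive_cst.
Unshelve. all: by end_near. Qed.

Lemma EB_morse_bott mu : 0 < mu -> (forall m, 0 < m -> m < mu -> local_EB F u0 G m) ->
  morse_bott mu f xbar.
Proof.
move=> mu0 EBf.
have pu0 : p u0 = 0.
  have [r r0 Hr] := minimizer_critical oU Uu0 F2 F_min.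
  by apply: Hr => //; rewrite subrr normr0.
have [d [C [B [dn uC uB AE]]]] := rank_normal_form A.
pose D : 'M[R]_n := last_coords n d.
(* With [A = C *m D *m B], this choice gives [A *m L = C *m D], which has the rank of [A], and
   multiplying by [B] recovers [A]. *)
pose L : 'M[R]_n := invmx B *m D.
have AL : A *m L = C *m D by rewrite {1}AE /L !mulmxA mulmxK// -!mulmxA last_coords_idem.
have ALB : A = A *m L *m B by rewrite AL.
(* Any constant below [mu] describes the solution set; only the final coercivity estimate uses them
   all. *)
have m0 : 0 < mu / 2 by rewrite divr_gt0.
have mmu : mu / 2 < mu by rewrite ltr_pdivrMr// ltr_pMr// ltr1n.
have [d1 d10 Hd1] := EB_solution_set oU Uu0 F2 pG F_min m0 (EBf _ m0 mmu) ALB.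
have /near_norm[d2 d20 Hd2] := min_set_chart xbar_min.
have /near_norm[d3 d30 Hd3] := chart_cod_near Uu0.
pose d0 := Num.min d1 (Num.min d2 d3).
pose U' : set 'rV[R]_n := [set u | `|u - u0| < d0].
have U'P u : U' u -> U u /\ (S (chart_inv c u) <-> p u *m L = 0).
  rewrite /U' /= !lt_min => /and3P[ud1 ud2 ud3]; split; first exact: Hd3.
  exact: iff_trans (Hd2 _ ud2) (Hd1 _ ud1).
have U'U : U' `<=` U by move=> u /U'P[].
have oU' : open U'.
  apply/(@open_norm R 'rV[R]_n) => u uU'; exists (d0 - `|u - u0|); first by rewrite subr_gt0.
  move=> y yu; rewrite /U' /=; have := ler_normD (y - u) (u - u0); rewrite addrA subrK.
  by move: yu; lra.
have U'u0 : U' u0 by rewrite /U' /= subrr normr0 !lt_min d10 d20.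
(* The equations [p u *m L] fill the coordinates of index at least [d], and a linear map fills the
   others. The derivatives at [u0] add up to [C *m (1%:M - D) + C *m D = C], which is invertible. *)
pose Psi u := (u - u0) *m (C *m (1%:M - D)) + p u *m L.
have Psi1 : Ck_on 1 U' Psi.
  apply: C1_add => //.
    by apply: C1_mulmxr => //; exact: C1_affine.
  by apply: C1_mulmxr => //; apply: C1_subset (C1_partials oU F2).
have Psi_strict : strict_diff Psi u0 C.
  have [K K0 HK] := mulmx_bound L.
  move=> e e0; have [r r0 Hr] := partials_strict_diff oU Uu0 F2 (divr_gt0 e0 K0).
  exists r => // x y xr yr.
  have -> : Psi x - Psi y - (x - y) *m C = (p x - p y - (x - y) *m A) *m L.
    rewrite [RHS]mulmxBl -[(x - y) *m A *m L]mulmxA AL [(p x - p y) *m L]mulmxBl /Psi.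
    rewrite mulmxBr mulmx1 !mulmxBr !mulmxBl; apply/rowP => i; rewrite !mxE; ring.
  apply: le_trans (HK _) _; apply: le_trans (_ : K * (e / K * `|x - y|) <= _).
    by rewrite ler_pM2l//; exact: Hr.
  by rewrite mulrA mulrCA mulfV ?mulr1// gt_eqF.
have Psi0 : Psi u0 = 0 by rewrite /Psi subrr mul0mx pu0 mul0mx addr0.
have [W [g [oW Wu0 WU' oV [gPsi g1]]]] := inverse_function_theorem oU' U'u0 Psi1 Psi_strict uC.
have WU : W `<=` U by move=> u /WU' /U'U.
have PsiW : Ck_on 1 W Psi by exact: C1_subset Psi1.
pose s := slice_chart oW WU oV gPsi PsiW g1.
have sx : chart_dom s xbar by [].
have sS y : chart_dom s y -> (S y <-> forall i : 'I_n, (d <= i)%N -> chart_map s y 0 i = 0).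
  move=> [cy Wy]; have [_ H] := U'P _ (WU' _ Wy).
  rewrite chart_mapK// in H; apply: iff_trans H _.
  have PsiE (i : 'I_n) : (d <= i)%N -> Psi (chart_map c y) 0 i = (p (chart_map c y) *m L) 0 i.
    move=> di; rewrite /Psi mxE mulmxA mulmxBr mulmx1.
    by rewrite [X in X + _]mxE [X in _ + X + _]mxE mul_last_coordsE di subrr add0r.
  split=> [pL i di|H]; first by rewrite /= PsiE// pL mxE.
  apply/rowP => i; rewrite [RHS]mxE; have [di|di] := leqP d i.
    by rewrite -PsiE//; exact: H.
  by rewrite /L mulmxA mul_last_coordsE leqNgt di.
have hessE v : hess f xbar v = 0 <-> v *m A = 0.
  rewrite hess_chart//; split=> [E|->]; last by rewrite mul0mx.
  by rewrite -[LHS](mulmxK (posdef_unitmx pG)) -[v *m A *m G *m _]mulmxA mulmxV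
    ?posdef_unitmx// mulmx1
    -[v *m A](mulmxKV (posdef_unitmx pG)) E mul0mx.
have kernel_sub v : v *m A = 0 -> tangent_space S xbar v.
  move=> vA; pose y := v *m C.
  (* Since [v *m A = y *m D *m B] and [B] is invertible, a kernel vector has no last coordinates in
     the slice chart, and the line through [y] stays in the slice. *)
  have yD : y *m D = 0.
    apply: (can_inj (mulmxK uB)); rewrite mul0mx -vA /y AE !mulmxA//.
  have V0 : (Psi @` W) 0 by exists u0.
  have /(@near_norm R 'rV[R]_n)[r r0 Hr] := open_nbhs_nbhs (conj oV V0).
  have y1 : 0 < `|y| + 1 by rewrite ltr_wpDl.
  pose e := r / (`|y| + 1).
  have e0 : 0 < e by rewrite divr_gt0.
  have line t : t \in `]- e, e[ -> (Psi @` W) (t *: y).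
    rewrite in_itv/= -ltr_norml => te; apply: Hr; rewrite subr0 normrZ.
    apply: (@le_lt_trans _ _ (`|t| * (`|y| + 1))); first by rewrite ler_wpM2l// lerDl.
    by rewrite -ltr_pdivlMr.
  exists (fun t => chart_inv c (g (t *: y))), e => //.
  have g0 : g (0 *: y) = u0 by rewrite scale0r -Psi0 gPsi.
  split.
  - exact: (slice_line_C1 ac WU gPsi g1 line).
  - move=> t te; have [u Wu uE] := line t te.
    have [du muE] := chart_codP (WU _ Wu).
    rewrite -uE gPsi//; apply/sS; first by split; rewrite ?muE.
    move=> i di; rewrite /= muE uE.
    by have := congr1 (fun v : 'rV[R]_n => v 0 i) yD;
      rewrite mul_last_coordsE di !mxE => ->; rewrite mulr0.
  - by rewrite g0 chart_mapK.
  (* Differentiating [g (Psi u) = u] at [u0] in the direction [v] gives ['D_y g 0 = v], because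
     [y = v *m C] is the derivative of [Psi] there. *)
  - rewrite /velocity g0 chart_mapK// derive1E.
    have -> : 'D_1 (chart_map c \o (fun t => chart_inv c (g (t *: y)))) 0 =
       'D_1 (fun t : R => g (0 + t *: y)) 0.
      apply: near_eq_derive.
      have : \forall t \near (0 : R), t \in `]- e, e[.
        by apply: open_nbhs_nbhs; split; [exact: interval_open|rewrite /= in_itv/= oppr_lt0 e0].
      apply: filterS => t te; have [u Wu uE] := line t te.
      by rewrite add0r /= -uE gPsi//; have [] := chart_codP (WU _ Wu).
    have dg0 : differentiable g 0 by exact: g1.1.
    have dg0' : differentiable g (0 + (0 : R) *: y) by rewrite scale0r addr0.
    have [_ ->] := is_derive_line_diff dg0'.
    rewrite scale0r addr0.
    have dP : differentiable Psi u0 by exact: PsiW.1.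
    have dgP : differentiable g (Psi u0) by rewrite Psi0.
    have := derive_comp v dP dgP.
    rewrite (strict_diff_derive _ Psi_strict) Psi0 -/y => <-.
    rewrite -[RHS](derive_id u0); apply: near_eq_derive.
    have : \forall u \near u0, W u by exact: open_nbhs_nbhs.
    by apply: filterS => u Wu /=; rewrite gPsi.
split.
- exists (chart_dom s).
    by split; [exact: chart_dom_open|exact: sx].
  exists d => // x [Sx dx]; exists s; split => //.
    by move=> c' ac'; exact: slice_compatible.
  move=> y dy; apply: iff_trans (sS y dy); by split=> [[]|].
- apply/seteqP; split=> v /=.
    by move=> /hessE; exact: kernel_sub.
  by move=> /tangent_space_sub_kernel /hessE.
- move=> v vN.
  have uG := posdef_unitmx pG.
  have -> : inner xbar v (hess f xbar v) = bform A v v.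
    have AT := hessian_sym oU Uu0 F2.
    rewrite hess_chart// /inner /bform !trmx_mul AT !mulmxA; congr ((_ *m _) 0 0).
    by rewrite trmx_inv pG.1 mulmxK.
  apply: (EB_normal_coercive oU Uu0 F2 pG F_min (v := v) mu0 EBf) => w wA.
  exact: (vN w (kernel_sub w wA)).
Qed.

End morse_bott_property.

Theorem corollary2p17 (R : realType) (n : nat) (M : riemannianManifold R n)
    (f : M -> R) (xbar : M) (mu : R)
    (f_C2 : Ck_function 2 f) (xbar_min : local_min f xbar) (mu_gt0 : 0 < mu) :
  [/\ PL mu f xbar -> morse_bott mu f xbar,
      EB mu f xbar -> morse_bott mu f xbar &
      QG mu f xbar -> morse_bott mu f xbar].
Proof.
split=> H; apply: EB_morse_bott => // m m0 mmu.
- exact: PL_EB_chart H.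
- exact: EB_chart H.
- exact: QG_EB_chart H.
Qed.
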